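(* Let $K \subset \mathsf{PD}_{\alpha,\beta}$ and define the mapping $F : K \to \mathbb{R}^{d\times d}$ by $A \mapsto \overline{A}$, where $\overline{A}$ is the homogenized coefficient associated with $A$. Assume in addition that $K$ is compact in $L^2(\mathbb{T}^d;\mathbb{R}^{d\times d})$. Then, for any $\epsilon > 0$, there exists a Fourier neural operator (FNO) $\Phi : K \to L^\infty(\mathbb{T}^d;\mathbb{R}^{d\times d})$ such that $$\sup_{A\in K}\ \sup_{x\in\mathbb{T}^d} |F(A) - \Phi(A)(x)|_F < \epsilon.$$
   Context: $\mathbb{T}^d$ is the $d$-dimensional unit torus ($1$-periodic functions) and $|\cdot|_F$ is the Frobenius norm. For $\beta \ge \alpha > 0$ fixed, $\mathsf{PD}_{\alpha,\beta}$ is the set of symmetric-matrix-valued $A \in L^\infty(\mathbb{T}^d;\mathbb{R}^{d\times d})$ with $\alpha|\xi|^2 \le \langle \xi, A(y)\xi\rangle \le \beta|\xi|^2$ for all $(y,\xi) \in \mathbb{T}^d\times\mathbb{R}^d$ (as usual for $L^\infty$ functions, in the almost everywhere sense in $y$). $\dot{H}^1$ denotes the space of $1$-periodic, mean-zero $W^{1,2}(\mathbb{T}^d)$ functions (componentwise for vector-valued functions), with norm $\|g\|_{\dot{H}^1} = \|\nabla g\|_{L^2}$. $L^2$ norms of matrix fields use the Frobenius norm pointwise. Cell problem: for $A \in \mathsf{PD}_{\alpha,\beta}$, $\chi \in \dot{H}^1(\mathbb{T}^d;\mathbb{R}^d)$ is the unique weak solution of $-\nabla\cdot(\nabla\chi\,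 A) = \nabla\cdot A$, $\chi$ $1$-periodic; equivalently each component satisfies $-\nabla\cdot(A\nabla\chi_\ell) = \nabla\cdot(A e_\ell)$ weakly, i.e. $\int_{\mathbb{T}^d}\langle A\nabla\chi_\ell,\nabla v\rangle\,dy = -\int_{\mathbb{T}^d}\langle Ae_\ell,\nabla v\rangle\,dy$ for all $v\in\dot{H}^1(\mathbb{T}^d;\mathbb{R})$, $\ell=1,\dots,d$, with $e_\ell$ the standard basis vectors. The homogenized coefficient is $\overline{A} = \int_{\mathbb{T}^d}\left(A(y)+A(y)\nabla\chi(y)^T\right)dy$, where $(\nabla\chi)_{\ell j}=\partial_j\chi_\ell$. Fourier neural operator: a map from $\mathbb{R}^{d_a}$-valued functions $a$ on $\mathbb{T}^d$ to $\mathbb{R}^{d_u}$-valued functions on $\mathbb{T}^d$ (here $\mathbb{R}^{d\times d}$ is identified with $\mathbb{R}^{d^2}$, so $d_a=d_u=d^2$) of the form $\mathcal{Q}\circ \mathsf{L}_{T-1}\circ\dots\circ\mathsf{L}_0\circ\mathcal{P}$, with $v_0=\mathcal{P}(a)$, $v_{t+1} = \mathsf{L}_t v_t = \sigma(W_t v_t + \mathcal{K}_t v_t + b_t)$ for $t=0,\dots,T-1$, and output $u=\mathcal{Q}(v_T)$. Here $d_v$ (the number of channels) is a fixed positive integer; $\mathcal{P}:\mathbb{R}^{d_a}\to\mathbb{R}^{d_v}$ is a local lifting map and $\mathcal{Q}:\mathbb{R}^{d_v}\to\mathbb{R}^{d_u}$ a local projection map (usually multilayer perceptrons), both acting pointwise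 (almost everywhere) on functions; $\sigma:\mathbb{R}\to\mathbb{R}$ is a fixed globally Lipschitz, non-polynomial, $C^\infty$ activation function, acting pointwise and componentwise; $W_t\in\mathbb{R}^{d_v\times d_v}$ are matrices; $b_t:\mathbb{T}^d\to\mathbb{R}^{d_v}$ are bias functions; and $\mathcal{K}_t$ maps $\mathbb{R}^{d_v}$-valued functions to $\mathbb{R}^{d_v}$-valued functions via $$(\mathcal{K}_t v)_l(x) = \sum_{k\in\mathbb{Z}^d,\,|k|\le k_{\max}}\Big(\sum_{j=1}^{d_v}P^k_{lj}\,\langle v_j,\overline{\psi}_k\rangle_{L^2(\mathbb{T}^d;\mathbb{C})}\Big)\psi_k(x),\quad l=1,\dots,d_v,$$ where $\psi_k(x)=e^{2\pi i\langle k,x\rangle}$ is the Fourier basis (so $\langle v_j,\overline{\psi}_k\rangle$ denotes the Fourier coefficient of $v_j$ at frequency $k$), and $P^k\in\mathbb{C}^{d_v\times d_v}$ are parameters (depending on $t$). The depth $T$, width $d_v$, cutoff $k_{\max}$, and parameters of $\mathcal{P},\mathcal{Q},W_t,b_t,P^k$ are free to be chosen. *)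

(* Defs.v *)
From HB Require Import structures.
From mathcomp Require Import all_boot all_order all_algebra.
From mathcomp Require Import complex ring lra.
From mathcomp Require Import all_classical all_reals all_analysis measurable_realfun.

Set Implicit Arguments.
Unset Strict Implicit.
Unset Printing Implicit Defensive.

Import Order.TTheory GRing.Theory Num.Theory.
Import numFieldNormedType.Exports.

Local Open Scope classical_set_scope.
Local Open Scope ring_scope.
Local Open Scope complex_scope.

(* The sigma-algebra on matrices is the product one, generated by the entries. *)
Definition mx_display : measure_display -> measure_display.
Proof. exact. Qed.

Section measurable_matrix.
Context {disp : measure_display} {T : measurableType disp} {m n : nat}.

Definition mx_entry_preimages : set (set 'M[T]_(m, n)) :=
  [set X | exists i j (B : set T), measurable B /\
             X = (fun M : 'M[T]_(m, n) => M i j) @^-1` B].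

HB.instance Definition _ := @isMeasurable.Build (mx_display disp) 'M[T]_(m, n)
  <<s mx_entry_preimages >> (@sigma_algebra0 _ _ _)
  (@sigma_algebraC _ _) (@sigma_algebra_bigcup _ _ _).

Lemma measurable_entry (i : 'I_m) (j : 'I_n) :
  measurable_fun setT (fun M : 'M[T]_(m, n) => M i j).
Proof.
by move=> _ B mB; rewrite setTI; apply: sub_sigma_algebra; exists i, j, B.
Qed.

Lemma measurable_fun_mxP disp' (S : measurableType disp') (f : S -> 'M[T]_(m, n)) :
  measurable_fun setT f <->
  forall i j, measurable_fun setT (fun x => f x i j).
Proof.
split=> [mf i j|mf]; first exact: (measurableT_comp (measurable_entry i j) mf).
apply: (measurability mx_entry_preimages) => // _ [_ [i [j [B [mB ->]]]] <-].
exact: (mf i j measurableT B mB).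
Qed.

End measurable_matrix.

(* Lebesgue measure on the unit cube [0,1]^d, as an iterated product of the
   uniform probability on [0,1].  The torus is modelled by 1-periodic functions
   on R^d, integrated over the unit cube. *)
Section torus_measure.
Variable R : realType.

Definition cons_row (d : nat) (p : measurableTypeR R * 'rV[R]_d) : 'rV[R]_d.+1 :=
  row_mx (p.1 : R)%:M p.2 : 'rV[R]_(1 + d).

Lemma measurable_cons_row d : measurable_fun setT (@cons_row d).
Proof.
apply/measurable_fun_mxP => i j.
case: (split_ordP (j : 'I_(1 + d))) => k ->.
  rewrite (_ : (fun _ => _) = fst); first exact: measurable_fst.
  by apply/funext => p; rewrite [LHS]row_mxEl mxE (ord1 i) (ord1 k) mulr1n.
rewrite (_ : (fun _ => _) = (fun M : 'rV[R]_d => M i k) \o snd).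
  exact: (measurableT_comp (measurable_entry i k) measurable_snd).
by apply/funext => p; rewrite [LHS]row_mxEr.
Qed.

HB.instance Definition _ d :=
  isMeasurableFun.Build _ _ _ _ (@cons_row d) (@measurable_cons_row d).

Fixpoint torus (d : nat) : probability 'rV[R]_d R :=
  match d with
  | 0%N => dirac (0 : 'rV[R]_0)
  | d'.+1 => distribution (uniform_prob (@ltr01 R) \x torus d')%E (@cons_row d')
  end.

End torus_measure.

Section frobenius.
Variable R : realType.

Definition frob (m n : nat) (M : 'M[R]_(m, n)) : R :=
  Num.sqrt (\sum_i \sum_j M i j ^+ 2).

Lemma frobE m n (M : 'M[R]_(m, n)) :
  frob M = Num.sqrt (\sum_(p : 'I_m * 'I_n) M p.1 p.2 ^+ 2).
Proof. by rewrite /frob pair_bigA. Qed.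

Lemma frob_ge0 m n (M : 'M[R]_(m, n)) : 0 <= frob M.
Proof. exact: sqrtr_ge0. Qed.

Lemma frob0 m n : frob (0 : 'M[R]_(m, n)) = 0.
Proof. by rewrite frobE big1 ?sqrtr0// => p _; rewrite mxE expr0n. Qed.

Lemma frobN m n (M : 'M[R]_(m, n)) : frob (- M) = frob M.
Proof. by rewrite !frobE; under eq_bigr do rewrite mxE sqrrN. Qed.

Lemma sqr_frob m n (M : 'M[R]_(m, n)) :
  frob M ^+ 2 = \sum_(p : 'I_m * 'I_n) M p.1 p.2 ^+ 2.
Proof. by rewrite frobE sqr_sqrtr// sumr_ge0// => p _; exact: sqr_ge0. Qed.

Lemma frob_eq0 m n (M : 'M[R]_(m, n)) : frob M = 0 -> M = 0.
Proof.
move=> M0; have /esym := sqr_frob M; rewrite M0 expr0n/= => s0.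
apply/matrixP => i j; rewrite mxE; apply/eqP; rewrite -sqrf_eq0; apply/eqP.
have ge0 (p : 'I_m * 'I_n) : true -> 0 <= M p.1 p.2 ^+ 2 by rewrite sqr_ge0.
exact: (psumr_eq0P ge0 s0 (erefl : (xpredT (i, j)))).
Qed.

Lemma frob_cauchy_schwarz m n (M N : 'M[R]_(m, n)) :
  \sum_(p : 'I_m * 'I_n) M p.1 p.2 * N p.1 p.2 <= frob M * frob N.
Proof.
have [/frob_eq0 ->|M0] := eqVneq (frob M) 0.
  by rewrite frob0 mul0r big1// => p _; rewrite mxE mul0r.
have [/frob_eq0 ->|N0] := eqVneq (frob N) 0.
  by rewrite frob0 mulr0 big1// => p _; rewrite mxE mulr0.
have XY : 0 < frob M * frob N by rewrite mulr_gt0// lt_neqAle eq_sym frob_ge0 andbT.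
have : 0 <= \sum_(p : 'I_m * 'I_n)
    (frob N * M p.1 p.2 - frob M * N p.1 p.2) ^+ 2.
  by apply: sumr_ge0 => p _; exact: sqr_ge0.
rewrite (eq_bigr (fun p => frob N ^+ 2 * M p.1 p.2 ^+ 2 +
    frob M ^+ 2 * N p.1 p.2 ^+ 2 -
    2 * (frob M * frob N) * (M p.1 p.2 * N p.1 p.2))); last first.
  by move=> p _; ring.
rewrite sumrB big_split/= -!mulr_sumr -!sqr_frob subr_ge0.
rewrite (_ : _ + _ = 2 * (frob M * frob N) * (frob M * frob N)); last by ring.
by rewrite ler_pM2l// mulr_gt0.
Qed.

Lemma frob_triangle m n (M N : 'M[R]_(m, n)) : frob (M + N) <= frob M + frob N.
Proof.
rewrite -ler_sqr ?nnegrE ?addr_ge0 ?frob_ge0// sqr_frob.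
rewrite (eq_bigr (fun p => M p.1 p.2 ^+ 2 + N p.1 p.2 ^+ 2 +
    2 * (M p.1 p.2 * N p.1 p.2))); last by move=> p _; rewrite mxE; ring.
rewrite !big_split/= -mulr_sumr -!sqr_frob sqrrD.
have := frob_cauchy_schwarz M N.
lra.
Qed.

Lemma measurable_frob m n : measurable_fun setT (@frob m n).
Proof.
have mS : measurable_fun setT (fun M : 'M[R]_(m, n) => \sum_i \sum_j M i j ^+ 2).
  apply: measurable_sum => i; apply: measurable_sum => j.
  by apply: measurable_funX; exact: measurable_entry.
exact: (measurableT_comp (continuous_measurable_fun (@sqrt_continuous R)) mS).
Qed.

End frobenius.

Section lebesgue_fields.
Variables (R : realType) (d : nat).
Notation Rd := 'rV[R]_d.

Definition periodic (V : Type) (f : Rd -> V) :=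
  forall (x : Rd) (i : 'I_d), f (x + delta_mx 0 i) = f x.

(* 1-periodic matrix (or column vector) fields in L^p, with the Frobenius
   (Euclidean) norm pointwise. *)
Definition Lp (m n : nat) (p : \bar R) (f : Rd -> 'M[R]_(m, n)) :=
  [/\ periodic f, measurable_fun setT f &
      ('N[torus R d]_p [EFin \o (fun x => frob (f x))] < +oo)%E].

Record L2_field := L2Field {
  field_fun :> Rd -> 'M[R]_d;
  field_L2 : Lp 2%:E field_fun }.

HB.instance Definition _ := gen_eqMixin L2_field.
HB.instance Definition _ := gen_choiceMixin L2_field.

Definition L2_dist (A B : L2_field) : \bar R :=
  'N[torus R d]_2%:E [EFin \o (fun x => frob (A x - B x))].

Let ball (A : L2_field) (e : R) : set L2_field :=
  [set B | (L2_dist A B < e%:E)%E].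

Let ent : set_system (L2_field * L2_field) := entourage_ ball.

Let nbhs (A : L2_field) : set_system L2_field := nbhs_ ent A.

Let nbhsE : nbhs = nbhs_ ent. Proof. by []. Qed.

HB.instance Definition _ := hasNbhs.Build L2_field nbhs.

Let measurable_sub (A B : L2_field) :
  measurable_fun setT (fun x => frob (A x - B x)).
Proof.
apply: (measurableT_comp (@measurable_frob R d d)).
case: A B => [A [_ mA _]] [B [_ mB _]] /=.
apply/measurable_fun_mxP => i j.
rewrite (_ : (fun _ => _) = (fun x => A x i j) \- (fun x => B x i j)).
  by apply: measurable_funB; [move/measurable_fun_mxP : mA
                             |move/measurable_fun_mxP : mB]; exact.
by apply/funext => x; rewrite /= !mxE.
Qed.

Let ball_center A (e : R) : 0 < e -> ball A e A.
Proof.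
move=> e0; rewrite /ball/= /L2_dist (_ : EFin \o _ = cst 0%E).
  by rewrite Lnorm0 ?lte_fin// eqe pnatr_eq0.
by apply/funext => x /=; rewrite subrr frob0.
Qed.

Let ball_sym A B (e : R) : ball A e B -> ball B e A.
Proof.
rewrite /ball/= /L2_dist (_ : (fun x => frob (B x - A x)) =
  (fun x => frob (A x - B x)))//.
by apply/funext => x; rewrite -frobN opprB.
Qed.

Let mL2 (f : Rd -> R) : measurable_fun setT f ->
  measurable_fun setT (fun x => `|(f x)%:E| `^ 2)%E.
Proof.
move=> mf.
suff : measurable_fun setT (EFin \o (fun x => `|f x| `^ 2)) by [].
apply/measurable_EFinP/(@measurableT_comp _ _ _ _ _ _ (@powR R ^~ 2)) => //.
exact: measurableT_comp.
Qed.

Let ball_triangle A B C (e1 e2 : R) :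
  ball A e1 B -> ball B e2 C -> ball A (e1 + e2) C.
Proof.
rewrite /ball/= => AB BC; rewrite EFinD; apply: le_lt_trans (lteD AB BC).
apply: le_trans (minkowski_EFin _ (measurable_sub A B) (measurable_sub B C) _).
  rewrite /L2_dist unlock; apply: gt0_ler_poweR.
  - by rewrite invr_ge0.
  - by rewrite in_itv/= leey integral_ge0.
  - by rewrite in_itv/= leey integral_ge0.
  apply: ge0_le_integral => //.
  - by move=> x _; exact: poweR_ge0.
  - exact: (mL2 (measurable_sub A C)).
  - exact: (mL2 (measurable_funD (measurable_sub A B) (measurable_sub B C))).
  - move=> x _; rewrite lee_fin ge0_ler_powR ?nnegrE// ger0_norm ?frob_ge0//.
    rewrite ger0_norm ?addr_ge0 ?frob_ge0//.
    by rewrite (le_trans _ (frob_triangle _ _))// addrA subrK.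
by rewrite ler1n.
Qed.

Let entourageE : ent = entourage_ ball. Proof. by []. Qed.

HB.instance Definition _ := @Nbhs_isPseudoMetric.Build R L2_field
  ent nbhsE ball ball_center ball_sym ball_triangle entourageE.

End lebesgue_fields.

Section sobolev.
Variables (R : realType) (d : nat).
Notation Rd := 'rV[R]_d.
Notation mu := (torus R d).

Definition partial (j : 'I_d) (f : Rd -> R) : Rd -> R :=
  fun x => 'D_(delta_mx 0 j) f x.

Definition smooth_periodic (f : Rd -> R) :=
  periodic f /\
  forall (s : seq 'I_d) (x : Rd), differentiable (foldr partial f s) x.

Definition scalar_L2 (g : Rd -> R) := periodic g /\ g \in Lfun mu 2%:E.

(* G is the weak gradient of g on the torus. *)
Definition weak_gradient (g : Rd -> R) (G : Rd -> 'cV[R]_d) :=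
  forall (phi : Rd -> R) (j : 'I_d), smooth_periodic phi ->
    \int[mu]_x (g x * partial j phi x) = - \int[mu]_x (G x j 0 * phi x).

(* g belongs to the mean-zero space \dot H^1 and has weak gradient G; G is
   carried along because it is determined by g only almost everywhere. *)
Definition H1dot (g : Rd -> R) (G : Rd -> 'cV[R]_d) :=
  [/\ scalar_L2 g, Lp 2%:E G, weak_gradient g G & \int[mu]_x g x = 0].

End sobolev.

Section homogenization.
Variables (R : realType) (d : nat).
Notation Rd := 'rV[R]_d.
Notation mu := (torus R d).

Definition dotv (u v : 'cV[R]_d) : R := \sum_i u i 0 * v i 0.

Definition PD (alpha beta : R) : set (Rd -> 'M[R]_d) :=
  [set A | [/\ Lp +oo A,
               {ae mu, forall y, (A y)^T = A y} &
               {ae mu, forall y, forall xi : 'cV[R]_d,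
                 alpha * dotv xi xi <= dotv xi (A y *m xi) <=
                   beta * dotv xi xi}]].

(* Dchi y l j is the j-th partial derivative of the l-th component of chi. *)
Definition is_corrector (A : Rd -> 'M[R]_d)
    (chi : Rd -> 'cV[R]_d) (Dchi : Rd -> 'M[R]_d) :=
  forall l : 'I_d,
    H1dot (fun y => chi y l 0) (fun y => (row l (Dchi y))^T) /\
    forall (v : Rd -> R) (Dv : Rd -> 'cV[R]_d), H1dot v Dv ->
      \int[mu]_y dotv (A y *m (row l (Dchi y))^T) (Dv y) =
      - \int[mu]_y dotv (A y *m delta_mx l 0) (Dv y).

Definition corrector (A : Rd -> 'M[R]_d) :
    (Rd -> 'cV[R]_d) * (Rd -> 'M[R]_d) :=
  get [set c | is_corrector A c.1 c.2].

Definition homogenized (A : Rd -> 'M[R]_d) : 'M[R]_d :=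
  let Dchi := (corrector A).2 in
  \matrix_(i, j) \int[mu]_y (A y + A y *m (Dchi y)^T) i j.

End homogenization.

Section neural_operator.
Variable R : realType.

(* Multilayer perceptrons: affine maps with the activation in between (none
   after the last affine map). *)
Inductive mlp : nat -> nat -> Type :=
| MlpLast m n (W : 'M[R]_(n, m)) (b : 'cV[R]_n) : mlp m n
| MlpLayer m p n (W : 'M[R]_(p, m)) (b : 'cV[R]_p) (rest : mlp p n) : mlp m n.

Fixpoint mlp_eval (sigma : R -> R) (m n : nat) (N : mlp m n) :
    'cV[R]_m -> 'cV[R]_n :=
  match N in mlp m n return 'cV[R]_m -> 'cV[R]_n with
  | MlpLast _ _ W b => fun x => W *m x + b
  | MlpLayer _ _ _ W b rest =>
      fun x => mlp_eval sigma rest (map_mx sigma (W *m x + b))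
  end.

Variable d : nat.
Notation Rd := 'rV[R]_d.
Notation mu := (torus R d).
Notation freq := 'rV[int]_d.

Definition phase (k : freq) (x : Rd) : R :=
  2 * pi * \sum_i (k 0 i)%:~R * x 0 i.

Definition fourier_basis (k : freq) (x : Rd) : R[i] :=
  cos (phase k x) +i* sin (phase k x).

(* int v_j(x) exp(- 2 pi i <k, x>) dx, split into real and imaginary parts *)
Definition fourier_coef (dv : nat) (v : Rd -> 'cV[R]_dv) (k : freq) :
    'cV[R[i]]_dv :=
  \col_j ((\int[mu]_x (v x j 0 * cos (phase k x))) +i*
          (- \int[mu]_x (v x j 0 * sin (phase k x)))).

Definition low_freqs (kmax : nat) : set freq :=
  [set k | \sum_i k 0 i ^+ 2 <= kmax%:Z ^+ 2].

Lemma finite_low_freqs kmax : finite_set (low_freqs kmax).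
Proof.
pose F (f : {ffun 'I_d -> 'I_(kmax + kmax).+1}) : freq :=
  \row_i ((f i)%:Z - kmax%:Z).
have : finite_set (F @` setT) by apply: finite_image; exact: finite_finset.
apply: sub_finite_set => k /= kk.
have kb i : (`|k 0 i| <= kmax%:Z).
  rewrite -ler_sqr ?nnegrE// real_normK ?num_real//; apply: le_trans kk.
  rewrite (bigD1 i)//= lerDl sumr_ge0// => j _; exact: sqr_ge0.
exists [ffun i => inord (absz (k 0 i + kmax%:Z))] => //.
apply/rowP => i; rewrite mxE ffunE.
have := kb i; rewrite ler_norml => /andP[k1 k2].
have k0 : 0 <= k 0 i + kmax%:Z by lra.
rewrite inordK; first by rewrite gez0_abs// addrK.
by rewrite ltnS -lez_nat gez0_abs// PoszD lerD2r.
Qed.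

Definition fourier_op (dv kmax : nat) (P : freq -> 'M[R[i]]_dv)
    (v : Rd -> 'cV[R]_dv) (x : Rd) : 'cV[R[i]]_dv :=
  \sum_(k \in low_freqs kmax) fourier_basis k x *: (P k *m fourier_coef v k).

(* [multiplier_real] expresses that the Fourier operator maps real fields to
   real fields, so that taking the real part in [layer_eval] loses nothing. *)
Record fno_layer (dv kmax : nat) := FnoLayer {
  weight : 'M[R]_dv;
  bias : Rd -> 'cV[R]_dv;
  bias_bounded : Lp +oo bias;
  multiplier : freq -> 'M[R[i]]_dv;
  multiplier_real : forall v : Rd -> 'cV[R]_dv, Lp 2%:E v ->
    forall x l, complex.Im (fourier_op kmax multiplier v x l 0) = 0 }.

Definition layer_eval (sigma : R -> R) (dv kmax : nat)
    (L : fno_layer dv kmax) (v : Rd -> 'cV[R]_dv) : Rd -> 'cV[R]_dv :=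
  fun x => map_mx sigma (weight L *m v x
    + map_mx (@complex.Re R) (fourier_op kmax (multiplier L) v x) + bias L x).

Record fno (da du : nat) := Fno {
  width : nat;
  width_gt0 : (0 < width)%N;
  cutoff : nat;
  lifting : mlp da width;
  layers : seq (fno_layer width cutoff);
  depth_gt0 : (0 < size layers)%N;
  projection : mlp width du }.

Definition fno_eval (sigma : R -> R) (da du : nat) (N : fno da du)
    (a : Rd -> 'cV[R]_da) : Rd -> 'cV[R]_du :=
  let v0 := fun x => mlp_eval sigma (lifting N) (a x) in
  let vT := foldl (fun v L => layer_eval sigma L v) v0 (layers N) in
  fun x => mlp_eval sigma (projection N) (vT x).

(* [fno_eval] on matrix fields, with R^(d x d) identified with R^(d^2) *)
Definition fno_eval_mx (sigma : R -> R) (N : fno (d * d) (d * d))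
    (A : Rd -> 'M[R]_d) : Rd -> 'M[R]_d :=
  fun x => vec_mx (fno_eval sigma N (fun y => (mxvec (A y))^T) x)^T.

End neural_operator.

Section activation.
Variable R : realType.

Definition smooth (s : R -> R) := forall n x, derivable (derive1n n s) x 1.

Definition polynomial_fun (s : R -> R) := exists p : {poly R}, s = horner p.

End activation.

(* Main.v *)
From HB Require Import structures.
From mathcomp Require Import all_boot all_order all_algebra.
From mathcomp Require Import complex ring lra.
From mathcomp Require Import all_classical all_reals all_analysis.
From mathcomp Require Import measurable_realfun ess_sup_inf.
From mathcomp Require finmap.
Require Import Defs.

(* The homogenized coefficient depends continuously on the coefficient field in
   L^2, uniformly over fields with given ellipticity bounds: correctors exist
   by minimizing the energy over the mean-zero Sobolev space, which is complete
   by the Poincare inequality, and testing the two cell problems with the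
   difference of the correctors bounds the gap by the L^2 norm of
   (A - B)(e_l + grad chi_l), which tends to 0 when A tends to B in L^2 with
   bounded entries.

   On the compact set K, a continuous F is uniformly close to
   max_i (F B_i - c_i * |A - B_i|^2) for finitely many B_i in K: the penalty
   removes the centres far from A.  A Fourier neural operator can evaluate this
   formula: the bias of the first layer is a free bounded function, hence may
   contain the entries of B_i, and second differences of sigma at a point where
   its second derivative does not vanish approximate squares; averaging (the
   zero Fourier mode) in the second layer gives the squared distances as
   constant fields; and an MLP computes maxima, since |t| is a limit of
   polynomials obtained by iterated squaring. *)

Set Implicit Arguments.
Unset Strict Implicit.
Unset Printing Implicit Defensive.

Import Order.TTheory GRing.Theory Num.Theory.
Import numFieldNormedType.Exports.

Local Open Scope classical_set_scope.
Local Open Scope ring_scope.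

(** * Square-integrable functions on a probability space *)

(** The gap between two coefficients involves the product of [A - B], small only in L^2, with a
    gradient known only to be in L^2. Boundedness of [A - B] and truncation of the gradient make
    this product small, but with a modulus that depends on [B]; hence a separate radius and penalty
    constant at each centre. The Poincare inequality rests on the completeness of a trigonometric
    system; the real functions cos + sin replace complex exponentials, so that every integral stays
    real. On the network side, a Fourier operator is linear, so the squaring must happen before the
    average: the available features are means of [sigma] applied to an affine image of [A x], with a
    bias depending on x, and a squared distance is close to a combination of such means. The
    remaining obstacle is depth. Perceptrons run side by side only when their depths agree, and the
    identity need not have an exact realization through [sigma]; it is recovered from squares by
    polarization, so that what is approximable at one depth is so at all larger ones. *)

Section square_integrable.
Context {disp : measure_display} {T : measurableType disp} {R : realType}.
Variable mu : probability T R.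
Implicit Types (f g h : T -> R).

Definition rint (f : T -> R) := mu.-integrable setT (EFin \o f).

Local Notation L2 := (Lfun mu 2%:E).

Lemma rintW f : rint f -> measurable_fun setT f.
Proof. by move/measurable_int => /measurable_EFinP. Qed.

Lemma rintD f g : rint f -> rint g -> rint (fun x => f x + g x).
Proof. exact: integrableD. Qed.

Lemma rintB f g : rint f -> rint g -> rint (fun x => f x - g x).
Proof. exact: integrableB. Qed.

Lemma rintZ c f : rint f -> rint (fun x => c * f x).
Proof. by move=> /(integrableZl measurableT c). Qed.

Lemma rint_cst c : rint (fun=> c).
Proof. exact: finite_measure_integrable_cst. Qed.

Lemma rint_sum (I : Type) (s : seq I) (F : I -> T -> R) :
  (forall i, rint (F i)) -> rint (fun x => \sum_(i <- s) F i x).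
Proof.
move=> iF; elim: s => [|i s ih].
  by under eq_fun do rewrite big_nil; exact: rint_cst.
by under eq_fun do rewrite big_cons; exact: rintD.
Qed.

Lemma rint_norm f : rint f -> rint (fun x => `|f x|).
Proof. exact: integrable_norm. Qed.

Lemma rint_le_ae f g : measurable_fun setT f -> rint g ->
  {ae mu, forall x, `|f x| <= g x} -> rint f.
Proof.
move=> mf ig fg; have mg := rintW ig.
apply/integrableP; split; first exact/measurable_EFinP.
have /integrableP[_ +] := rint_norm ig.
apply: le_lt_trans; apply: ae_ge0_le_integral => //.
- by apply: measurableT_comp => //; exact/measurable_EFinP.
- apply: measurableT_comp => //; apply/measurable_EFinP.
  exact: measurableT_comp.
apply: filterS fg => x fg _; rewrite /= lee_fin normr_id.
by rewrite (le_trans fg)// ler_norm.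
Qed.

Lemma rint_le f g : measurable_fun setT f -> rint g ->
  (forall x, `|f x| <= g x) -> rint f.
Proof. by move=> mf ig fg; apply: (rint_le_ae mf ig); exact: aeW. Qed.

Lemma intD f g : rint f -> rint g ->
  \int[mu]_x (f x + g x) = \int[mu]_x f x + \int[mu]_x g x.
Proof. by move=> fi gi; rewrite RintegralD. Qed.

Lemma intB f g : rint f -> rint g ->
  \int[mu]_x (f x - g x) = \int[mu]_x f x - \int[mu]_x g x.
Proof. by move=> fi gi; rewrite RintegralB. Qed.

Lemma intZ c f : rint f -> \int[mu]_x (c * f x) = c * \int[mu]_x f x.
Proof. by move=> fi; rewrite RintegralZl. Qed.

Lemma int_cst c : \int[mu]_x c = c.
Proof. by rewrite Rintegral_cst// [X in fine X]probability_setT mulr1. Qed.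

Lemma int_sum (I : Type) (s : seq I) (F : I -> T -> R) :
  (forall i, rint (F i)) ->
  \int[mu]_x (\sum_(i <- s) F i x) = \sum_(i <- s) \int[mu]_x F i x.
Proof.
move=> iF; elim: s => [|i s ih].
  by rewrite big_nil; under eq_Rintegral do rewrite big_nil; exact: int_cst.
under eq_Rintegral do rewrite big_cons.
by rewrite big_cons intD// ?ih//; exact: rint_sum.
Qed.

Lemma int_ge0_ae f : rint f -> {ae mu, forall x, 0 <= f x} -> 0 <= \int[mu]_x f x.
Proof.
move=> fi f0; have mf := rintW fi.
rewrite /Rintegral (@ae_eq_integral _ _ _ _ _ (EFin \o (fun x => `|f x|)))//.
- by apply: Rintegral_ge0.
- exact/measurable_EFinP.
- by apply/measurable_EFinP; exact: measurableT_comp.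
- by apply: filterS f0 => x f0 _ /=; rewrite ger0_norm.
Qed.

Lemma int_le_ae f g : rint f -> rint g -> {ae mu, forall x, f x <= g x} ->
  \int[mu]_x f x <= \int[mu]_x g x.
Proof.
move=> fi gi fg; rewrite -subr_ge0 -intB//; apply: int_ge0_ae; first exact: rintB.
by apply: filterS fg => x; rewrite subr_ge0.
Qed.

Lemma int_le f g : rint f -> rint g -> (forall x, f x <= g x) ->
  \int[mu]_x f x <= \int[mu]_x g x.
Proof. by move=> fi gi fg; apply: int_le_ae => //; exact: aeW. Qed.

Lemma int_eq_ae f g : measurable_fun setT f -> measurable_fun setT g ->
  {ae mu, forall x, f x = g x} -> \int[mu]_x f x = \int[mu]_x g x.
Proof.
move=> mf mg fg; rewrite /Rintegral; congr fine.
apply: ae_eq_integral => //; [exact/measurable_EFinP|exact/measurable_EFinP|].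
by apply: filterS fg => x /= ->.
Qed.

Lemma int_norm f : rint f -> `|\int[mu]_x f x| <= \int[mu]_x `|f x|.
Proof. by move=> fi; exact: le_normr_Rintegral. Qed.

Lemma L2P f : f \in L2 <-> measurable_fun setT f /\ rint (fun x => f x ^+ 2).
Proof.
split=> [l2f|[mf /integrableP[_ fi]]].
  split; last exact: Lfun2_integrable_sqr.
  by move: l2f; rewrite inE => /andP[/[!inE]].
rewrite inE; apply/andP; split; rewrite inE//= /finite_norm.
rewrite unlock poweR_lty//.
apply: le_lt_trans fi; rewrite le_eqVlt; apply/orP; left; apply/eqP.
by apply: eq_integral => x _ /=; rewrite normrX powR_mulrn.
Qed.

Lemma L2_meas f : f \in L2 -> measurable_fun setT f.
Proof. by case/L2P. Qed.

Lemma L2_sqr f : f \in L2 -> rint (fun x => f x ^+ 2).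
Proof. by case/L2P. Qed.

Lemma L2_mul f g : f \in L2 -> g \in L2 -> rint (fun x => f x * g x).
Proof. by move=> fL gL; apply/Lfun1_integrable; exact: Lfun2_mul_Lfun1. Qed.

Lemma L2_cst c : (fun=> c) \in L2.
Proof. by apply/L2P; split=> //; exact: rint_cst. Qed.

Lemma L2_rint f : f \in L2 -> rint f.
Proof.
move=> /L2_mul /(_ (L2_cst 1)).
by under eq_fun do rewrite mulr1.
Qed.

Lemma L2D f g : f \in L2 -> g \in L2 -> (fun x => f x + g x) \in L2.
Proof.
move=> fL gL; apply/L2P; split.
  by apply: measurable_funD; exact: L2_meas.
rewrite (_ : (fun x => _) =
  (fun x => f x ^+ 2 + (2 * (f x * g x) + g x ^+ 2))); last first.
  by apply/funext => x; ring.
by apply: rintD; [exact: L2_sqr|apply: rintD;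
  [exact/rintZ/L2_mul|exact: L2_sqr]].
Qed.

Lemma L2Z c f : f \in L2 -> (fun x => c * f x) \in L2.
Proof.
move=> fL; apply/L2P; split.
  by apply: measurable_funM => //; exact: L2_meas.
under eq_fun do rewrite exprMn; exact/rintZ/L2_sqr.
Qed.

Lemma L2N f : f \in L2 -> (fun x => - f x) \in L2.
Proof. by move=> /(L2Z (-1)); under eq_fun do rewrite mulN1r. Qed.

Lemma L2B f g : f \in L2 -> g \in L2 -> (fun x => f x - g x) \in L2.
Proof. by move=> fL /L2N; exact: L2D. Qed.

Lemma L2_sum (I : Type) (s : seq I) (F : I -> T -> R) :
  (forall i, F i \in L2) -> (fun x => \sum_(i <- s) F i x) \in L2.
Proof.
move=> iF; elim: s => [|i s ih].
  by under eq_fun do rewrite big_nil; exact: L2_cst.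
by under eq_fun do rewrite big_cons; exact: L2D.
Qed.

Lemma L2_le_ae f g : measurable_fun setT f -> g \in L2 ->
  {ae mu, forall x, `|f x| <= `|g x| } -> f \in L2.
Proof.
move=> mf gL fg; apply/L2P; split=> //.
apply: (rint_le_ae _ (L2_sqr gL)); first exact: measurable_funX.
apply: filterS fg => x fg.
by rewrite normrX -[leRHS]ger0_norm ?sqr_ge0// normrX lerXn2r// nnegrE.
Qed.

Lemma L2_bounded M f : measurable_fun setT f -> {ae mu, forall x, `|f x| <= M} ->
  f \in L2.
Proof.
move=> mf fM; apply: (L2_le_ae mf (L2_cst M)).
by apply: filterS fM => x fM; rewrite (le_trans fM)// ler_norm.
Qed.

Lemma L2_boundedM M f g : measurable_fun setT f ->
  {ae mu, forall x, `|f x| <= M} -> g \in L2 -> (fun x => f x * g x) \in L2.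
Proof.
move=> mf fM gL; apply: (L2_le_ae _ (L2Z M gL)).
  by apply: measurable_funM => //; exact: L2_meas.
apply: filterS fM => x fM.
by rewrite !normrM ler_wpM2r// (le_trans fM)// ler_norm.
Qed.

Definition n2 f : R := \int[mu]_x (f x ^+ 2).

Lemma n2_ge0 f : 0 <= n2 f.
Proof. by apply: Rintegral_ge0 => x _; exact: sqr_ge0. Qed.

Lemma n2Z c f : f \in L2 -> n2 (fun x => c * f x) = c ^+ 2 * n2 f.
Proof.
move=> fL; rewrite /n2; under eq_Rintegral do rewrite exprMn.
by rewrite intZ//; exact: L2_sqr.
Qed.

Lemma n2B_sym f g : n2 (fun x => f x - g x) = n2 (fun x => g x - f x).
Proof. by apply: eq_Rintegral => x _; rewrite -opprB sqrrN. Qed.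

Lemma n2_eq_ae f g : f \in L2 -> g \in L2 -> {ae mu, forall x, f x = g x} ->
  n2 f = n2 g.
Proof.
move=> fL gL fg; apply: int_eq_ae.
- exact/rintW/L2_sqr.
- exact/rintW/L2_sqr.
- by apply: filterS fg => x ->.
Qed.

Lemma n2_le_ae f g : f \in L2 -> g \in L2 ->
  {ae mu, forall x, `|f x| <= `|g x|} -> n2 f <= n2 g.
Proof.
move=> fL gL fg; apply: int_le_ae; [exact: L2_sqr|exact: L2_sqr|].
apply: filterS fg => x fg.
by rewrite -[leLHS]ger0_norm ?sqr_ge0// -[leRHS]ger0_norm ?sqr_ge0// !normrX
  lerXn2r// nnegrE.
Qed.

Lemma n2D_le f g : f \in L2 -> g \in L2 ->
  n2 (fun x => f x + g x) <= 2 * n2 f + 2 * n2 g.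
Proof.
move=> fL gL; rewrite /n2 -!intZ ?L2_sqr// -intD; last 2 first.
- exact/rintZ/L2_sqr.
- exact/rintZ/L2_sqr.
apply: int_le; [exact/L2_sqr/L2D|by apply: rintD; exact/rintZ/L2_sqr|].
by move=> x; have := sqr_ge0 (f x - g x); lra.
Qed.

Lemma n2_add_expand f g t : f \in L2 -> g \in L2 ->
  n2 (fun x => f x + t * g x) =
  n2 f + 2 * t * (\int[mu]_x (f x * g x)) + t ^+ 2 * n2 g.
Proof.
move=> fL gL; rewrite /n2.
rewrite (@eq_Rintegral _ _ _ _ _ (fun x => f x ^+ 2 + 2 * t * (f x * g x) +
  t ^+ 2 * g x ^+ 2)); last by move=> x _; ring.
have i1 := L2_sqr fL; have i2 := rintZ (2 * t) (L2_mul fL gL).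
have i3 := rintZ (t ^+ 2) (L2_sqr gL).
rewrite intD//; last exact: rintD.
by rewrite intD// !intZ//; do ?[exact: L2_mul|exact: L2_sqr].
Qed.

End square_integrable.

(** Evaluation at the vertex [- b / c]; when [c = 0], a nonzero slope would allow the value -1. This
    is the common source of the Cauchy-Schwarz inequalities and of the Euler-Lagrange estimate for
    almost minimizers. *)
Lemma discriminant_le (R : realType) (a b c : R) : 0 <= c ->
  (forall t, 0 <= a + 2 * t * b + t ^+ 2 * c) -> b ^+ 2 <= a * c.
Proof.
move=> c0 H; have a0 : 0 <= a by have := H 0; rewrite mulr0 mul0r expr0n/= mul0r !addr0.
have [c00|cn0] := eqVneq c 0.
  have [->|b0] := eqVneq b 0; first by rewrite expr0n/= mulr_ge0.
  have := H (- (a + 1) / (2 * b)).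
  rewrite c00 mulr0 addr0.
  rewrite (_ : 2 * _ * b = - (a + 1)); last by field; rewrite b0.
  lra.
have := H (- b / c).
rewrite (_ : _ + _ = (a * c - b ^+ 2) / c); last by field.
by rewrite pmulr_lge0 ?invr_gt0 ?subr_ge0// lt_neqAle eq_sym cn0.
Qed.

Section square_integrable2.
Context {disp : measure_display} {T : measurableType disp} {R : realType}.
Variable mu : probability T R.
Implicit Types (f g h : T -> R).
Local Notation L2 := (Lfun mu 2%:E).

Lemma L2_cauchy_schwarz f g : f \in L2 -> g \in L2 ->
  (\int[mu]_x (f x * g x)) ^+ 2 <= n2 mu f * n2 mu g.
Proof.
move=> fL gL; apply: discriminant_le; first exact: n2_ge0.
by move=> t; rewrite -n2_add_expand//; exact: n2_ge0.
Qed.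

Lemma int_sqr_le f : f \in L2 -> (\int[mu]_x f x) ^+ 2 <= n2 mu f.
Proof.
move=> fL; have := L2_cauchy_schwarz fL (L2_cst mu 1).
under eq_Rintegral do rewrite mulr1.
by rewrite {2}/n2 int_cst expr1n mulr1.
Qed.

Lemma n2_eq0_ae f : f \in L2 -> n2 mu f <= 0 -> {ae mu, forall x, f x = 0}.
Proof.
move=> fL f0.
have i2 : mu.-integrable setT (EFin \o (fun x => f x ^+ 2)) := L2_sqr fL.
have : ae_eq mu setT (EFin \o (fun x => f x ^+ 2)) (cst 0%E).
  apply/ae_eq_integral_abs => //; first exact: measurable_int i2.
  under eq_integral => x _ do rewrite /= ger0_norm ?sqr_ge0//.
  have := integrable_fin_num measurableT i2 => /fineK <-.
  by congr EFin; apply/eqP; rewrite eq_le f0 n2_ge0.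
by apply: filterS => x /(_ I) [] /eqP; rewrite sqrf_eq0 => /eqP.
Qed.

End square_integrable2.

(** * Completeness of L^2 *)

Section riesz_fischer.
Context {disp : measure_display} {T : measurableType disp} {R : realType}.
Variable mu : probability T R.
Implicit Types (f g h : T -> R) (u w : nat -> T -> R).
Local Notation L2 := (Lfun mu 2%:E).

(** The bound is on an extended real integral because nothing yet says that [f] is integrable;
    integrability is what is drawn from it. *)
Lemma cvg_fatou w f e : (forall k, measurable_fun setT (w k)) -> (forall k x, 0 <= w k x) ->
  measurable_fun setT f ->
  {ae mu, forall x, w k x @[k --> \oo] --> f x} ->
  (forall k, (\int[mu]_x (w k x)%:E <= e%:E)%E) ->
  (\int[mu]_x `|f x|%:E <= e%:E)%E.
Proof.
move=> mw w0 mf wf we.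
have mE k : measurable_fun setT (EFin \o w k) by exact/measurable_EFinP.
have w0' k x : setT x -> (0 <= (EFin \o w k) x)%E by move=> _; rewrite lee_fin.
apply: (@le_trans _ _ (\int[mu]_x limn_einf (fun k => (w k x)%:E))%E); last first.
  apply: le_trans (fatou mu measurableT mE w0') _.
  rewrite limn_einf_lim; apply: lime_le; first exact: is_cvg_einfs.
  apply: nearW => n; apply: le_trans (we n); apply: ereal_inf_lbound.
  by exists n => //=.
rewrite le_eqVlt; apply/orP; left; apply/eqP; apply: ge0_ae_eq_integral => //.
- by apply/measurable_EFinP; apply: (measurableT_comp (@normr_measurable R setT)  mf).
- have mN : measurable_fun setT (fun x => limn_esup (fun k => - (w k x)%:E)%E).
    apply: (@measurable_fun_limn_esup _ _ _ _ (fun k x => (- (w k x)%:E)%E)) => k.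
    exact: (measurableT_comp (@oppe_measurable R setT) (mE k)).
  rewrite (_ : (fun x => _) = (fun x => - limn_esup (fun k => - (w k x)%:E))%E).
    exact: (measurableT_comp (@oppe_measurable R setT) mN).
  by apply/funext => x; rewrite -limn_einfN; congr limn_einf; apply/funext => k /=; rewrite opprK.
- move=> x _; apply: (@le_trans _ _ (einfs (fun k => (w k x)%:E) 0)).
    by apply: le_ereal_inf_tmp => _ [n _ <-]; rewrite lee_fin.
  by rewrite limn_einf_lim (cvg_lim _ (@cvg_einfs_sup _ _))//; apply: ereal_sup_ubound; exists 0%N.
apply: filterS wf => x wfx _.
have f0 : 0 <= f x.
  have <- := cvg_lim (@Rhausdorff R) wfx; apply: limr_ge.
    by apply/cvg_ex; exists (f x).
  by apply: nearW => k; exact: w0.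
have cE : (w k x)%:E @[k --> \oo] --> (f x)%:E by apply: cvg_EFin => //; exact: nearW.
rewrite ger0_norm// -(cvg_lim _ cE)// is_cvg_limn_einfE//.
by apply/cvg_ex; exists (f x)%:E.
Qed.

(** Applied to the differences between a term and the tail of a subsequence, this turns the Cauchy
    property into convergence to the almost everywhere limit. *)
Lemma L2_fatou w f e : (forall k, w k \in L2) -> measurable_fun setT f ->
  {ae mu, forall x, w k x @[k --> \oo] --> f x} -> (forall k, n2 mu (w k) <= e) ->
  f \in L2 /\ n2 mu f <= e.
Proof.
move=> wL mf wf we.
have mf2 : measurable_fun setT (fun x => f x ^+ 2) by exact: measurable_funX.
have f2 : (\int[mu]_x `|f x ^+ 2|%:E <= e%:E)%E.
  apply: (@cvg_fatou (fun k x => w k x ^+ 2)) => //.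
  - by move=> k; apply: measurable_funX; exact: L2_meas (wL k).
  - by move=> k x; exact: sqr_ge0.
  - by apply: filterS wf => x wx; exact: (cvgM wx wx).
  - move=> k; have i2 := L2_sqr (wL k).
    by rewrite -(fineK (integrable_fin_num measurableT i2)) lee_fin; exact: we.
have fL : f \in L2.
  apply/L2P; split => //; apply/integrableP; split; first exact/measurable_EFinP.
  by apply: (le_lt_trans f2); rewrite ltry.
split => //; rewrite -lee_fin; apply: le_trans f2.
rewrite /n2 fineK; last exact: (integrable_fin_num measurableT (L2_sqr fL)).
rewrite le_eqVlt; apply/orP; left; apply/eqP; apply: eq_integral => x _.
by rewrite ger0_norm// sqr_ge0.
Qed.

(** The series of absolute values has a finite integral, hence is finite almost everywhere. *)
Lemma series_ae_cvg w : (forall k, w k \in L2) -> (forall k, n2 mu (w k) <= 4^-1 ^+ k) ->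
  {ae mu, forall x, cvgn (series (w ^~ x))}.
Proof.
move=> wL w2.
have mw k : measurable_fun setT (fun x => `|w k x|%:E).
  by apply/measurable_EFinP; 
     apply: (measurableT_comp (@normr_measurable R setT)); exact: L2_meas (wL k).
have wi k : (\int[mu]_x `|w k x|%:E <= (geometric 1 2^-1 k)%:E)%E.
  have iw : rint mu (fun x => `|w k x|) by exact/rint_norm/L2_rint/wL.
  rewrite -(fineK (integrable_fin_num measurableT iw)) lee_fin -/(Rintegral _ _ _).
  (* Young's inequality t <= p t^2 / 2 + 1 / (2 p) with p = 2^k, which balances the two terms at
     2^-k / 2 each. *)
  apply: (@le_trans _ _ (\int[mu]_x (2 ^+ k / 2 * w k x ^+ 2 + 2^-1 ^+ k / 2))).
    apply: int_le => //.
      by apply: rintD; [exact/rintZ/L2_sqr|exact: rint_cst].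
    move=> x; rewrite -[w k x ^+ 2]real_normK ?num_real//.
    have := sqr_ge0 (2 ^+ k * `|w k x| - 1).
    have : 0 < 2 ^+ k :> R by rewrite exprn_gt0.
    rewrite exprVn; set p := 2 ^+ k; set t := `|w k x| => p0 H.
    rewrite -subr_ge0 (_ : _ - t = (p * t - 1) ^+ 2 / (2 * p)); last first.
      by field; rewrite gt_eqF.
    by rewrite divr_ge0// mulr_ge0// ltW.
  rewrite intD; [|exact/rintZ/L2_sqr|exact: rint_cst].
  rewrite intZ ?L2_sqr// int_cst /= mul1r.
  have := w2 k; rewrite -/(n2 mu (w k)).
  rewrite (_ : 4^-1 = 2^-1 * 2^-1); last by field.
  rewrite exprMn !exprVn => w2k.
  have p0 : 0 < 2 ^+ k :> R by rewrite exprn_gt0.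
  apply: (@le_trans _ _ (2 ^+ k / 2 * ((2 ^+ k)^-1 * (2 ^+ k)^-1) + (2 ^+ k)^-1 / 2)).
    by rewrite lerD2r ler_wpM2l// divr_ge0// ltW.
  by rewrite le_eqVlt; apply/orP; left; apply/eqP; field; rewrite gt_eqF.
have ws : (\int[mu]_x (\sum_(k <oo) `|w k x|%:E) <= 2%:E)%E.
  rewrite integral_nneseries//.
  apply: (@le_trans _ _ (\sum_(k <oo) (geometric 1 2^-1 k)%:E)%E).
    by apply: lee_nneseries => [k _ _|k _]; [exact: integral_ge0|exact: wi].
  have := @cvg_geometric_series R 1 2^-1.
  rewrite ger0_norm// invf_lt1// ltr1n => /(_ erefl) H.
  rewrite (cvg_lim _ (_ : _ --> (1 / (1 - 2^-1))%:E))//.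
    by rewrite lee_fin (_ : 1 / _ = 2)//; field.
  rewrite (_ : (fun n => _) = EFin \o series (geometric 1 2^-1)).
    by apply: cvg_EFin => //; exact: nearW.
  by apply/funext => n /=; rewrite /series/= -sumEFin.
have /integrable_ae -/(_ measurableT) : mu.-integrable setT (fun x => (\sum_(k <oo) `|w k x|%:E))%E.
  apply/integrableP; split; first exact: ge0_emeasurable_sum.
  apply: le_lt_trans (ltry 2); apply: le_trans ws.
  rewrite le_eqVlt; apply/orP; left; apply/eqP; apply: eq_integral => x _.
  by rewrite gee0_abs// nneseries_ge0.
apply: filterS => x /(_ I) fx.
apply: normed_cvg; apply: nondecreasing_is_cvgn.
  exact: (@nondecreasing_series _ (fun k => `|w k x|) xpredT 0).
exists (fine (\sum_(k <oo) `|w k x|%:E)%E) => _ [n _ <-].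
rewrite -lee_fin fineK// /series/= -sumEFin.
by apply: (@nneseries_lim_ge R (fun k => `|w k x|%:E)%E xpredT 0 n).
Qed.

(** Riesz-Fischer. The limit is defined at every point as an upper limit along a subsequence, so it
    depends on the values of the sequence at that point alone; the last clause records this and is
    what transmits periodicity. *)
Lemma L2_complete u : (forall n, u n \in L2) ->
  (forall e, 0 < e -> exists N, forall m n, (N <= m)%N -> (N <= n)%N ->
    n2 mu (fun x => u m x - u n x) <= e) ->
  exists f, [/\ f \in L2,
    forall e, 0 < e -> exists N, forall n, (N <= n)%N ->
      n2 mu (fun x => u n x - f x) <= e &
    forall x y, (forall n, u n x = u n y) -> f x = f y].
Proof.
move=> uL uC.
have p4 k : 0 < 4^-1 ^+ k :> R by rewrite exprn_gt0.
pose N k := projT1 (cid (uC _ (p4 k))).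
have NP k : forall m n, (N k <= m)%N -> (N k <= n)%N ->
    n2 mu (fun x => u m x - u n x) <= 4^-1 ^+ k.
  by rewrite /N; case: cid.
(* The maximum puts [S k] beyond every threshold up to [k], and the summand [k] makes [S]
   unbounded. *)
pose S k := (k + \max_(j < k.+1) N j)%N.
have NS j k : (j <= k)%N -> (N j <= S k)%N.
  move=> jk; rewrite /S (bigD1 (Ordinal (jk : (j < k.+1)%N)))//=.
  by rewrite (leq_trans (leq_maxl _ _) (leq_addl _ _)).
pose w k := u (S k).
pose f x := fine (limn_esup (fun k => (w k x)%:E)).
have mf : measurable_fun setT f.
  apply: (@measurableT_comp _ _ _ _ _ _ fine _ (fun x => limn_esup (fun k => (w k x)%:E))) => //.
  apply: (@measurable_fun_limn_esup _ _ _ _ (fun k x => (w k x)%:E)) => k.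
  by apply/measurable_EFinP; exact: L2_meas (uL _).
have wf : {ae mu, forall x, w k x @[k --> \oo] --> f x}.
  have h1 k : (fun x => w k.+1 x - w k x) \in L2 by exact: (L2B (uL _) (uL _)).
  have h2 k : n2 mu (fun x => w k.+1 x - w k x) <= 4^-1 ^+ k.
    by apply: NP; exact: NS.
  have := series_ae_cvg h1 h2; apply: filterS => x cx.
  have cw : cvgn (w ^~ x).
    rewrite (_ : w ^~ x = (fun n => w 0 x + series (telescope (w ^~ x)) n)).
      by apply: is_cvgD; [exact: is_cvg_cst|exact: cx].
    by apply/funext => n; rewrite -eq_sum_telescope.
  have cE : (w k x)%:E @[k --> \oo] --> (limn (w ^~ x))%:E.
    by apply: cvg_EFin => //; exact: nearW.
  rewrite /f is_cvg_limn_esupE; last by apply/cvg_ex; eexists; exact: cE.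
  by rewrite (cvg_lim _ cE).
have key e : 0 < e -> exists N0, forall n, (N0 <= n)%N ->
    (fun x => u n x - f x) \in L2 /\ n2 mu (fun x => u n x - f x) <= e.
  move=> e0; have [N0 N0P] := uC _ e0.
  exists N0 => n N0n.
  have [K SK] : exists K, forall k, (N0 <= S (K + k))%N.
    by exists N0 => k; rewrite /S -addnA leq_addr.
  apply: (@L2_fatou (fun k x => u n x - w (K + k)%N x)).
  - by move=> k; exact: (L2B (uL _) (uL _)).
  - by apply: measurable_funB => //; exact: L2_meas (uL _).
  - apply: filterS wf => x wx; apply: cvgB; first exact: cvg_cst.
    by rewrite -(cvg_shiftn K) in wx; under eq_fun do rewrite addnC.
  - by move=> k; exact: N0P.
exists f; split.
- have [N0 /(_ N0 (leqnn _))[L _]] := key 1 ltr01.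
  rewrite (_ : f = (fun x => u N0 x - (u N0 x - f x))); first exact: L2B.
  by apply/funext => x; rewrite opprB addrC subrK.
- by move=> e /key[N0 H]; exists N0 => n /H[].
- by move=> x y xy; rewrite /f; congr (fine (limn_esup _)); apply/funext => k; rewrite /w xy.
Qed.

End riesz_fischer.

(** * Minimization in Hilbert spaces *)

Lemma sqr_le_eps_eq0 (R : realType) (x c : R) :
  (forall e, 0 < e -> x ^+ 2 <= e * c) -> x = 0.
Proof.
move=> H; apply/eqP; rewrite -sqrf_eq0 eq_le sqr_ge0 andbT.
apply/ler_addgt0Pr => e e0; rewrite add0r.
have [c0|c0] := leP c 0.
  by rewrite (le_trans (H 1 ltr01))// mul1r (le_trans c0)// ltW.
by have := H (e / c) (divr_gt0 e0 c0); rewrite divfK// gt_eqF.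
Qed.

(** Riesz representation for a merely semidefinite form on a subspace. Functions equal almost
    everywhere are not identified, so the form has a kernel, and completeness is assumed as the
    existence of some limit. The solution is the limit of a minimizing sequence of the energy
    [J]. *)
Lemma riesz_minimization (R : realType) (V : lmodType R) (H : set V)
    (a : V -> V -> R) (l : V -> R) (C : R) :
  H 0 -> (forall u v t, H u -> H v -> H (u + t *: v)) ->
  (forall u v, H u -> H v -> a u v = a v u) ->
  (forall u v w t, H u -> H v -> H w -> a (u + t *: v) w = a u w + t * a v w) ->
  (forall u, H u -> 0 <= a u u) ->
  (forall u v t, H u -> H v -> l (u + t *: v) = l u + t * l v) ->
  0 <= C -> (forall v, H v -> l v ^+ 2 <= C * a v v) ->
  (forall u : nat -> V, (forall n, H (u n)) ->
    (forall e, 0 < e -> exists N, forall m n, (N <= m)%N -> (N <= n)%N ->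
      a (u m - u n) (u m - u n) <= e) ->
    exists2 w, H w & forall e, 0 < e -> exists N, forall n, (N <= n)%N ->
      a (u n - w) (u n - w) <= e) ->
  exists2 w, H w & forall v, H v -> a w v = l v.
Proof.
move=> H0 HD aC aL a0 lL C0 lC complete.
have HB u v : H u -> H v -> H (u - v).
  by move=> Hu Hv; rewrite -scaleN1r; exact: HD.
have aDD u v t : H u -> H v ->
    a (u + t *: v) (u + t *: v) = a u u + 2 * t * a u v + t ^+ 2 * a v v.
  move=> Hu Hv; have Huv := HD u v t Hu Hv; rewrite aL// ![a _ (u + _)]aC// !aL//.
  by rewrite (aC v u)//; ring.
pose J v := a v v - 2 * l v.
have JD u v t : H u -> H v ->
    J (u + t *: v) = J u + 2 * t * (a u v - l v) + t ^+ 2 * a v v.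
  by move=> Hu Hv; rewrite /J aDD// lL//; ring.
have JC v : H v -> - C <= J v.
  move=> Hv; have av := a0 v Hv; have lv := lC v Hv.
  suff : 2 * l v <= C + a v v by rewrite /J; lra.
  apply: (le_trans (ler_norm _)).
  rewrite -ler_sqr ?nnegrE ?addr_ge0// real_normK ?num_real//.
  by have := sqr_ge0 (C - a v v); nra.
pose S := [set J v | v in H].
have Sne : S !=set0 by exists (J 0), 0.
have Slb : has_lbound S by exists (- C) => _ [v Hv <-]; exact: JC.
pose m := inf S.
have mJ v : H v -> m <= J v by move=> Hv; apply: ge_inf => //; exists v.
have /choice[u uP] n : exists v, H v /\ J v < m + n.+1%:R^-1.
  have [|_ [v Hv <-] Jv] := @inf_adherent _ S n.+1%:R^-1 _ (conj Sne Slb).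
    by rewrite invr_gt0.
  by exists v.
have Hu n : H (u n) by case: (uP n).
have [w Hw uw] : exists2 w, H w & forall e, 0 < e -> exists N, forall n,
    (N <= n)%N -> a (u n - w) (u n - w) <= e.
  apply: complete => // e e0.
  exists (Num.truncn (4 * e^-1)) => i j Ni Nj.
  have small k : (Num.truncn (4 * e^-1) <= k)%N -> k.+1%:R^-1 <= e / 4.
    move=> Nk; rewrite -[leRHS]invrK lef_pV2 ?posrE ?invr_gt0 ?divr_gt0//.
    rewrite invf_div ltW// (lt_le_trans (truncnS_gt _))//.
    by rewrite ler_nat ltnS.
  have Hd := HB _ _ (Hu i) (Hu j).
  (* Parallelogram argument: the energy at the midpoint of [u i] and [u j] is at least [m], so the
     form at their difference is at most 2 / (i + 1) + 2 / (j + 1). *)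
  have := JD (u j) (u i - u j) 1 (Hu j) Hd; rewrite scale1r addrCA subrr addr0.
  have := mJ _ (HD (u j) (u i - u j) 2^-1 (Hu j) Hd); rewrite JD//.
  have [_ Ji] := uP i; have [_ Jj] := uP j.
  have := small i Ni; have := small j Nj.
  move: (i.+1%:R^-1) (j.+1%:R^-1) Ji Jj => ei ej; lra.
exists w => // v Hv; apply/eqP; rewrite -subr_eq0; apply/eqP.
apply: (@sqr_le_eps_eq0 _ _ (4 * a v v)) => e e0.
have [N NP] := uw e e0.
pose n := maxn N (Num.truncn e^-1).
have e_n : n.+1%:R^-1 <= e.
  rewrite -[leRHS]invrK lef_pV2 ?posrE ?invr_gt0//.
  by rewrite ltW// (lt_le_trans (truncnS_gt _))// ler_nat ltnS leq_maxr.
(* Minimality up to 1 / (n + 1) in the direction [v]: the discriminant bounds the residual of the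
   Euler-Lagrange equation at [u n]. *)
have b1 : (a (u n) v - l v) ^+ 2 <= n.+1%:R^-1 * a v v.
  apply: discriminant_le => [|t]; first exact: a0.
  have := mJ _ (HD (u n) v t (Hu n) Hv); rewrite JD//.
  by have [_] := uP n; move: (J (u n)) (n.+1%:R^-1) => Jn en; lra.
have Hd := HB _ _ (Hu n) Hw.
have b2 : (a (u n - w) v) ^+ 2 <= a (u n - w) (u n - w) * a v v.
  apply: discriminant_le => [|t]; first exact: a0.
  by rewrite -aDD//; apply/a0/HD.
have Na := NP n (leq_maxl _ _).
have av := a0 v Hv.
have -> : a w v - l v = (a (u n) v - l v) - a (u n - w) v.
  by rewrite -[- w]scaleN1r aL//; ring.
have b1e := le_trans b1 (ler_wpM2r av e_n).
have b2e := le_trans b2 (ler_wpM2r av Na).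
move: (a (u n) v - l v) (a (u n - w) v) b1e b2e => X Y.
by have := sqr_ge0 (X + Y); lra.
Qed.

(** * Trigonometric polynomials on the torus *)

Section torus_integrals.
Variable R : realType.

Definition row_tail d (x : 'rV[R]_d.+1) : 'rV[R]_d := \row_i x 0 (lift ord0 i).

Lemma cons_row0 d (p : measurableTypeR R * 'rV[R]_d) : cons_row p 0 ord0 = p.1.
Proof.
rewrite /cons_row (_ : ord0 = lshift d (ord0 : 'I_1)); last exact: val_inj.
by rewrite [LHS]row_mxEl mxE eqxx mulr1n.
Qed.

Lemma cons_rowS d (p : measurableTypeR R * 'rV[R]_d) i :
  cons_row p 0 (lift ord0 i) = p.2 0 i.
Proof.
rewrite /cons_row (_ : lift ord0 i = rshift 1 i); last exact: val_inj.
by rewrite [LHS]row_mxEr.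
Qed.

Lemma row_tail_cons d (p : measurableTypeR R * 'rV[R]_d) :
  row_tail (cons_row p) = p.2.
Proof. by apply/rowP => i; rewrite mxE cons_rowS. Qed.

Lemma measurable_row_tail d : measurable_fun setT (@row_tail d).
Proof.
apply/measurable_fun_mxP => i j.
rewrite (_ : (fun _ => _) = (fun x : 'rV[R]_d.+1 => x 0 (lift ord0 j))).
  exact: measurable_entry.
by apply/funext => x; rewrite mxE.
Qed.

Lemma rint_bounded (disp : measure_display) (T : measurableType disp)
    (mu : probability T R) (f : T -> R) M :
  measurable_fun setT f -> (forall x, `|f x| <= M) -> rint mu f.
Proof. by move=> mf fM; apply: (rint_le mf (rint_cst mu M)). Qed.

(** Fubini along the recursive construction of [torus]; boundedness supplies the integrability of
    every factor. *)
Lemma torus_int_prod d (f : R -> R) (g : 'rV[R]_d -> R) Mf Mg :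
  measurable_fun setT f -> measurable_fun setT g ->
  (forall t, `|f t| <= Mf) -> (forall x, `|g x| <= Mg) ->
  \int[torus R d.+1]_x (f (x 0 ord0) * g (row_tail x)) =
  (\int[uniform_prob (@ltr01 R)]_t f t) * (\int[torus R d]_x g x).
Proof.
move=> mf mg fM gM.
have mF : measurable_fun setT
    (fun x : 'rV[R]_d.+1 => f (x 0 ord0) * g (row_tail x)).
  apply: measurable_funM.
    exact: (measurableT_comp mf (measurable_entry _ _)).
  exact: (measurableT_comp mg (@measurable_row_tail d)).
have mG : measurable_fun setT
    (fun p : measurableTypeR R * 'rV[R]_d => f p.1 * g p.2).
  by apply: measurable_funM;
    [exact: (measurableT_comp mf)|exact: (measurableT_comp mg)].
have compE : (EFin \o (fun x : 'rV[R]_d.+1 => f (x 0 ord0) * g (row_tail x))) \o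
    (@cons_row R d) = EFin \o (fun p => f p.1 * g p.2).
  by apply/funext => p /=; rewrite cons_row0 row_tail_cons.
have iG : rint (uniform_prob (@ltr01 R) \x torus R d)%E
    (fun p : measurableTypeR R * 'rV[R]_d => f p.1 * g p.2).
  apply: (@rint_bounded _ _ _ _ (Mf * Mg)) => // p.
  by rewrite normrM ler_pM.
have ig : rint (torus R d) g by exact: (@rint_bounded _ _ _ _ Mg).
have if_ : rint (uniform_prob (@ltr01 R)) f by exact: (@rint_bounded _ _ _ _ Mf).
have E1 : (\int[torus R d.+1]_x (f (x 0 ord0) * g (row_tail x))%:E =
    \int[uniform_prob (@ltr01 R) \x torus R d]_p (f p.1 * g p.2)%:E)%E.
  rewrite [LHS](@integral_distribution _ _ _ _ _
    (uniform_prob (@ltr01 R) \x torus R d)%E (@cons_row R d)).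
  - by apply: eq_integral => p _ /=; rewrite cons_row0 row_tail_cons.
  - exact/measurable_EFinP.
  - by rewrite compE; exact: iG.
rewrite {1}/Rintegral E1 -integral12_prod_meas1//=.
under eq_integral => t _.
  rewrite /fubini_F/=.
  under eq_integral do rewrite EFinM.
  rewrite integralZl// -(fineK (integrable_fin_num measurableT ig)) muleC.
  over.
rewrite integralZl// -(fineK (integrable_fin_num measurableT if_)).
by rewrite -EFinM/= mulrC.
Qed.

Lemma periodic_int (V : zmodType) (f : R -> V) (p : R) (z : int) t :
  (forall t, f (t + p) = f t) -> f (t + p * z%:~R) = f t.
Proof.
move=> fp.
have fn (n : nat) s : f (s + p * n%:R) = f s.
  elim: n s => [|n ih] s; first by rewrite mulr0 addr0.
  by rewrite mulrSr mulrDr mulr1 addrA fp ih.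
case: z => n; first exact: fn.
by rewrite NegzE mulrNz mulrN -(fn n.+1 (t - _)) subrK.
Qed.

Lemma cosD2piz t (z : int) : cos (t + 2 * pi * z%:~R) = cos t :> R.
Proof.
by apply: periodic_int => {}t; rewrite mulr2n mulrDl mul1r -mulr2n cosD2pi.
Qed.

Lemma sinD2piz t (z : int) : sin (t + 2 * pi * z%:~R) = sin t :> R.
Proof.
by apply: periodic_int => {}t; rewrite mulr2n mulrDl mul1r -mulr2n sinD2pi.
Qed.

Lemma uniform_int_deriv (F f : R -> R) M : continuous f ->
  (forall t : R, is_derive t 1 F (f t)) -> (forall t, `|f t| <= M) ->
  \int[uniform_prob (@ltr01 R)]_t f t = F 1 - F 0.
Proof.
move=> cf dF fM.
have mf := continuous_measurable_fun cf.
pose P := uniform_prob (@ltr01 R).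
have if_ : rint P f by exact: (@rint_bounded _ _ _ _ M).
(* Adding [M] makes the integrand nonnegative, as [integral_uniform] requires. *)
suff : \int[P]_t (f t + M) = F 1 - F 0 + M.
  by rewrite intD//; [rewrite int_cst => /addIr|exact: rint_cst].
have dG (t : R) : is_derive t 1 (fun t => F t + M * t) (f t + M).
  by apply: is_derive_eq; rewrite /= scaler1.
have cG : continuous (fun t => F t + M * t).
  by move=> t; apply: differentiable_continuous; apply/derivable1_diffP; apply: ex_derive.
rewrite /Rintegral integral_uniform; last 2 first.
- by apply/measurable_EFinP; exact: measurable_funD.
- by move=> t; rewrite lee_fin -lerBlDr sub0r; have := fM t; rewrite ler_norml => /andP[].
rewrite (@continuous_FTC2 _ (fun t => f t + M) (fun t => F t + M * t))//.
- by rewrite subr0 invr1 mul1e -EFinB/=; ring.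
- apply: continuous_subspaceT => t; apply: cvgD; [exact: cf|exact: cvg_cst].
- split.
  + by move=> t _; apply: ex_derive.
  + by apply: cvg_at_right_filter; exact: cG.
  + by apply: cvg_at_left_filter; exact: cG.
- by move=> t _; rewrite derive1E; apply: derive_val.
Qed.

Lemma uniform_int_cos (n : int) :
  \int[uniform_prob (@ltr01 R)]_t cos (2 * pi * (n%:~R * t)) = (n == 0)%:R.
Proof.
have [->|n0] := eqVneq n 0.
  by under eq_Rintegral do rewrite mul0r mulr0 cos0; rewrite int_cst.
set c : R := 2 * pi * n%:~R.
have c0 : c != 0 by rewrite !mulf_neq0// ?pnatr_eq0// ?intr_eq0// gt_eqF// pi_gt0.
have dF (t : R) : is_derive t 1 (fun t => c^-1 * sin (c * t)) (cos (2 * pi * (n%:~R * t))).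
  rewrite mulrA -/c.
  apply: is_derive_eq; rewrite /= scaler1 /GRing.scale/=.
  by rewrite mulrCA mulVf ?mulr1.
rewrite (@uniform_int_deriv _ (fun t => cos (2 * pi * (n%:~R * t))) 1 _ dF).
- by rewrite mulr1 mulr0 sin0 -[c]add0r sinD2piz sin0 !mulr0 subrr.
- by move=> t; apply: differentiable_continuous; apply/derivable1_diffP; apply: ex_derive.
- by move=> t; exact: cos_max.
Qed.

Lemma uniform_int_sin (n : int) :
  \int[uniform_prob (@ltr01 R)]_t sin (2 * pi * (n%:~R * t)) = 0.
Proof.
have [->|n0] := eqVneq n 0.
  by under eq_Rintegral do rewrite mul0r mulr0 sin0; rewrite int_cst.
set c : R := 2 * pi * n%:~R.
have c0 : c != 0 by rewrite !mulf_neq0// ?pnatr_eq0// ?intr_eq0// gt_eqF// pi_gt0.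
have dF (t : R) : is_derive t 1 (fun t => - c^-1 * cos (c * t)) (sin (2 * pi * (n%:~R * t))).
  rewrite mulrA -/c.
  apply: is_derive_eq; rewrite /= scaler1 /GRing.scale/=.
  by field.
rewrite (@uniform_int_deriv _ (fun t => sin (2 * pi * (n%:~R * t))) 1 _ dF).
- by rewrite mulr1 mulr0 cos0 -[c]add0r cosD2piz cos0 mulr1 subrr.
- by move=> t; apply: differentiable_continuous; apply/derivable1_diffP; apply: ex_derive.
- by move=> t; exact: sin_max.
Qed.

End torus_integrals.

(** * Orthonormality of the Hartley functions *)

Section hartley.
Variable R : realType.

Lemma phase0 d (x : 'rV[R]_d) : phase 0 x = 0.
Proof. by rewrite /phase big1 ?mulr0// => i _; rewrite mxE mul0r. Qed.

Lemma phaseD d (k l : 'rV[int]_d) (x : 'rV[R]_d) :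
  phase (k + l) x = phase k x + phase l x.
Proof.
rewrite /phase -mulrDr -big_split; congr (_ * _); apply: eq_bigr => i _ /=.
by rewrite mxE intrD mulrDl.
Qed.

Lemma phaseN d (k : 'rV[int]_d) (x : 'rV[R]_d) : phase (- k) x = - phase k x.
Proof.
by apply/eqP; rewrite -addr_eq0 -phaseD addNr phase0.
Qed.

Lemma phaseS d (k : 'rV[int]_d.+1) (x : 'rV[R]_d.+1) :
  phase k x = 2 * pi * ((k 0 ord0)%:~R * x 0 ord0) +
    phase (\row_i k 0 (lift ord0 i)) (row_tail x).
Proof.
rewrite /phase big_ord_recl mulrDr; congr (_ + _ * _).
by apply: eq_bigr => i _; rewrite !mxE.
Qed.

Lemma measurable_phase d (k : 'rV[int]_d) :
  measurable_fun setT (fun x : 'rV[R]_d => phase k x).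
Proof.
apply: measurable_funM => //; apply: measurable_sum => i.
by apply: measurable_funM => //; exact: measurable_entry.
Qed.

Lemma measurable_cos : measurable_fun setT (@cos R).
Proof. by apply: continuous_measurable_fun; exact: continuous_cos. Qed.

Lemma measurable_sin : measurable_fun setT (@sin R).
Proof. by apply: continuous_measurable_fun; exact: continuous_sin. Qed.

Lemma measurable_cos_phase d (k : 'rV[int]_d) :
  measurable_fun setT (fun x : 'rV[R]_d => cos (phase k x)).
Proof. exact: (measurableT_comp measurable_cos (measurable_phase k)). Qed.

Lemma measurable_sin_phase d (k : 'rV[int]_d) :
  measurable_fun setT (fun x : 'rV[R]_d => sin (phase k x)).
Proof. exact: (measurableT_comp measurable_sin (measurable_phase k)). Qed.

(** Both integrals are computed in one induction on the dimension because the addition formulas mix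
    cosines and sines of the remaining coordinates. *)
Lemma int_cos_sin_phase d (k : 'rV[int]_d) :
  \int[torus R d]_x cos (phase k x) = (k == 0)%:R /\
  \int[torus R d]_x sin (phase k x) = 0.
Proof.
elim: d k => [|d ih] k.
  have p0 (x : 'rV[R]_0) : phase k x = 0 by rewrite /phase big_ord0 mulr0.
  under eq_Rintegral do rewrite p0 cos0.
  under [X in _ /\ X = _]eq_Rintegral do rewrite p0 sin0.
  by rewrite !int_cst thinmx0 eqxx.
set l := (\row_i k 0 (lift ord0 i)).
have mf (u : R -> R) : measurable_fun setT u ->
    measurable_fun setT (fun t : R => u (2 * pi * ((k 0 ord0)%:~R * t))).
  move=> mu; apply: (measurableT_comp mu).
  by apply: measurable_funM => //; apply: measurable_funM.
have mc := mf _ measurable_cos; have ms := mf _ measurable_sin.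
have cP := @torus_int_prod R d _ _ 1 1.
have mlc := measurable_cos_phase l; have mls := measurable_sin_phase l.
have cc := cP _ _ mc mlc (fun=> cos_max _) (fun=> cos_max _).
have ss := cP _ _ ms mls (fun=> sin_max _) (fun=> sin_max _).
have cs := cP _ _ mc mls (fun=> cos_max _) (fun=> sin_max _).
have sc := cP _ _ ms mlc (fun=> sin_max _) (fun=> cos_max _).
rewrite !(uniform_int_cos, uniform_int_sin) !(ih l).1 !(ih l).2 in cc ss cs sc.
have ri (u v : R -> R) : measurable_fun setT u -> measurable_fun setT v ->
    (forall t, `|u t| <= 1) -> (forall t, `|v t| <= 1) ->
    rint (torus R d.+1) (fun x => u (2 * pi * ((k 0 ord0)%:~R * x 0 ord0)) *
       v (phase l (row_tail x))).
  move=> mu mv u1 v1; apply: (@rint_bounded _ _ _ _ _ (1 * 1)) => [|x].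
    apply: measurable_funM.
      apply: (measurableT_comp mu); apply: measurable_funM => //.
      by apply: measurable_funM => //; exact: measurable_entry.
    apply: (measurableT_comp mv).
    exact: (measurableT_comp (measurable_phase l) (@measurable_row_tail R d)).
  by rewrite normrM ler_pM.
have [mC mS] := (measurable_cos, measurable_sin).
have [C1 S1] := (@cos_max R, @sin_max R).
split.
- under eq_Rintegral do rewrite phaseS -/l cosD.
  rewrite intB; [|exact: ri..].
  rewrite cc ss mul0r subr0 -natrM mulnb; congr (_%:R); congr nat_of_bool.
  apply/andP/eqP => [[/eqP k0 /eqP l0]|k0]; last first.
    rewrite /l k0 mxE; split; first exact: eqxx.
    by apply/eqP/rowP => i; rewrite !mxE.
  apply/rowP => i; rewrite mxE; case: (unliftP ord0 i) => [j ->|-> //].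
  by have := congr1 (fun M : 'rV[int]_d => M 0 j) l0; rewrite !mxE.
- under eq_Rintegral do rewrite phaseS -/l sinD.
  rewrite intD; [|exact: ri..].
  by rewrite sc cs mul0r mulr0 addr0.
Qed.

Variable d : nat.
Implicit Types (k l : 'rV[int]_d) (x : 'rV[R]_d).
Local Notation mu := (torus R d).

(* Hartley's real substitute for the Fourier basis: a single function per
   frequency, orthonormal over the whole of Z^d. *)
Definition cas k x : R := cos (phase k x) + sin (phase k x).

Lemma cas0 x : cas 0 x = 1.
Proof. by rewrite /cas phase0 cos0 sin0 addr0. Qed.

Lemma cosE_cas k x : cos (phase k x) = 2^-1 * (cas k x + cas (- k) x).
Proof. by rewrite /cas phaseN cosN sinN; field. Qed.

Lemma sinE_cas k x : sin (phase k x) = 2^-1 * (cas k x - cas (- k) x).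
Proof. by rewrite /cas phaseN cosN sinN; field. Qed.

(** The cross terms combine into one cosine of the difference and one sine of the sum. The cosine
    gives orthonormality, and the identity also closes trigonometric polynomials under products. *)
Lemma casM k l x :
  cas k x * cas l x = cos (phase (k - l) x) + sin (phase (k + l) x).
Proof. by rewrite /cas !phaseD phaseN cosD sinD cosN sinN; ring. Qed.

Lemma cas_max k x : `|cas k x| <= 2.
Proof.
by rewrite (le_trans (ler_normD _ _))// (_ : 2 = 1 + 1)// lerD ?cos_max ?sin_max.
Qed.

Lemma measurable_cas k : measurable_fun setT (cas k).
Proof.
by apply: measurable_funD; [exact: measurable_cos_phase|exact: measurable_sin_phase].
Qed.

Lemma cas_L2 k : cas k \in Lfun mu 2%:E.
Proof.
apply: (@L2_bounded _ _ _ _ 2); first exact: measurable_cas.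
by apply: aeW => x; exact: cas_max.
Qed.

Lemma cas_orthonormal k l : \int[mu]_x (cas k x * cas l x) = (k == l)%:R.
Proof.
under eq_Rintegral do rewrite casM.
rewrite intD; last 2 first.
- by apply: (@rint_bounded _ _ _ _ _ 1) => [|x]; [exact: measurable_cos_phase|exact: cos_max].
- by apply: (@rint_bounded _ _ _ _ _ 1) => [|x]; [exact: measurable_sin_phase|exact: sin_max].
by rewrite (int_cos_sin_phase _).1 (int_cos_sin_phase _).2 addr0 subr_eq0.
Qed.

End hartley.

(** * Polynomial approximations of the sign and of the Heaviside function *)

Section sign_polynomials.
Variable R : realType.
Implicit Type s : R.

(** The Newton-Schulz cubic: odd, with fixed points -1, 0 and 1, and with vanishing derivative at -1
    and 1. *)
Definition sign_step s : R := (3 * s - s ^+ 3) / 2.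

Lemma sign_step_itv s : 0 <= s <= 1 ->
  [/\ s <= sign_step s, sign_step s <= 1 &
      1 - sign_step s <= (1 - s) * (1 - s / 2)].
Proof.
move=> /andP[s0 s1]; rewrite /sign_step.
have t0 : 0 <= 1 - s by lra.
have st := mulr_ge0 s0 t0.
have sst := mulr_ge0 s0 st.
have tt := mulr_ge0 t0 t0; have stt := mulr_ge0 s0 tt.
by split; rewrite -subr_ge0; lra.
Qed.

Definition sign_iter n s : R := iter n sign_step s.

Lemma sign_iterN n s : sign_iter n (- s) = - sign_iter n s.
Proof.
elim: n => [//|n ih]; rewrite /sign_iter !iterS -!/(sign_iter n _) ih /sign_step.
by field.
Qed.

(** The iterates increase, so the contraction factor [1 - s / 2] of the starting point remains valid
    at every step. *)
Lemma sign_iter_itv n s : 0 <= s <= 1 ->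
  s <= sign_iter n s <= 1 /\ 1 - sign_iter n s <= (1 - s / 2) ^+ n.
Proof.
move=> s01; elim: n => [|n [/andP[s1 s2] s3]].
  rewrite /sign_iter /= expr0 lexx; case/andP: s01 => s0 ->; split => //; lra.
rewrite /sign_iter iterS -/(sign_iter n s).
case/andP: s01 => s0 s1'.
have [|t1 t2 t3] := @sign_step_itv (sign_iter n s).
  by rewrite s2 andbT (le_trans s0).
split; first by rewrite t2 andbT (le_trans s1).
apply: (le_trans t3); rewrite exprSr ler_pM//; lra.
Qed.

Lemma sign_iter_max n s : `|s| <= 1 -> `|sign_iter n s| <= 1.
Proof.
move=> s1; wlog s0 : s s1 / 0 <= s.
  move=> H; have [|/ltW s0] := leP 0 s; first exact: H.
  by rewrite -[s]opprK sign_iterN normrN H ?normrN// oppr_ge0.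
have s01 : 0 <= s <= 1 by rewrite s0 -(ger0_norm s0).
have [/andP[h1 h2] _] := sign_iter_itv n s01.
by rewrite ger0_norm// (le_trans s0).
Qed.

Lemma cvg_sign_iter s : 0 < s <= 1 -> sign_iter n s @[n --> \oo] --> (1 : R).
Proof.
move=> /andP[s0 s1].

have s01 : 0 <= s <= 1 by rewrite ltW.
have c0 : 1 - (1 - s / 2) ^+ n @[n --> \oo] --> (1 : R).
  rewrite -[X in _ --> X]subr0; apply: cvgB; first exact: cvg_cst.
  by apply: cvg_expr; rewrite ger0_norm; lra.
have c1 : (fun=> 1 : R) n @[n --> \oo] --> (1 : R) by exact: cvg_cst.
apply: (squeeze_cvgr _ c0 c1); apply: nearW => n.
have [/andP[_ h2] h3] := sign_iter_itv n s01.
by rewrite h2 andbT; lra.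
Qed.

(* The last factor only matters at s = 0, where it turns the limit 1/2 into 0. *)
Definition heaviside n s : R :=
  2^-1 * (1 + sign_iter n s) * (1 - (1 - s ^+ 2) ^+ n).

Lemma heaviside_max n s : `|s| <= 1 -> `|heaviside n s| <= 1.
Proof.
move=> s1; have := sign_iter_max n s1; rewrite ler_norml => /andP[h1 h2].
have s2 : 0 <= 1 - s ^+ 2 <= 1.
  have := sqr_ge0 s; have : s ^+ 2 <= 1 by rewrite -real_normK ?num_real// expr_le1.
  by move=> ? ?; apply/andP; split; lra.
have p1 : 0 <= (1 - s ^+ 2) ^+ n <= 1.
  by case/andP: s2 => ? ?; rewrite exprn_ge0// exprn_ile1.
case/andP: p1 => p0 p1.
by rewrite /heaviside normrM -[leRHS]mulr1 ler_pM// ler_norml; apply/andP; split; lra.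
Qed.

Lemma cvg_heaviside s : `|s| <= 1 -> heaviside n s @[n --> \oo] --> ((0 < s)%R%:R : R).
Proof.
move=> s1; have [->|sn0] := eqVneq s 0.
  rewrite ltxx; under eq_fun do rewrite /heaviside expr0n/= subr0 expr1n subrr mulr0.
  exact: cvg_cst.
have c1 : 1 - (1 - s ^+ 2) ^+ n @[n --> \oo] --> (1 : R).
  rewrite -[X in _ --> X]subr0; apply: cvgB; first exact: cvg_cst.
  have : 0 < s ^+ 2 by rewrite exprn_even_gt0.
  have : s ^+ 2 <= 1 by rewrite -real_normK ?num_real// expr_le1.
  by move=> ? ?; apply: cvg_expr; rewrite ger0_norm; lra.
have c2 : sign_iter n s @[n --> \oo] --> (if 0 < s then 1 else - 1 : R).
  move: s1; rewrite ler_norml => /andP[h1 h2].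
  case: ifPn => [s0|]; first by apply: cvg_sign_iter; rewrite s0.
  rewrite -leNgt le_eqVlt (negbTE sn0)/= => s0.
  rewrite -[s]opprK; under eq_fun do rewrite sign_iterN.
  by apply: cvgN; apply: cvg_sign_iter; apply/andP; split; lra.
rewrite (_ : (0 < s)%R%:R = 2^-1 * (1 + (if 0 < s then 1 else - 1)) * 1); last first.
  by case: ifP => _ /=; field.
apply: cvgM => //; apply: cvgM; first exact: cvg_cst.
by apply: cvgD => //; exact: cvg_cst.
Qed.

End sign_polynomials.

(** * The algebra of trigonometric polynomials *)

Section trig_polynomials.
Variables (R : realType) (d : nat).
Implicit Types (p q : 'rV[R]_d -> R).

(** Only linear combinations are built in, so that orthogonality to every [cas k] extends to all
    members by induction; products are recovered in [trig_mul]. *)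
Inductive trig_poly : ('rV[R]_d -> R) -> Prop :=
| trig_cas k : trig_poly (cas k)
| trig_add p q : trig_poly p -> trig_poly q -> trig_poly (fun x => p x + q x)
| trig_scale c p : trig_poly p -> trig_poly (fun x => c * p x).

Lemma trig_cst c : trig_poly (fun=> c).
Proof.
rewrite (_ : (fun=> c) = (fun x => c * cas 0 x)).
  by apply: trig_scale; exact: trig_cas.
by apply/funext => x; rewrite cas0 mulr1.
Qed.

Lemma trig_sub p q : trig_poly p -> trig_poly q -> trig_poly (fun x => p x - q x).
Proof.
move=> tp tq; rewrite (_ : (fun x => _) = (fun x => p x + -1 * q x)).
  by apply: trig_add => //; exact: trig_scale.
by apply/funext => x; rewrite mulN1r.
Qed.

Lemma trig_cos k : trig_poly (fun x => cos (phase k x)).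
Proof.
rewrite (_ : (fun x => _) = (fun x => 2^-1 * (cas k x + cas (- k) x))).
  by apply: trig_scale; apply: trig_add; exact: trig_cas.
by apply/funext => x; rewrite cosE_cas.
Qed.

Lemma trig_sin k : trig_poly (fun x => sin (phase k x)).
Proof.
rewrite (_ : (fun x => _) = (fun x => 2^-1 * (cas k x - cas (- k) x))).
  by apply: trig_scale; apply: trig_sub; exact: trig_cas.
by apply/funext => x; rewrite sinE_cas.
Qed.

Lemma trig_mul p q : trig_poly p -> trig_poly q -> trig_poly (fun x => p x * q x).
Proof.
move=> tp tq; elim: tp => [k|p1 p2 _ ih1 _ ih2|c p1 _ ih].
- elim: tq => [l|q1 q2 _ ih1 _ ih2|c q1 _ ih].
  + rewrite (_ : (fun x => _) =
      (fun x => cos (phase (k - l) x) + sin (phase (k + l) x))).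
      by apply: trig_add; [exact: trig_cos|exact: trig_sin].
    by apply/funext => x; rewrite casM.
  + by under eq_fun do rewrite mulrDr; exact: trig_add.
  + by under eq_fun do rewrite mulrCA; exact: trig_scale.
- by under eq_fun do rewrite mulrDl; exact: trig_add.
- by under eq_fun do rewrite -mulrA; exact: trig_scale.
Qed.

Lemma trig_exp p n : trig_poly p -> trig_poly (fun x => p x ^+ n).
Proof.
move=> tp; elim: n => [|n ih]; first by under eq_fun do rewrite expr0; exact: trig_cst.
by under eq_fun do rewrite exprS; exact: trig_mul.
Qed.

Lemma trig_meas p : trig_poly p -> measurable_fun setT p.
Proof.
elim=> [k|p1 p2 _ ih1 _ ih2|c p1 _ ih]; first exact: measurable_cas.
- exact: measurable_funD.
- by apply: measurable_funM.
Qed.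

Lemma trig_bounded p : trig_poly p -> exists M, forall x, `|p x| <= M.
Proof.
elim=> [k|p1 p2 _ [M1 ih1] _ [M2 ih2]|c p1 _ [M ih]].
- by exists 2 => x; exact: cas_max.
- by exists (M1 + M2) => x; rewrite (le_trans (ler_normD _ _))// lerD.
- by exists (`|c| * M) => x; rewrite normrM ler_wpM2l.
Qed.

Lemma trig_heaviside p n : trig_poly p -> trig_poly (fun x => heaviside n (p x)).
Proof.
move=> tp; have ts : trig_poly (fun x => sign_iter n (p x)).
  elim: n => [//|n ih]; rewrite /sign_iter /=.
  rewrite (_ : (fun x => _) = (fun x =>
    2^-1 * (3 * sign_iter n (p x) - sign_iter n (p x) ^+ 3))).
    by apply: trig_scale; apply: trig_sub; [exact: trig_scale|exact: trig_exp].
  by apply/funext => x; rewrite mulrC.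
apply: trig_mul.
  by apply: trig_scale; apply: trig_add => //; exact: trig_cst.
apply: trig_sub; first exact: trig_cst.
by apply/trig_exp/trig_sub; [exact: trig_cst|exact: trig_exp].
Qed.

End trig_polynomials.

Lemma int_dominated_cvg (disp : measure_display) (T : measurableType disp)
    (R : realType) (mu : probability T R) (h : nat -> T -> R) (f g : T -> R) :
  (forall n, measurable_fun setT (h n)) -> measurable_fun setT f ->
  {ae mu, forall x, h n x @[n --> \oo] --> f x} -> rint mu g ->
  {ae mu, forall x, forall n, `|h n x| <= g x} ->
  \int[mu]_x h n x @[n --> \oo] --> \int[mu]_x f x.
Proof.
move=> mh mf hf ig hg.
have [|||||i1 _ c] := @dominated_convergence _ _ _ mu _ measurableT
  (fun n => EFin \o h n) (EFin \o f) (EFin \o g).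
- by move=> n; exact/measurable_EFinP.
- exact/measurable_EFinP.
- by apply: filterS hf => x hx _; apply: cvg_EFin => //; exact: nearW.
- exact: ig.
- by apply: filterS hg => x hx n _; rewrite lee_fin.
- by apply: fine_cvg; rewrite /Rintegral fineK//; exact: integrable_fin_num.
Qed.

(** * Completeness of the Hartley system *)

Section hartley_complete.
Variables (R : realType) (d : nat).
Local Notation mu := (torus R d).
Implicit Types (A : set 'rV[R]_d) (x : 'rV[R]_d).

(** The faces form a null set; leaving them out keeps [sin (pi * (1 - x 0 i))] positive. *)
Definition open_cube : set 'rV[R]_d := [set x | forall i, 0 < x 0 i < 1].

(* Bounded pointwise limits of trigonometric polynomials give zero integral
   against any f orthogonal to them, by dominated convergence; the sets below
   form a pi-system generating the measurable sets up to a null set. *)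
Definition trig_limit A := measurable A /\
  exists h : nat -> 'rV[R]_d -> R, [/\ forall n, trig_poly (h n),
    forall n x, `|h n x| <= 1 &
    forall x, open_cube x -> h n x @[n --> \oo] --> (\1_A x : R)].

Lemma trig_limitI : setI_closed trig_limit.
Proof.
move=> A B [mA [h [th h1 hA]]] [mB [g [tg g1 gB]]]; split; first exact: measurableI.
exists (fun n x => h n x * g n x); split.
- by move=> n; exact: trig_mul.
- by move=> n x; rewrite normrM -[leRHS]mulr1 ler_pM.
- by move=> x cx; rewrite indicI; apply: cvgM; [exact: hA|exact: gB].
Qed.

(** For 0 <= a < 1, the condition a < x_i is the positivity of the product [q] of two sines on the
    open cube. Each sine changes sign under a unit shift, but the product is 1-periodic, hence a
    trigonometric polynomial to which the Heaviside approximations apply. *)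
Lemma trig_limit_ray i a : trig_limit [set x | a < x 0 i].
Proof.
have mray : measurable [set x : 'rV[R]_d | a < x 0 i].
  have := @measurable_entry _ (measurableTypeR R) 1 d 0 i measurableT `]a, +oo[%classic.
  rewrite setTI (_ : _ @^-1` _ = [set x : 'rV[R]_d | a < x 0 i]); last first.
    by apply/seteqP; split => x /=; rewrite in_itv/= andbT.
  by apply; exact: measurable_itv.
split=> //.
have [a1|a1] := leP 1 a.
  exists (fun _ _ => 0); split; first by move=> _; exact: trig_cst.
    by move=> _ x; rewrite normr0.
  move=> x /(_ i) /andP[_ x1]; rewrite indicE memNset; first exact: cvg_cst.
  by apply/negP; rewrite -leNgt (le_trans _ a1)// ltW.
have [a0|a0] := ltP a 0.
  exists (fun _ _ => 1); split; first by move=> _; exact: trig_cst.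
    by move=> _ x; rewrite normr1.
  move=> x /(_ i) /andP[x0 _]; rewrite indicE mem_set; first exact: cvg_cst.
  exact: lt_trans x0.
pose q x : R := sin (pi * (x 0 i - a)) * sin (pi * (1 - x 0 i)).
have q1 x : `|q x| <= 1 by rewrite normrM -[leRHS]mulr1 ler_pM// sin_max.
have tq : trig_poly q.
  pose k : 'rV[int]_d := delta_mx 0 i.
  have pk x : phase k x = 2 * pi * x 0 i.
    rewrite /phase (bigD1 i)//= big1 ?addr0 ?mxE ?eqxx ?mul1r// => j ji.
    by rewrite mxE eqxx/= (negbTE ji) mul0r.
  rewrite (_ : q = (fun x => 2^-1 * (cos (pi * a) -
    (cos (pi * a) * cos (phase k x) + sin (pi * a) * sin (phase k x))))).
    apply: trig_scale; apply: trig_sub; first exact: trig_cst.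
    by apply: trig_add; apply: trig_scale; [exact: trig_cos|exact: trig_sin].
  apply/funext => x; rewrite pk /q.
  rewrite (_ : pi * (1 - x 0 i) = - (pi * x 0 i) + pi); last by ring.
  rewrite sinDpi sinN opprK (_ : 2 * pi * x 0 i = pi * x 0 i + pi * x 0 i); last by ring.
  rewrite mulrBr sinB cosD sinD.
  have := cos2Dsin2 (pi * x 0 i); set C := cos (pi * x 0 i); set S := sin (pi * x 0 i) => CS.
  transitivity (2^-1 * (cos (pi * a) * (C ^+ 2 + S ^+ 2) -
    (cos (pi * a) * (C * C - S * S) + sin (pi * a) * (S * C + C * S)))).
    by field.
  by rewrite CS mulr1.
exists (fun n x => heaviside n (q x)); split.
- by move=> n; exact: trig_heaviside.
- by move=> n x; exact: heaviside_max.
move=> x /(_ i) /andP[x0 x1].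
rewrite indicE (_ : (x \in _) = (0 < q x)); first exact: cvg_heaviside.
have s1 : 0 < sin (pi * (1 - x 0 i)).
  apply: sin_gt0_pi; rewrite mulr_gt0 ?pi_gt0 ?subr_gt0//=.
  by rewrite -[ltRHS]mulr1 ltr_pM2l ?pi_gt0// gtrBl.
rewrite /q pmulr_lgt0//.
have [ax|xa] := ltP a (x 0 i).
  rewrite mem_set//; apply/esym; apply: sin_gt0_pi.
  rewrite mulr_gt0 ?pi_gt0 ?subr_gt0//=.
  by rewrite -[ltRHS]mulr1 ltr_pM2l ?pi_gt0//; lra.
rewrite memNset; last by apply/negP; rewrite -leNgt.
apply/esym/negbTE; rewrite -leNgt -oppr_ge0 -sinN -mulrN opprB.
apply: sin_ge0_pi; rewrite mulr_ge0 ?subr_ge0//= ?pi_ge0//.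
by rewrite -[leRHS]mulr1 ler_pM2l ?pi_gt0//; lra.
Qed.

(** Open rays generate the Borel sets of the line, and preimages of Borel sets under the entries
    generate the sigma-algebra of row vectors. *)
Lemma measurable_sub_trig_limit A : measurable A -> <<s trig_limit >> A.
Proof.
have sP := smallest_sigma_algebra setT trig_limit.
move: A; apply: smallest_sub => //.
move=> _ [i [j [B [mB ->]]]]; rewrite (ord1 i) {i}.
have [s0 sD sU] := sP.
have key : <<s @RGenOInfty.G R >> `<=`
    [set C | <<s trig_limit >> ((fun x : 'rV[R]_d => x 0 j) @^-1` C)].
  apply: smallest_sub => /=.
  - split => [|C|F FF] /=; first by rewrite preimage_set0.
    + by move=> sC; rewrite setTD preimage_setC -setTD; exact: sD.
    + by rewrite preimage_bigcup; exact: sU.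
  - move=> _ [a ->]; apply: sub_sigma_algebra.
    rewrite (_ : _ @^-1` _ = [set x : 'rV[R]_d | a < x 0 j]); first exact: trig_limit_ray.
    by apply/seteqP; split => x /=; rewrite in_itv/= andbT.
have := mB : (@ocitv R).-sigma.-measurable B.
rewrite RGenOInfty.measurableE; exact: key.
Qed.

End hartley_complete.

(** The indicator of the cube is a product of one-dimensional indicators of integral 1, so it has
    mean 1; a function with values 0 and 1 and mean 1 equals 1 almost everywhere. *)
Lemma open_cube_ae (R : realType) d :
  {ae torus R d, forall x, open_cube x}.
Proof.
pose e (t : R) : R := \1_(`]0, 1[%classic) t.
have me : measurable_fun setT e by apply: measurable_indic; exact: measurable_itv.
have e01 t : e t = 0 \/ e t = 1.
  by rewrite /e indicE; case: (_ \in _); [right|left].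
pose c n (x : 'rV[R]_n) := \prod_(i < n) e (x 0 i).
have c01 n x : c n x = 0 \/ c n x = 1.
  rewrite /c; elim/big_ind: _ => [|a b [->|->] [->|->]|i _]; 
    rewrite ?mul0r ?mulr0 ?mulr1; first [by left|by right|exact: e01].
have mc n : measurable_fun setT (c n).
  rewrite /c; elim: (index_enum _) => [|i s ih].
    by under eq_fun do rewrite big_nil; exact: measurable_cst.
  under eq_fun do rewrite big_cons; apply: measurable_funM => //.
  exact: (measurableT_comp me (measurable_entry _ _)).
have c1 n x : `|c n x| <= 1 by case: (c01 n x) => ->; rewrite ?normr0 ?normr1.
have e1 t : `|e t| <= 1 by case: (e01 t) => ->; rewrite ?normr0 ?normr1.
have ie : \int[uniform_prob (@ltr01 R)]_t e t = 1.
  rewrite /Rintegral integral_uniform; last 2 first.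
  - exact/measurable_EFinP.
  - by move=> t; rewrite lee_fin; case: (e01 t) => ->.
  rewrite subr0 invr1 mul1e integral_indic//= setIidl; last first.
    by apply: subset_itv; rewrite bnd_simp.
  by rewrite lebesgue_measure_itv/= lte_fin ltr01 sube0.
have ic n : \int[torus R n]_x c n x = 1.
  elim: n => [|n ih].
    by rewrite -[RHS](int_cst (torus R 0)); apply: eq_Rintegral => x _; rewrite /c big_ord0.
  have := torus_int_prod me (mc n) e1 (c1 n); rewrite ie ih mulr1 => <-.
  apply: eq_Rintegral => x _; rewrite /c big_ord_recl; congr (_ * _).
  by apply: eq_bigr => i _; rewrite mxE.
have L2c : (fun x => 1 - c d x) \in Lfun (torus R d) 2%:E.
  apply: L2B; first exact: L2_cst.
  by apply: (@L2_bounded _ _ _ _ 1); [exact: mc|apply: aeW => x; exact: c1].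
have : n2 (torus R d) (fun x => 1 - c d x) <= 0.
  rewrite /n2 (@eq_Rintegral _ _ _ _ _ (fun x => 1 - c d x)); last first.
    by move=> x _; case: (c01 d x) => ->; ring.
  rewrite intB ?int_cst ?ic ?subrr//; first exact: rint_cst.
  by apply: (@rint_bounded _ _ _ _ _ 1); [exact: mc|exact: c1].
move/(n2_eq0_ae L2c); apply: filterS => x /eqP; rewrite subr_eq0 => /eqP cx i.
have : e (x 0 i) != 0.
  have : c d x != 0 by rewrite -cx oner_neq0.
  by rewrite /c prodf_seq_neq0 => /allP /(_ i); apply; rewrite mem_index_enum.
rewrite /e indicE; case: (boolP (_ \in _)) => [/set_mem/=|]; first by rewrite in_itv.
by rewrite eqxx.
Qed.

Section hartley_complete.
Variables (R : realType) (d : nat).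
Local Notation mu := (torus R d).

(** Dynkin's pi-lambda argument: the sets over which [f] has integral 0 form a lambda-system, which
    contains the pi-system [trig_limit] and hence all measurable sets. *)
Lemma cas_complete (f : 'rV[R]_d -> R) : f \in Lfun mu 2%:E ->
  (forall k, \int[mu]_x (f x * cas k x) = 0) -> {ae mu, forall x, f x = 0}.
Proof.
move=> fL f0; have fi := L2_rint fL; have mf := L2_meas fL.
have fT p : trig_poly p -> \int[mu]_x (f x * p x) = 0.
  elim=> [k|p1 p2 t1 ih1 t2 ih2|c p1 t1 ih1]; first exact: f0.
  - under eq_Rintegral do rewrite mulrDr.
    have L2p q : trig_poly q -> rint mu (fun x => f x * q x).
      move=> tq; have [M qM] := trig_bounded tq; apply: L2_mul => //.
      by apply: (@L2_bounded _ _ _ _ M); [exact: trig_meas|exact: aeW].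
    by rewrite intD ?ih1 ?ih2 ?addr0//; exact: L2p.
  - under eq_Rintegral do rewrite mulrCA.
    have [M qM] := trig_bounded t1.
    rewrite intZ ?ih1 ?mulr0//; apply: L2_mul => //.
    by apply: (@L2_bounded _ _ _ _ M); [exact: trig_meas|exact: aeW].
pose H := [set A | measurable A /\ \int[mu]_x (f x * \1_A x) = 0].
have mfA A : measurable A -> measurable_fun setT (fun x => f x * \1_A x).
  by move=> mA; apply: measurable_funM => //; exact: measurable_indic.
have ind1 (A : set 'rV[R]_d) x : `|\1_A x : R| <= 1.
  by rewrite indicE; case: (_ \in _); rewrite ?normr0 ?normr1.
have ifA A : measurable A -> rint mu (fun x => f x * \1_A x).
  move=> mA; apply: (rint_le _ (rint_norm fi)); first exact: mfA.
  by move=> x; rewrite normrM -[leRHS]mulr1 ler_wpM2l.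
(* Passage to the limit with [|f|] as dominating function; it serves both the sets of the pi-system
   and increasing unions. *)
have dct (h : nat -> 'rV[R]_d -> R) (A : set 'rV[R]_d) : measurable A ->
    (forall n, measurable_fun setT (h n)) -> (forall n x, `|h n x| <= 1) ->
    {ae mu, forall x, h n x @[n --> \oo] --> (\1_A x : R)} ->
    (forall n, \int[mu]_x (f x * h n x) = 0) -> \int[mu]_x (f x * \1_A x) = 0.
  move=> mA mh h1 hA h0.
  have := @int_dominated_cvg _ _ _ mu (fun n x => f x * h n x)
    (fun x => f x * \1_A x) (fun x => `|f x|).
  have -> : (fun n => \int[mu]_x (f x * h n x)) = (fun=> 0) by apply/funext => n; exact: h0.
  move=> P; apply/esym; apply: (@cvg_unique _ (@Rhausdorff R) (0 @[_ --> \oo]));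
    first exact: cvg_cst.
  apply: P => //.
  - by move=> n; exact: measurable_funM.
  - exact: mfA.
  - by apply: filterS hA => x hx; apply: cvgM => //; exact: cvg_cst.
  - exact: rint_norm.
  - by apply: aeW => x n; rewrite normrM -[leRHS]mulr1 ler_wpM2l.
have HP : @trig_limit R d `<=` H.
  move=> A [mA [h [th h1 hA]]]; split => //; apply: (dct h) => //.
  - by move=> n; exact: trig_meas.
  - by apply: filterS (open_cube_ae R d) => x; exact: hA.
  - by move=> n; exact: fT.
have fE : \int[mu]_x f x = 0.
  by rewrite -(f0 0); apply: eq_Rintegral => x _; rewrite cas0 mulr1.
have lH : lambda_system setT H.
  split => //.
  - split=> //; rewrite -[RHS]fE; apply: eq_Rintegral => x _.
    by rewrite indicE mem_set// mulr1.
  - move=> A B BA [mA A0] [mB B0]; split; first exact: measurableD.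
    rewrite -[RHS](subrr 0) -{1}A0 -B0 -intB; [|exact: ifA..].
    apply: eq_Rintegral => x _; rewrite -mulrBr; congr (_ * _).
    rewrite !indicE in_setD; case: (boolP (x \in B)) => xB /=.
      by rewrite (mem_set (BA _ (set_mem xB))) andbF subrr.
    by rewrite andbT subr0.
  - move=> F nF HF; have mF : measurable (\bigcup_n F n).
      by apply: bigcup_measurable => n _; exact: (HF n).1.
    split => //; apply: (dct (fun n => \1_(F n))) => //.
    + by move=> n; apply: measurable_indic; exact: (HF n).1.
    + apply: aeW => x; have [[N _ FN]|nF'] := pselect ((\bigcup_n F n) x).
        rewrite [\1_(\bigcup_n _) x]indicE mem_set; last by exists N.
        apply: cvg_near_cst; near=> n.
        rewrite indicE mem_set//.
        have : (N <= n)%N by near: n; exact: nbhs_infty_ge.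
        by move=> /nF /subsetPset; exact.
      rewrite [\1_(\bigcup_n _) x]indicE memNset//.
      apply: cvg_near_cst; apply: nearW => n.
      by rewrite indicE memNset// => Fn; apply: nF'; exists n.
    + by move=> n; exact: (HF n).2.
have mH A : measurable A -> \int[mu]_x (f x * \1_A x) = 0.
  move=> mA; suff [] : H A by [].
  apply: (lambda_system_subset (@trig_limitI R d) lH HP) => //.
  exact: measurable_sub_trig_limit.
have := @integral_ae_eq _ _ _ mu setT measurableT (cst 0%E) (EFin \o f) fi.
have m0 : measurable_fun setT (cst 0%E : 'rV[R]_d -> \bar R) by exact: measurable_cst.
move=> /(_ m0) K; have : ae_eq mu setT (EFin \o f) (cst 0%E).
  apply: K => E _ mE; rewrite integral0 integral_mkcond.
  have iE := ifA _ mE; have := mH E mE; rewrite /Rintegral => h.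
  rewrite (_ : _ \_ E = EFin \o (fun x => f x * \1_E x)).
    by rewrite -(fineK (integrable_fin_num measurableT iE)); congr EFin.
  apply/funext => x; rewrite patchE/= indicE; case: (boolP (x \in E)) => xE.
    by rewrite mulr1.
  by rewrite mulr0.
by apply: filterS => x /(_ I) [].
Unshelve. all: by end_near. Qed.

End hartley_complete.

(** * Smoothness and derivatives of the Hartley functions *)

Section trig_smooth.
Variables (R : realType) (d : nat).
Implicit Types (k : 'rV[int]_d) (x : 'rV[R]_d).

Lemma phase_shift k x j (t : R) :
  phase k (t *: delta_mx 0 j + x) = 2 * pi * (k 0 j)%:~R * t + phase k x.
Proof.
rewrite /phase (eq_bigr (fun i => (k 0 i)%:~R * (t * (i == j)%:R) +
  (k 0 i)%:~R * x 0 i)); last first.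
  by move=> i _; rewrite !mxE eqxx/= mulrDr.
rewrite big_split/= (bigD1 j)//= big1 ?eqxx; last first.
  by move=> i /negbTE ->; rewrite mulr0 mulr0.
rewrite /=; ring.
Qed.

(** At a fixed frequency this two-parameter family is stable under all partial derivatives, which
    gives the smoothness of [cas k] by induction on the list of directions. *)
Definition trig2 (a b : R) k x := a * cos (phase k x) + b * sin (phase k x).

Lemma partial_trig2 a b k (j : 'I_d) :
  partial j (trig2 a b k) =
  trig2 (b * (2 * pi * (k 0 j)%:~R)) (- a * (2 * pi * (k 0 j)%:~R)) k.
Proof.
apply/funext => x; rewrite /partial /trig2.
set c := 2 * pi * (k 0 j)%:~R; set p := phase k x.
pose g (t : R) := a * cos (c * t + p) + b * sin (c * t + p).
have dg : is_derive (0 : R) 1 g (b * c * cos p + - a * c * sin p).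
  by apply: is_derive_eq; rewrite /GRing.scale/= !mulr0 !add0r !addr0; ring.
rewrite -[RHS](@derive_val _ _ _ _ _ _ _ dg) /derive.
set F1 := (fun h => _); set F2 := (fun h => _).
suff -> : F1 = F2 by [].
apply/funext => h; rewrite /F1 /F2 /= /g !phase_shift -/c -/p addr0 mulr0 add0r.
by rewrite /GRing.scale/= mulr1.
Qed.

Lemma differentiable_trig2 a b k x : differentiable (trig2 a b k) x.
Proof.
have dp : differentiable (fun x : 'rV[R]_d => phase k x) x.
  apply: differentiableM; first exact: differentiable_cst.
  rewrite (_ : (fun x : 'rV[R]_d => \sum_i (k 0 i)%:~R * x 0 i) =
     \sum_i (fun x : 'rV[R]_d => (k 0 i)%:~R * x 0 i)); last first.
    by apply/funext => y; rewrite fct_sumE.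
  apply: differentiable_sum => i.
  apply: differentiableM; [exact: differentiable_cst|exact: differentiable_coord].
have dc : differentiable (fun x : 'rV[R]_d => cos (phase k x)) x.
  by apply: (differentiable_comp dp); apply/derivable1_diffP; apply: ex_derive.
have ds : differentiable (fun x : 'rV[R]_d => sin (phase k x)) x.
  by apply: (differentiable_comp dp); apply/derivable1_diffP; apply: ex_derive.
by apply: differentiableD; apply: differentiableM => //; exact: differentiable_cst.
Qed.

Lemma smooth_periodic_cas k : smooth_periodic (cas k : 'rV[R]_d -> R).
Proof.
split=> [x i|s x].
  have e : phase k (x + delta_mx 0 i) = phase k x + 2 * pi * (k 0 i)%:~R.
    by rewrite -[delta_mx 0 i]scale1r addrC phase_shift mulr1 addrC.
  by rewrite /cas e cosD2piz sinD2piz.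
suff [a [b ->]] : exists a b, foldr (@partial R d) (cas k) s = trig2 a b k.
  exact: differentiable_trig2.
elim: s => [|j s [a [b ih]]] /=.
  by exists 1, 1; apply/funext => y; rewrite /trig2 !mul1r.
by rewrite ih partial_trig2; do 2 eexists.
Qed.

(** Differentiation swaps the frequencies k and -k, which is why the coefficients of a gradient are
    read at [- k] in the Poincare inequality. *)
Lemma partial_cas k j :
  partial j (cas k : 'rV[R]_d -> R) = (fun x => 2 * pi * (k 0 j)%:~R * cas (- k) x).
Proof.
rewrite (_ : (cas k : 'rV[R]_d -> R) = trig2 1 1 k); last first.
  by apply/funext => x; rewrite /trig2 !mul1r.
rewrite partial_trig2; apply/funext => x.
by rewrite /trig2 /cas phaseN cosN sinN; ring.
Qed.

End trig_smooth.

(** * Bessel, Parseval and Poincare inequalities *)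

Section parseval.
Variables (R : realType) (d : nat).
Local Notation mu := (torus R d).
Local Notation freq := 'rV[int]_d.
Implicit Types (k l : freq) (s : seq freq) (f : 'rV[R]_d -> R).

Definition hartley_coef f k : R := \int[mu]_x (f x * cas k x).

Definition hartley_sum (c : freq -> R) s (x : 'rV[R]_d) : R :=
  \sum_(k <- s) c k * cas k x.

Lemma hartley_sum_L2 c s : hartley_sum c s \in Lfun mu 2%:E.
Proof. by apply: L2_sum => k; apply: L2Z; exact: cas_L2. Qed.

Lemma int_mul_hartley_sum f c s : f \in Lfun mu 2%:E ->
  \int[mu]_x (f x * hartley_sum c s x) = \sum_(k <- s) c k * hartley_coef f k.
Proof.
move=> fL; rewrite /hartley_sum.
under eq_Rintegral do rewrite mulr_sumr.
have i k : rint mu (fun x => f x * cas k x) by apply: L2_mul => //; exact: cas_L2.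
under eq_Rintegral do under eq_bigr do rewrite mulrCA.
rewrite int_sum; last by move=> k; exact: rintZ.
by apply: eq_bigr => k _; rewrite intZ.
Qed.

Lemma hartley_coef_sum c s l : uniq s ->
  hartley_coef (hartley_sum c s) l = if l \in s then c l else 0.
Proof.
move=> us; rewrite /hartley_coef.
under eq_Rintegral do rewrite mulrC.
rewrite int_mul_hartley_sum; last exact: cas_L2.
rewrite (eq_bigr (fun k => if k == l then c k else 0)); last first.
  move=> k _; rewrite /hartley_coef cas_orthonormal eq_sym.
  by case: ifP; rewrite (mulr1, mulr0).
case: ifPn => ls.
  by rewrite (bigD1_seq l)//= eqxx big1 ?addr0// => k /negbTE ->.
rewrite big_seq big1// => k ks; case: eqP => // kl.
by rewrite -kl ks in ls.
Qed.

Lemma n2_hartley_sum c s : uniq s ->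
  n2 mu (hartley_sum c s) = \sum_(k <- s) c k ^+ 2.
Proof.
move=> us; rewrite /n2; under eq_Rintegral do rewrite expr2.
rewrite int_mul_hartley_sum; last exact: hartley_sum_L2.
by apply: eq_big_seq => k ks; rewrite hartley_coef_sum// ks.
Qed.

Lemma n2_sub_hartley_sum f s : f \in Lfun mu 2%:E -> uniq s ->
  n2 mu (fun x => f x - hartley_sum (hartley_coef f) s x) =
  n2 mu f - \sum_(k <- s) hartley_coef f k ^+ 2.
Proof.
move=> fL us; set P := hartley_sum _ s.
rewrite (_ : (fun x => _) = (fun x => f x + -1 * P x)); last first.
  by apply/funext => x; rewrite mulN1r.
have PL : P \in Lfun mu 2%:E by exact: hartley_sum_L2.
rewrite n2_add_expand// n2_hartley_sum// int_mul_hartley_sum//.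
under [X in 2 * -1 * X]eq_bigr do rewrite -expr2.
ring.
Qed.

Lemma bessel f s : f \in Lfun mu 2%:E -> uniq s ->
  \sum_(k <- s) hartley_coef f k ^+ 2 <= n2 mu f.
Proof.
by move=> fL us; rewrite -subr_ge0 -n2_sub_hartley_sum//; exact: n2_ge0.
Qed.

(** Frequencies with code below [n]: nested finite lists that exhaust Z^d, so that sums of squares
    over them increase with [n]. *)
Definition freq_enum (n : nat) : seq freq := pmap (@pickle_inv freq) (iota 0 n).

Lemma freq_enum_uniq n : uniq (freq_enum n).
Proof. by apply: (pmap_uniq (@pickle_invK freq)); exact: iota_uniq. Qed.

Lemma mem_freq_enum k n : (pickle k < n)%N -> k \in freq_enum n.
Proof.
by move=> kn; rewrite mem_pmap; apply/mapP; exists (pickle k);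
  rewrite ?mem_iota// pickleK_inv.
Qed.

Lemma freq_enum_cat m n : (m <= n)%N ->
  freq_enum n = freq_enum m ++ pmap (@pickle_inv freq) (iota m (n - m)).
Proof. by move=> mn; rewrite -pmap_cat -iotaD subnKC. Qed.

(** By Bessel's inequality the partial sums form a Cauchy sequence; their limit has the coefficients
    of [f], so completeness identifies it with [f]. Finite lists and a slack [e] take the place of
    infinite sums. *)
Lemma parseval f e : f \in Lfun mu 2%:E -> 0 < e ->
  exists2 s, uniq s & n2 mu f <= \sum_(k <- s) hartley_coef f k ^+ 2 + e.
Proof.
move=> fL e0.
pose c := hartley_coef f; pose u n := hartley_sum c (freq_enum n).
pose S n := \sum_(k <- freq_enum n) c k ^+ 2.
have uL n : u n \in Lfun mu 2%:E by exact: hartley_sum_L2.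
have Sbound n : S n <= n2 mu f by apply: bessel => //; exact: freq_enum_uniq.
have uB m n : (m <= n)%N -> n2 mu (fun x => u n x - u m x) = S n - S m.
  move=> mn; have := freq_enum_uniq n; rewrite /u /S (freq_enum_cat mn).
  rewrite cat_uniq => /and3P[_ _ us].
  rewrite (_ : (fun x => _) = hartley_sum c (pmap (@pickle_inv freq) (iota m (n - m)))).
    by rewrite n2_hartley_sum// big_cat/= [RHS]addrC addKr.
  by apply/funext => x; rewrite /hartley_sum big_cat/= [LHS]addrC addKr.
have Smono m n : (m <= n)%N -> S m <= S n.
  by move=> mn; rewrite -subr_ge0 -uB//; exact: n2_ge0.
have Scauchy r : 0 < r -> exists N, forall m n, (N <= m)%N -> (N <= n)%N ->
    S n - S m <= r.
  move=> r0; have supS : has_sup (range S).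
    by split; [exists (S 0%N), 0%N|exists (n2 mu f) => _ [n _ <-]].
  have [_ [N _ <-] SN] := sup_adherent r0 supS.
  exists N => m n Nm Nn; have := Smono _ _ Nm.
  have : S n <= sup (range S) by apply: ub_le_sup; [exact: supS.2|exists n].
  lra.
have [w [wL uw _]] : exists f, [/\ f \in Lfun mu 2%:E,
    forall e, 0 < e -> exists N, forall n, (N <= n)%N ->
      n2 mu (fun x => u n x - f x) <= e &
    forall x y, (forall n, u n x = u n y) -> f x = f y].
  apply: L2_complete => // r /Scauchy[N SN].
  exists N => m n Nm Nn; case/orP: (leq_total m n) => mn.
    by rewrite n2B_sym uB// SN.
  by rewrite uB// SN.
have fw : {ae mu, forall x, f x - w x = 0}.
  apply: cas_complete => [|l]; first exact: L2B.
  have casl := cas_L2 R l.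
  apply: (@sqr_le_eps_eq0 _ _ 1) => r r0; rewrite mulr1.
  (* Beyond the code of [l], the partial sum has the same coefficient at [l] as [f]. *)
  have [N uN] := uw r r0; pose n := maxn N (pickle l).+1.
  have cl : hartley_coef (u n) l = c l.
    rewrite hartley_coef_sum ?freq_enum_uniq// mem_freq_enum//.
    by rewrite leq_maxr.
  have -> : \int[mu]_x ((f x - w x) * cas l x) = \int[mu]_x ((u n x - w x) * cas l x).
    transitivity (c l - hartley_coef w l).
      rewrite /c /hartley_coef -intB; [|exact: L2_mul..].
      by apply: eq_Rintegral => x _; rewrite mulrBl.
    rewrite -cl /hartley_coef -intB; [|exact: L2_mul..].
    by apply: eq_Rintegral => x _; rewrite mulrBl.
  apply: le_trans (L2_cauchy_schwarz _ casl) _; first exact: L2B.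
  have -> : n2 mu (cas l) = 1.
    by rewrite /n2; under eq_Rintegral do rewrite expr2; rewrite cas_orthonormal eqxx.
  by rewrite mulr1; apply: uN; rewrite leq_maxl.
have [N uN] := uw e e0; exists (freq_enum N); first exact: freq_enum_uniq.
rewrite -lerBlDl -n2_sub_hartley_sum ?freq_enum_uniq//.
rewrite (@n2_eq_ae _ _ _ _ _ (fun x => w x - u N x)).
- by rewrite n2B_sym; exact: uN.
- exact: (L2B fL (uL N)).
- exact: (L2B wL (uL N)).
- by apply: filterS fw => x /eqP; rewrite subr_eq0 => /eqP ->.
Qed.

(** Mode by mode: the coefficient of the gradient carries a factor 2 pi k_j, of absolute value at
    least 1 for some j when k is not 0, and the zero mode is the mean, which vanishes. *)
Lemma poincare (v : 'rV[R]_d -> R) (G : 'rV[R]_d -> 'cV[R]_d) :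
  v \in Lfun mu 2%:E -> (forall j, (fun x => G x j 0) \in Lfun mu 2%:E) ->
  weak_gradient v G -> \int[mu]_x v x = 0 ->
  n2 mu v <= \sum_j n2 mu (fun x => G x j 0).
Proof.
move=> vL GL vG v0; apply/ler_addgt0Pr => e e0.
have [s us /le_trans] := parseval vL e0; apply; rewrite lerD2r.
apply: (@le_trans _ _ (\sum_(k <- s) \sum_j
    hartley_coef (fun x => G x j 0) (- k) ^+ 2)); last first.
  rewrite exchange_big/=; apply: ler_sum => j _.
  rewrite -(big_map -%R xpredT (fun k => hartley_coef (fun x => G x j 0) k ^+ 2)).
  by apply: bessel => //; rewrite map_inj_uniq//; exact: oppr_inj.
apply: ler_sum => k _.
have [->|k0] := eqVneq k 0.
  apply: (@le_trans _ _ 0); last by apply: sumr_ge0 => j _; exact: sqr_ge0.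
  rewrite /hartley_coef; under eq_Rintegral do rewrite cas0 mulr1.
  by rewrite v0 expr0n.
have [j kj] : exists j, k 0 j != 0.
  apply/existsP; apply: contraR k0 => /existsPn kj; apply/eqP/rowP => j.
  by have := kj j; rewrite negbK mxE => /eqP.
apply: (@le_trans _ _ (hartley_coef (fun x => G x j 0) (- k) ^+ 2)); last first.
  by rewrite (bigD1 j)//= lerDl; apply: sumr_ge0 => i _; exact: sqr_ge0.
have := vG _ j (smooth_periodic_cas R (- k)).
rewrite partial_cas opprK; under eq_Rintegral do rewrite mulrCA.
rewrite intZ; last by apply: L2_mul => //; exact: cas_L2.
move=> /(congr1 (fun t => t ^+ 2)); rewrite sqrrN => <-.
rewrite exprMn ler_peMl ?sqr_ge0//.
rewrite mxE intrN mulrN sqrrN exprMn mulr_ege1//.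
  have : 1 <= pi :> R by rewrite (le_trans _ (pi_ge2 R))// ler1n.
  by move=> p1; rewrite expr_ge1 ?mulr_ege1 ?ler1n// mulr_ge0// ltW// pi_gt0.
rewrite -rmorphXn ler1z /= -gtz0_ge1 lt_neqAle sqr_ge0 andbT eq_sym sqrf_eq0.
exact: kj.
Qed.

End parseval.

(** * The space of mean-zero periodic Sobolev functions *)

Section continuous_fields.
Variables (R : realType) (d : nat).

Definition grid_round (n : nat) (x : 'rV[R]_d) : 'rV[int]_d :=
  \row_i Num.floor (n.+1%:R * x 0 i).

Definition grid_point (n : nat) (k : 'rV[int]_d) : 'rV[R]_d :=
  \row_i ((k 0 i)%:~R / n.+1%:R).

Lemma measurable_grid_round n (D : set 'rV[int]_d) :
  measurable [set x : 'rV[R]_d | D (grid_round n x)].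
Proof.
rewrite (_ : [set x | _] = \bigcup_k (if `[< D k >] then
  [set x : 'rV[R]_d | grid_round n x = k] else set0)); last first.
  apply/seteqP; split => x /=.
    by move=> Dx; exists (grid_round n x) => //; rewrite asboolT.
  by move=> [k _]; case: ifPn => //= /asboolP Dk ->.
apply: countable_bigcupT_measurable => [|k]; first exact: countableP.
case: ifP => // _.
rewrite (_ : [set x | _] = \bigcap_(i in [set: 'I_d])
  [set x : 'rV[R]_d | (k 0 i)%:~R <= n.+1%:R * x 0 i < (k 0 i + 1)%:~R]); last first.
  apply/seteqP; split => x /=.
    by move=> <- i _; rewrite /= mxE floor_itv.
  move=> H; apply/rowP => i; rewrite mxE; apply/floor_def.
  exact: (H i I).
apply: fin_bigcap_measurable => [|i _]; first exact: finite_finset.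
have mi : measurable_fun setT (fun x : 'rV[R]_d => n.+1%:R * x 0 i).
  by apply: measurable_funM => //; exact: measurable_entry.
have := mi measurableT `[(k 0 i)%:~R, (k 0 i + 1)%:~R[%classic (measurable_itv _).
rewrite setTI; congr measurable; apply/seteqP; split => x /=; by rewrite in_itv.
Qed.

(** The sigma-algebra on row vectors is generated by the entries rather than by open sets. The
    function is therefore written as the limit of its values at grid points of mesh 1 / (n + 1),
    which are constant on countably many measurable cells. *)
Lemma continuous_measurable_field (f : 'rV[R]_d -> R) :
  (forall x, {for x, continuous f}) -> measurable_fun setT f.
Proof.
move=> cf; apply: (@measurable_fun_cvg _ _ _ _ (fun n x => f (grid_point n (grid_round n x)))).
  move=> n _ B mB; rewrite setTI.
  exact: (measurable_grid_round n [set k | B (f (grid_point n k))]).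
move=> x _; apply: (@cvg_comp _ _ _ (fun n => grid_point n (grid_round n x)) f _ _ _ _ (cf x)).
apply/cvg_ballP => e e0; near=> n.
split=> // i j; rewrite (ord1 i) !mxE /ball/= /ball_/=.
have n0 : 0 < n.+1%:R :> R by [].
have /andP[h1 h2] := floor_itv (n.+1%:R * x 0 j).
set z : R := (Num.floor _)%:~R in h1 *.
have h2' : n.+1%:R * x 0 j - z < 1 by move: h2; rewrite intrD; lra.
have -> : x 0 j - z / n.+1%:R = (n.+1%:R * x 0 j - z) / n.+1%:R by field.
rewrite ger0_norm ?divr_ge0 ?subr_ge0// ltr_pdivrMr//.
apply: (lt_le_trans h2').
have : e^-1 <= n.+1%:R.
  apply: (@le_trans _ _ (Num.truncn e^-1).+1%:R); first exact/ltW/truncnS_gt.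
  rewrite ler_nat ltnS; near: n; exact: nbhs_infty_ge.
by rewrite -ler_pdivrMl// mulr1.
Unshelve. all: by end_near. Qed.

Lemma continuous_bounded_cube (f : 'rV[R]_d -> R) :
  (forall x, {for x, continuous f}) -> exists M, forall x, open_cube x -> `|f x| <= M.
Proof.
move=> cf.
have cK := @rV_compact R d (fun=> `[0, 1]%classic) (fun=> @segment_compact R 0 1).
have : bounded_set (f @` [set v : 'rV[R]_d | forall i, `[0%R, 1%R]%classic (v ord0 i)]).
  apply/compact_bounded/continuous_compact => //; exact: continuous_subspaceT.
move=> [M [_ MP]]; exists (M + 1) => x cx; apply: (MP (M + 1)); first by rewrite ltrDl.
exists x => // i; have /andP[h1 h2] := cx i.
by rewrite /= in_itv/= !ltW.
Qed.

Lemma smooth_periodic_L2 (phi : 'rV[R]_d -> R) (s : seq 'I_d) :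
  smooth_periodic phi -> foldr (@partial R d) phi s \in Lfun (torus R d) 2%:E.
Proof.
move=> [_ sp]; set f := foldr _ _ _.
have cf x : {for x, continuous f} by apply: differentiable_continuous; exact: sp.
have [M fM] := continuous_bounded_cube cf.
apply: (@L2_bounded _ _ _ _ M); first exact: continuous_measurable_field.
by apply: filterS (open_cube_ae R d) => x; exact: fM.
Qed.

End continuous_fields.

Section sobolev_space.
Variables (R : realType) (d : nat).
Local Notation mu := (torus R d).
Implicit Types (G D : 'rV[R]_d -> 'cV[R]_d).

Definition L2v G := forall j, (fun x => G x j 0) \in Lfun mu 2%:E.

Lemma norm_entry_le_frob m n (M : 'M[R]_(m, n)) i j : `|M i j| <= frob M.
Proof.
rewrite -ler_sqr ?nnegrE ?frob_ge0// real_normK ?num_real// sqr_frob.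
by rewrite (bigD1 (i, j))//= lerDl sumr_ge0// => p _; exact: sqr_ge0.
Qed.

Lemma Lp2P m n (F : 'rV[R]_d -> 'M[R]_(m, n)) :
  Lp 2%:E F <-> periodic F /\ forall i j, (fun x => F x i j) \in Lfun mu 2%:E.
Proof.
split=> [[pF mF FL]|[pF FL]].
  split=> // i j.
  have fL : (fun x => frob (F x)) \in Lfun mu 2%:E.
    rewrite inE; apply/andP; split; rewrite inE//=.
    exact: (measurableT_comp (@measurable_frob R m n) mF).
  apply: (L2_le_ae _ fL); first by move/measurable_fun_mxP : mF; exact.
  by apply: aeW => x; rewrite (ger0_norm (frob_ge0 _)) norm_entry_le_frob.
have mF : measurable_fun setT F by apply/measurable_fun_mxP => i j; exact: L2_meas (FL i j).
split=> //.
have : (fun x => frob (F x)) \in Lfun mu 2%:E.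
  apply/L2P; split; first exact: (measurableT_comp (@measurable_frob R m n) mF).
  under eq_fun do rewrite sqr_frob.
  by apply: rint_sum => p; apply: L2_sqr; exact: FL.
by rewrite inE => /andP[_]; rewrite inE.
Qed.

Lemma Lp2_colP G : Lp 2%:E G <-> periodic G /\ L2v G.
Proof.
split=> [/Lp2P[pG LG]|[pG LG]]; first by split=> // j; exact: LG.
by apply/Lp2P; split=> // i j; rewrite (ord1 j); exact: LG.
Qed.

Lemma H1dot_L2 v G : H1dot v G -> v \in Lfun mu 2%:E.
Proof. by case=> -[]. Qed.

Lemma H1dot_L2v v G : H1dot v G -> L2v G.
Proof. by case=> _ /Lp2_colP[]. Qed.

Lemma H1dot_lin u G v D t : H1dot u G -> H1dot v D ->
  H1dot (u + t *: v) (G + t *: D).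
Proof.
move=> [[pu uL] /Lp2_colP[pG GL] uG u0] [[pv vL] /Lp2_colP[pD DL] vD v0].
have tvL := L2Z t vL.
split.
- split; first by move=> x i; rewrite /= /GRing.add/= /GRing.scale/= pu pv.
  exact: (L2D uL tvL).
- apply/Lp2_colP; split; first by move=> x i; rewrite /= /GRing.add/= /GRing.scale/= pG pD.
  move=> j; rewrite (_ : (fun x => _) = (fun x => G x j 0 + t * D x j 0)).
    by apply: L2D => //; exact: L2Z.
  by apply/funext => x; rewrite !mxE.
- move=> phi j sphi.
  have pL := smooth_periodic_L2 [::] sphi.
  have dpL := smooth_periodic_L2 [:: j] sphi; rewrite /= in pL dpL.
  transitivity (\int[mu]_x (u x * partial j phi x) + t * \int[mu]_x (v x * partial j phi x)).
    have i1 := L2_mul uL dpL; have i2 := L2_mul vL dpL.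
    rewrite -intZ// -intD//; last exact: rintZ.
    by apply: eq_Rintegral => x _; rewrite -[(u + t *: v) x]/(u x + t * v x); ring.
  rewrite uG// vD// mulrN -opprD; congr (- _).
  have i1 := L2_mul (GL j) pL; have i2 := L2_mul (DL j) pL.
  rewrite -intZ// -intD//; last exact: rintZ.
  by apply: eq_Rintegral => x _; rewrite !mxE; ring.
- rewrite -[RHS](addr0 0) -{1}u0 -[in RHS](mulr0 t) -v0 -intZ ?L2_rint//.
  by rewrite -intD//; exact: L2_rint.
Qed.

Lemma H1dot0 : H1dot (0 : 'rV[R]_d -> R) 0.
Proof.
have z : (fun=> 0 : R) \in Lfun mu 2%:E := L2_cst mu 0.
split.
- by split.
- apply/Lp2_colP; split=> // j; rewrite (_ : (fun x => _) = (fun=> 0))//.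
  by apply/funext => x; rewrite mxE.
- move=> phi j _; rewrite (@eq_Rintegral _ _ _ _ _ (fun=> 0)); last first.
    by move=> x _; rewrite mul0r.
  rewrite int_cst (@eq_Rintegral _ _ _ _ _ (fun=> 0)) ?int_cst ?oppr0//.
  by move=> x _; rewrite mxE mul0r.
- exact: int_cst.
Qed.

Lemma H1dotB u G v D : H1dot u G -> H1dot v D -> H1dot (u - v) (G - D).
Proof.
by move=> uG vD; rewrite -(scaleN1r v) -(scaleN1r D); exact: H1dot_lin.
Qed.

End sobolev_space.

Section dot_product.
Variables (R : realType) (d : nat).
Implicit Types (u v w : 'cV[R]_d) (M : 'M[R]_d).

Lemma dotvE u v : dotv u v = (u^T *m v) 0 0.
Proof. by rewrite mxE; apply: eq_bigr => i _; rewrite mxE. Qed.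

Lemma dotvC u v : dotv u v = dotv v u.
Proof. by apply: eq_bigr => i _; rewrite mulrC. Qed.

Lemma dotvDl u v w t : dotv (u + t *: v) w = dotv u w + t * dotv v w.
Proof.
rewrite /dotv mulr_sumr -big_split; apply: eq_bigr => i _ /=.
by rewrite !mxE; ring.
Qed.

Lemma dotvDr u v w t : dotv w (u + t *: v) = dotv w u + t * dotv w v.
Proof. by rewrite dotvC dotvDl !(dotvC w). Qed.

Lemma dotv_mulmx M u v : dotv (M *m u) v = dotv u (M^T *m v).
Proof. by rewrite !dotvE trmx_mul mulmxA. Qed.

Lemma dotv_delta i v : dotv (delta_mx i 0) v = v i 0.
Proof.
rewrite /dotv (bigD1 i)//= big1 ?addr0 ?mxE ?eqxx ?mul1r// => j ji.
by rewrite mxE (negbTE ji) mul0r.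
Qed.

Lemma mulmx_delta_col M i j : (M *m delta_mx i 0 : 'cV[R]_d) j 0 = M j i.
Proof. by rewrite -colE mxE. Qed.

(** Testing on e_i + e_j and on e_i - e_j and subtracting isolates [M i j]. The Kronecker symbol [D]
    is kept as a number in [0, 1], so that the diagonal case needs no separate treatment. *)
Lemma entry_le_of_form M (a b : R) i j : 0 <= a -> M^T = M ->
  (forall xi, a * dotv xi xi <= dotv xi (M *m xi) <= b * dotv xi xi) ->
  `|M i j| <= b.
Proof.
move=> a0 sM H.
have q t := H (delta_mx i 0 + t *: delta_mx j 0).
have [D [/andP[D0 D1] DE]] : exists D : R, 0 <= D <= 1 /\ (i == j)%:R = D.
  by exists (i == j)%:R; split=> //; case: (i == j); rewrite ?lexx ?ler01.
have dd : dotv (delta_mx i 0) (delta_mx j 0) = D.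
  rewrite -DE.
  by rewrite dotv_delta mxE eqxx andbT.
have di (k : 'I_d) : dotv (delta_mx k 0) (delta_mx k 0) = 1 :> R.
  by rewrite dotv_delta mxE !eqxx.
have b0 : 0 <= b.
  have /andP[] := H (delta_mx i 0); rewrite di !mulr1; lra.
have E t : dotv (delta_mx i 0 + t *: delta_mx j 0)
    (M *m (delta_mx i 0 + t *: delta_mx j 0)) =
    M i i + 2 * t * M i j + t ^+ 2 * M j j.
  rewrite mulmxDr -scalemxAr !dotvDl !dotvDr !dotv_delta !mulmx_delta_col.
  have -> : M j i = M i j by rewrite -[in LHS]sM mxE.
  ring.
have N t : dotv (delta_mx i 0 + t *: delta_mx j 0)
    (delta_mx i 0 + t *: delta_mx j 0) = 1 + 2 * t * D + t ^+ 2.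
  by rewrite !dotvDl !dotvDr !di dd dotvC dd; ring.
have /andP[] := q 1; have /andP[] := q (-1); rewrite !E !N.
have /andP[] := H (delta_mx i 0); have /andP[] := H (delta_mx j 0).
rewrite !di !dotv_delta !mulmx_delta_col => *.
have := mulr_ge0 a0 D0; have := mulr_ge0 b0 D0.
have : 0 <= a * (1 - D) by rewrite mulr_ge0// subr_ge0.
have : 0 <= b * (1 - D) by rewrite mulr_ge0// subr_ge0.
by rewrite ler_norml => *; apply/andP; split; lra.
Qed.

End dot_product.

Section vector_fields.
Variables (R : realType) (d : nat).
Local Notation mu := (torus R d).
Implicit Types (G D : 'rV[R]_d -> 'cV[R]_d).

Definition nv G : R := \sum_j n2 mu (fun x => G x j 0).

Lemma nv_ge0 G : 0 <= nv G.
Proof. by apply: sumr_ge0 => j _; exact: n2_ge0. Qed.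

Lemma n2_le_nv G j : n2 mu (fun x => G x j 0) <= nv G.
Proof. by rewrite /nv (bigD1 j)//= lerDl sumr_ge0// => i _; exact: n2_ge0. Qed.

Lemma rint_dotv G D : L2v G -> L2v D -> rint mu (fun x => dotv (G x) (D x)).
Proof. by move=> GL DL; apply: rint_sum => i; exact: L2_mul. Qed.

Lemma nvE G : L2v G -> nv G = \int[mu]_x dotv (G x) (G x).
Proof.
move=> GL; rewrite /nv /dotv int_sum; last by move=> j; exact: L2_mul.
by apply: eq_bigr => j _; apply: eq_Rintegral => x _; rewrite expr2.
Qed.

Lemma L2vD G D t : L2v G -> L2v D -> L2v (G + t *: D).
Proof.
move=> GL DL j; rewrite (_ : (fun x => _) = (fun x => G x j 0 + t * D x j 0)).
  by apply: L2D => //; exact: L2Z.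
by apply/funext => x; rewrite !mxE.
Qed.

Lemma L2vB G D : L2v G -> L2v D -> L2v (G - D).
Proof. by move=> GL DL; rewrite -(scaleN1r D); exact: L2vD. Qed.

Lemma int_dotvDl G D E t : L2v G -> L2v D -> L2v E ->
  \int[mu]_x dotv ((G + t *: D) x) (E x) =
  \int[mu]_x dotv (G x) (E x) + t * \int[mu]_x dotv (D x) (E x).
Proof.
move=> GL DL EL; have i1 := rint_dotv GL EL; have i2 := rint_dotv DL EL.
rewrite -intZ// -intD//; last exact: rintZ.
by apply: eq_Rintegral => x _; rewrite -dotvDl.
Qed.

Lemma int_dotvC G D :
  \int[mu]_x dotv (G x) (D x) = \int[mu]_x dotv (D x) (G x).
Proof. by apply: eq_Rintegral => x _; rewrite dotvC. Qed.

Lemma nv_expand G D t : L2v G -> L2v D ->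
  nv (G + t *: D) = nv G + 2 * t * (\int[mu]_x dotv (G x) (D x)) + t ^+ 2 * nv D.
Proof.
move=> GL DL; have SL := L2vD t GL DL.
rewrite !nvE// int_dotvDl// ![\int[mu]_x dotv _ ((G + t *: D) x)]int_dotvC.
rewrite !int_dotvDl// (int_dotvC D G); ring.
Qed.

Lemma nv_cauchy_schwarz G D : L2v G -> L2v D ->
  (\int[mu]_x dotv (G x) (D x)) ^+ 2 <= nv G * nv D.
Proof.
move=> GL DL; apply: discriminant_le; first exact: nv_ge0.
by move=> t; rewrite -nv_expand//; exact: nv_ge0.
Qed.

(** Convergence of the gradients forces that of the functions by the Poincare inequality. The weak
    gradient identity passes to the limit by Cauchy-Schwarz, and periodicity by the pointwise clause
    of [L2_complete]. *)
Lemma H1dot_complete (u : nat -> 'rV[R]_d -> R) (G : nat -> 'rV[R]_d -> 'cV[R]_d) :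
  (forall n, H1dot (u n) (G n)) ->
  (forall e, 0 < e -> exists N, forall m n, (N <= m)%N -> (N <= n)%N ->
    nv (G m - G n) <= e) ->
  exists v D, H1dot v D /\
    forall e, 0 < e -> exists N, forall n, (N <= n)%N -> nv (G n - D) <= e.
Proof.
move=> uG GC.
have uL n := H1dot_L2 (uG n); have GL n := H1dot_L2v (uG n).
have entryB m n j : (fun x => G m x j 0 - G n x j 0) = (fun x => (G m - G n) x j 0).
  by apply/funext => x; rewrite !mxE.
have [v [vL uv pv]] : exists f, [/\ f \in Lfun mu 2%:E,
    forall e, 0 < e -> exists N, forall n, (N <= n)%N ->
      n2 mu (fun x => u n x - f x) <= e &
    forall x y, (forall n, u n x = u n y) -> f x = f y].
  apply: L2_complete => // e e0; have [N NP] := GC e e0.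
  exists N => m n Nm Nn; apply: le_trans (NP m n Nm Nn).
  have [[_ L1] /Lp2_colP[_ L2] w m0] := H1dotB (uG m) (uG n).
  exact: (poincare L1 L2 w m0).
have /choice[D0 D0P] j : exists f, [/\ f \in Lfun mu 2%:E,
    forall e, 0 < e -> exists N, forall n, (N <= n)%N ->
      n2 mu (fun x => G n x j 0 - f x) <= e &
    forall x y, (forall n, G n x j 0 = G n y j 0) -> f x = f y].
  apply: (@L2_complete _ _ _ _ (fun n x => G n x j 0)) => [n|e e0]; first exact: GL.
  have [N NP] := GC e e0; exists N => m n Nm Nn; apply: le_trans (NP m n Nm Nn).
  by rewrite entryB; exact: n2_le_nv.
pose D x : 'cV[R]_d := \col_j D0 j x.
have DE j : (fun x => D x j 0) = D0 j by apply/funext => x; rewrite mxE.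
have DL : L2v D by move=> j; rewrite DE; have [] := D0P j.
exists v, D; split; last first.
  (* A share of the error for each of the [d] components; the [+ 1] keeps the denominator positive
     for d = 0. *)
  move=> e e0; have e1 : 0 < e / (d%:R + 1) by rewrite divr_gt0// ltr_wpDl.
  have /choice[N NP] j : exists N, forall n, (N <= n)%N ->
      n2 mu (fun x => G n x j 0 - D0 j x) <= e / (d%:R + 1).
    by have [_ /(_ _ e1) + _] := D0P j.
  exists (\max_j N j)%N => n Nn.
  apply: (@le_trans _ _ (\sum_(j < d) e / (d%:R + 1))).
    apply: ler_sum => j _.
    rewrite (_ : (fun x => _) = (fun x => G n x j 0 - D0 j x)).
      by apply: NP; apply: leq_trans Nn; exact: leq_bigmax.
    by apply/funext => x; rewrite !mxE.
  rewrite sumr_const card_ord -[leLHS]mulr_natr mulrAC ler_pdivrMr ?ltr_wpDl//.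
  by rewrite ler_pM2l// lerDl.
have limE (f : nat -> R) (a : R) : (forall e, 0 < e -> exists N : nat, (f N - a) ^+ 2 <= e) ->
    (forall n, f n = 0) -> a = 0.
  move=> fa f0; apply: (@sqr_le_eps_eq0 _ _ 1) => e e0; rewrite mulr1.
  by have [N] := fa e e0; rewrite f0 sub0r sqrrN.
split.
- split=> // x i; apply: pv => n; have [[pu _] _ _ _] := uG n; exact: pu.
- apply/Lp2_colP; split=> // x i; apply/colP => j; rewrite !mxE.
  have [_ _] := D0P j; apply => n; have [_ /Lp2_colP[pG _] _ _] := uG n.
  by rewrite pG.
- move=> phi j sphi.
  have pL := smooth_periodic_L2 [::] sphi.
  have dpL := smooth_periodic_L2 [:: j] sphi; rewrite /= in pL dpL.
  apply/eqP; rewrite -subr_eq0 opprK; apply/eqP.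
  apply: (limE (fun n => \int[mu]_x (u n x * partial j phi x) +
     \int[mu]_x (G n x j 0 * phi x))); last first.
    by move=> n; have [_ _ /(_ phi j sphi) -> _] := uG n; rewrite addNr.
  move=> e e0.
  (* The factor left by (X + Y)^2 <= 2 X^2 + 2 Y^2 and Cauchy-Schwarz, plus 1 to make it
     positive. *)
  pose c := 2 * n2 mu (partial j phi) + 2 * n2 mu phi + 1.
  have c0 : 0 < c by rewrite ltr_wpDl// addr_ge0// mulr_ge0// n2_ge0.
  have ec : 0 < e / c by rewrite divr_gt0.
  have [N1 NP1] := uv _ ec; have [_ /(_ _ ec)[N2 NP2] _] := D0P j.
  exists (maxn N1 N2); set n := maxn N1 N2.
  have b1 := NP1 n (leq_maxl _ _); have b2 := NP2 n (leq_maxr _ _).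
  have uvL := L2B (uL n) vL; have [D0L _ _] := D0P j.
  have GDL := L2B (GL n j) D0L.
  have -> : \int[mu]_x (u n x * partial j phi x) +
     \int[mu]_x (G n x j 0 * phi x) - (\int[mu]_x (v x * partial j phi x) +
     \int[mu]_x (D x j 0 * phi x)) = \int[mu]_x ((u n x - v x) * partial j phi x) +
     \int[mu]_x ((G n x j 0 - D0 j x) * phi x).
    have i1 := L2_mul (uL n) dpL; have i2 := L2_mul vL dpL.
    have i3 := L2_mul (GL n j) pL; have i4 := L2_mul (DL j) pL.
    rewrite opprD addrACA -!intB//.
    congr (_ + _); apply: eq_Rintegral => x _; rewrite ?mxE; ring.
  have := L2_cauchy_schwarz uvL dpL; have := L2_cauchy_schwarz GDL pL.
  move: (\int[mu]_x ((u n x - v x) * partial j phi x)) => X.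
  move: (\int[mu]_x ((G n x j 0 - D0 j x) * phi x)) => Y.
  move=> hY hX.
  have hX' := le_trans hX (ler_wpM2r (n2_ge0 mu (partial j phi)) b1).
  have hY' := le_trans hY (ler_wpM2r (n2_ge0 mu phi) b2).
  apply: (@le_trans _ _ (2 * (e / c * n2 mu (partial j phi)) + 2 * (e / c * n2 mu phi))).
    by have := sqr_ge0 (X - Y); lra.
  rewrite (_ : _ + _ = e / c * (c - 1)); last by rewrite /c; ring.
  by rewrite -[leRHS](divfK (lt0r_neq0 c0)) ler_wpM2l ?ltW// gtrBl.
- apply: (limE (fun n => \int[mu]_x u n x)) => [e e0|n]; last by case: (uG n).
  have [N NP] := uv e e0; exists N; apply: le_trans (NP N (leqnn N)).
  rewrite -intB; [|exact: L2_rint..].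
  by apply: int_sqr_le; exact: L2B.
Qed.

End vector_fields.

(** * Correctors and continuity of the homogenized coefficient *)

Section bounded_matrix_fields.
Variables (R : realType) (d : nat).
Local Notation mu := (torus R d).
Implicit Types (G D : 'rV[R]_d -> 'cV[R]_d) (B : 'rV[R]_d -> 'M[R]_d).

Definition entrywise_bounded (M : R) B :=
  (forall i j, measurable_fun setT (fun x => B x i j)) /\
  {ae mu, forall x, forall i j, `|B x i j| <= M}.

Lemma L2_entryM M B i j (g : 'rV[R]_d -> R) : entrywise_bounded M B ->
  g \in Lfun mu 2%:E -> (fun x => B x i j * g x) \in Lfun mu 2%:E.
Proof.
move=> [mB bB] gL; apply: (L2_boundedM (mB i j) _ gL).
by apply: filterS bB => x; exact.
Qed.

Lemma L2v_mulmx M B G : entrywise_bounded M B -> L2v G ->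
  L2v (fun x => B x *m G x).
Proof.
move=> bB GL i; under eq_fun do rewrite mxE.
by apply: L2_sum => j; exact: (L2_entryM i j bB (GL j)).
Qed.

(** Expansion of the double sum of the squares of [a i - a j]. *)
Lemma sqr_sum_le (a : 'I_d -> R) : (\sum_i a i) ^+ 2 <= d%:R * \sum_i a i ^+ 2.
Proof.
have : 0 <= \sum_i \sum_j (a i - a j) ^+ 2.
  by apply: sumr_ge0 => i _; apply: sumr_ge0 => j _; exact: sqr_ge0.
have -> : \sum_i \sum_j (a i - a j) ^+ 2 =
    2 * (d%:R * \sum_i a i ^+ 2) - 2 * (\sum_i a i) ^+ 2.
  have c : \sum_(i < d) \sum_(j < d) a i ^+ 2 = d%:R * \sum_i a i ^+ 2.
    rewrite mulr_sumr; apply: eq_bigr => i _.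
    by rewrite sumr_const card_ord -[LHS]mulr_natl.
  transitivity (\sum_i \sum_j (a i ^+ 2 + a j ^+ 2 - 2 * (a i * a j))).
    by apply: eq_bigr => i _; apply: eq_bigr => j _; ring.
  under eq_bigr do rewrite sumrB big_split/=.
  rewrite sumrB big_split/= c exchange_big/= c.
  rewrite (_ : \sum_(i < d) \sum_j 2 * _ = 2 * (\sum_i a i) ^+ 2); first by ring.
  rewrite expr2 mulr_suml mulr_sumr; apply: eq_bigr => i _.
  by rewrite mulr_sumr mulr_sumr.
by lra.
Qed.

(** Entries and components stay multiplied together, for [n2_mul_small] to apply to each product
    when the entries of [B] are small in L^2 only. *)
Lemma nv_mulmx_le M B G : entrywise_bounded M B -> L2v G ->
  nv (fun x => B x *m G x) <=
  d%:R * \sum_i \sum_j n2 mu (fun x => B x i j * G x j 0).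
Proof.
move=> bB GL; rewrite /nv mulr_sumr; apply: ler_sum => i _.
have iL j : rint mu (fun x => (B x i j * G x j 0) ^+ 2).
  by apply: L2_sqr; exact: (L2_entryM i j bB (GL j)).
rewrite /n2 -int_sum// -intZ; last exact: rint_sum.
apply: int_le.
- by apply: L2_sqr; exact: (L2v_mulmx bB GL).
- by apply: rintZ; exact: rint_sum.
- by move=> x; rewrite mxE; exact: sqr_sum_le.
Qed.

Lemma nv_mulmx_bound M B G : 0 <= M -> entrywise_bounded M B -> L2v G ->
  nv (fun x => B x *m G x) <= (d%:R * M) ^+ 2 * nv G.
Proof.
move=> M0 bB GL; apply: (le_trans (nv_mulmx_le bB GL)).
rewrite exprMn [d%:R ^+ 2]expr2 -!mulrA ler_wpM2l//.
apply: (@le_trans _ _ (\sum_(i < d) M ^+ 2 * nv G)); last first.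
  by rewrite sumr_const card_ord mulr_natl expr2 mulrA.
apply: ler_sum => i _; rewrite /nv mulr_sumr; apply: ler_sum => j _.
rewrite -n2Z//; apply: n2_le_ae; [exact: (L2_entryM i j bB (GL j))|exact: (L2Z M (GL j))|].
apply: filterS bB.2 => x /(_ i j) bx.
by rewrite !normrM ler_wpM2r// (le_trans bx)// ler_norm.
Qed.

(** Split [g ^+ 2] into its truncation at level N and the excess. The truncation contributes at most
    N times the squared norm of [a]; the excess contributes at most M^2 times its integral, small
    for large N by dominated convergence. The radius thus depends on [g] and on the bound [M], not
    on [a]. *)
Lemma n2_mul_small (g : 'rV[R]_d -> R) (M e : R) : g \in Lfun mu 2%:E -> 0 < e ->
  exists2 del, 0 < del & forall a : 'rV[R]_d -> R, measurable_fun setT a ->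
    {ae mu, forall x, `|a x| <= M} -> n2 mu a <= del ->
    n2 mu (fun x => a x * g x) <= e.
Proof.
move=> gL e0.
have g2 := L2_sqr gL; have mg := L2_meas gL.
pose h (n : nat) x := g x ^+ 2 - Num.min (g x ^+ 2) n%:R.
have mmin (n : nat) : measurable_fun setT (fun x => Num.min (g x ^+ 2) n%:R).
  by apply: measurable_minr => //; exact: measurable_funX.
have h0 n x : 0 <= h n x by rewrite subr_ge0 ge_min lexx.
have hg n x : h n x <= g x ^+ 2.
  by rewrite gerBl le_min sqr_ge0 ler0n.
have mh n : measurable_fun setT (h n).
  by apply: measurable_funB => //; exact: measurable_funX.
have hc : \int[mu]_x h n x @[n --> \oo] --> \int[mu]_x (0 : R).
  apply: (@int_dominated_cvg _ _ _ _ _ _ (fun x => g x ^+ 2)) => //.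
    apply: aeW => x; apply: cvg_near_cst; near=> n.
    rewrite /h min_l ?subrr//.
    apply: (@le_trans _ _ (Num.truncn (g x ^+ 2)).+1%:R); first exact/ltW/truncnS_gt.
    by rewrite ler_nat; near: n; exact: nbhs_infty_ge.
  by apply: aeW => x n; rewrite ger0_norm.
rewrite int_cst in hc.
have M1 : 0 < M ^+ 2 + 1 by rewrite ltr_wpDl// sqr_ge0.
have e1 : 0 < e / 2 / (M ^+ 2 + 1) by rewrite !divr_gt0.
have /cvgrPdist_le /(_ _ e1) [N _ HN] := hc.
have := HN N (leqnn N); rewrite sub0r normrN ger0_norm; last exact: Rintegral_ge0.
(* [N] may be 0, hence the [+ 1]. *)
move=> hN; exists (e / 2 / (N%:R + 1)); first by rewrite !divr_gt0// ltr_wpDl.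
move=> a ma aM a2.
have ih : rint mu (h N).
  by apply: (rint_le (mh N) g2) => x; rewrite ger0_norm.
have aL : a \in Lfun mu 2%:E by exact: L2_bounded aM.
have agL := L2_boundedM ma aM gL.
apply: (@le_trans _ _ (\int[mu]_x (N%:R * a x ^+ 2 + M ^+ 2 * h N x))).
  apply: int_le_ae; [exact: L2_sqr|by apply: rintD; apply: rintZ => //; exact: L2_sqr|].
  apply: filterS aM => x aM; rewrite exprMn.
  have a2M : a x ^+ 2 <= M ^+ 2.
    by rewrite -[a x ^+ 2]real_normK ?num_real// lerXn2r// nnegrE (le_trans _ aM).
  have := ler_wpM2r (h0 N x) a2M.
  have mN : Num.min (g x ^+ 2) N%:R <= N%:R by rewrite ge_min lexx orbT.
  have := ler_wpM2l (sqr_ge0 (a x)) mN.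
  by rewrite /h; move: (Num.min _ _) => m; lra.
have a2r := L2_sqr aL.
rewrite intD; [|exact: rintZ..]; rewrite !intZ//.
have h1 : N%:R * n2 mu a <= e / 2.
  apply: (@le_trans _ _ ((N%:R + 1) * n2 mu a)).
    by rewrite ler_wpM2r ?n2_ge0// lerDl.
  by rewrite mulrC -ler_pdivlMr// ltr_wpDl.
have h2 : M ^+ 2 * (\int[mu]_x h N x) <= e / 2.
  apply: (@le_trans _ _ ((M ^+ 2 + 1) * \int[mu]_x h N x)).
    by rewrite ler_wpM2r ?lerDl// Rintegral_ge0.
  by rewrite mulrC -ler_pdivlMr.
rewrite -/(n2 mu a); lra.
Unshelve. all: by end_near. Qed.

End bounded_matrix_fields.

Section correctors.
Variables (R : realType) (d : nat) (alpha beta : R).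
Hypotheses (alpha0 : 0 < alpha) (alpha_beta : alpha <= beta).
Local Notation mu := (torus R d).
Local Notation PD := (PD alpha beta).
Implicit Types (A B : 'rV[R]_d -> 'M[R]_d) (G D : 'rV[R]_d -> 'cV[R]_d).

Let beta0 : 0 <= beta. Proof. by rewrite (le_trans _ alpha_beta)// ltW. Qed.

Lemma PD_bounded A : PD A -> entrywise_bounded beta A.
Proof.
move=> [[_ mA _] symA boundA]; split.
  by move/measurable_fun_mxP : mA.
apply: filterS2 symA boundA => x sA bA i j.
exact: (entry_le_of_form i j (ltW alpha0) sA bA).
Qed.

Lemma PD_L2v A G : PD A -> L2v G -> L2v (fun x => A x *m G x).
Proof. by move=> /PD_bounded; exact: L2v_mulmx. Qed.

Definition form A G D : R := \int[mu]_x dotv (A x *m G x) (D x).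

Lemma form_linl A G D E t : PD A -> L2v G -> L2v D -> L2v E ->
  form A (G + t *: D) E = form A G E + t * form A D E.
Proof.
move=> pA GL DL EL; rewrite /form -int_dotvDl//; try exact: PD_L2v.
apply: eq_Rintegral => x _; congr (dotv _ _).
by rewrite [LHS]mulmxDr -scalemxAr.
Qed.

Lemma formC A G D : PD A -> L2v G -> L2v D -> form A G D = form A D G.
Proof.
move=> pA GL DL; have [_ symA _] := pA.
apply: int_eq_ae.
- exact: (rintW (rint_dotv (PD_L2v pA GL) DL)).
- exact: (rintW (rint_dotv (PD_L2v pA DL) GL)).
- by apply: filterS symA => x sA; rewrite dotv_mulmx sA dotvC.
Qed.

Lemma form_coercive A G : PD A -> L2v G ->
  alpha * nv G <= form A G G <= beta * nv G.
Proof.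
move=> pA GL; have [_ _ bA] := pA.
have i1 := rint_dotv GL GL; have i2 := rint_dotv (PD_L2v pA GL) GL.
rewrite nvE// -!intZ//; apply/andP; split.
  apply: int_le_ae => //; first exact: rintZ.
  by apply: filterS bA => x /(_ (G x)) /andP[+ _]; rewrite dotvC.
apply: int_le_ae => //; first exact: rintZ.
by apply: filterS bA => x /(_ (G x)) /andP[_]; rewrite dotvC.
Qed.

Definition basis_field (l : 'I_d) : 'rV[R]_d -> 'cV[R]_d := fun=> delta_mx l 0.

Lemma basis_field_L2v l : L2v (basis_field l).
Proof. by move=> j; exact: L2_cst. Qed.

(** Energy minimization over pairs of a function and its gradient, the gradient being carried as
    data. The form sees the gradient alone, and the squared norm of A e_l divided by [alpha] bounds
    the linear functional, by Cauchy-Schwarz and coercivity. *)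
Lemma scalar_corrector_exists A l : PD A ->
  exists v G, H1dot v G /\ forall w D, H1dot w D ->
    form A G D = - form A (basis_field l) D.
Proof.
move=> pA; have eL := basis_field_L2v l; have AeL := PD_L2v pA eL.
pose H := [set p : ('rV[R]_d -> R) * ('rV[R]_d -> 'cV[R]_d) | H1dot p.1 p.2].
pose a (p q : ('rV[R]_d -> R) * ('rV[R]_d -> 'cV[R]_d)) := form A p.2 q.2.
pose b (p : ('rV[R]_d -> R) * ('rV[R]_d -> 'cV[R]_d)) := - form A (basis_field l) p.2.
have HL p : H p -> L2v p.2 by exact: H1dot_L2v.
have [|||||||||[v G] /= Hw wP] := @riesz_minimization R _ H a b
  (nv (fun x => A x *m basis_field l x) / alpha).
- exact: H1dot0.
- by move=> p q t Hp Hq; exact: H1dot_lin.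
- by move=> p q Hp Hq; apply: formC => //; exact: HL.
- by move=> p q r t Hp Hq Hr; apply: form_linl => //; exact: HL.
- move=> p /HL pL; have /andP[+ _] := form_coercive pA pL.
  by apply: le_trans; rewrite mulr_ge0 ?nv_ge0// ltW.
- move=> p q t /HL pL /HL qL; rewrite /b formC// ?form_linl//; last exact: L2vD.
  by rewrite [form A p.2 _]formC// [form A q.2 _]formC//; ring.
- by rewrite divr_ge0 ?nv_ge0// ltW.
- move=> p /HL pL; rewrite /b sqrrN; apply: le_trans (nv_cauchy_schwarz AeL pL) _.
  rewrite -mulrA ler_wpM2l ?nv_ge0// mulrC ler_pdivlMr// mulrC.
  by have /andP[] := form_coercive pA pL.
- move=> u Hu uC.
  have uL n := HL _ (Hu n).
  have [|v [G [vG uG]]] := @H1dot_complete R d (fun n => (u n).1) (fun n => (u n).2) Hu.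
    move=> e e0; have [N NP] := uC (alpha * e) (mulr_gt0 alpha0 e0).
    exists N => m n Nm Nn; rewrite -(ler_pM2l alpha0); apply: le_trans (NP m n Nm Nn).
    by have /andP[] := form_coercive pA (L2vB (uL m) (uL n)).
  exists (v, G) => // e e0.
  have e1 : 0 < e / (beta + 1) by rewrite divr_gt0// ltr_wpDl.
  have [N NP] := uG _ e1; exists N => n Nn.
  have GL := H1dot_L2v vG; have dL := L2vB (uL n) GL.
  have /andP[_ /le_trans] := form_coercive pA dL; apply.
  apply: (@le_trans _ _ ((beta + 1) * nv ((u n).2 - G))).
    by rewrite ler_wpM2r ?nv_ge0// lerDl.
  by rewrite mulrC -ler_pdivlMr ?ltr_wpDl// NP.
- by exists v, G; split=> // w D wD; exact: (wP (w, D)).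
Qed.

Lemma corrector_exists A : PD A -> exists chi Dchi, is_corrector A chi Dchi.
Proof.
move=> pA.
have /choice[v vP] l : exists v, exists G, H1dot v G /\ forall w D, H1dot w D ->
  form A G D = - form A (basis_field l) D := scalar_corrector_exists l pA.
have /choice[G GP] l := vP l.
exists (fun y => \col_l v l y), (fun y => \matrix_(l, j) G l y j 0) => l.
have -> : (fun y => (\col_l v l y : 'cV_d) l 0) = v l by apply/funext => y; rewrite mxE.
have GE : (fun y => (row l (\matrix_(l, j) G l y j 0))^T) = G l.
  by apply/funext => y; apply/colP => j; rewrite !mxE.
rewrite GE; have [vG K] := GP l; split=> // w D wD.
rewrite -(K w D wD); apply: eq_Rintegral => x _.
by rewrite -[in RHS]GE.
Qed.

(** What the comparison uses of the correctors: their gradients [G l] alone, detached from the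
    choice made by [corrector]. Column j of A times the transposed Jacobian is A applied to the
    gradient of component j, so column j of [H] is the mean of A (e_j + G_j). *)
Definition corrector_spec A (G : 'I_d -> 'rV[R]_d -> 'cV[R]_d) (H : 'M[R]_d) :=
  [/\ forall l, exists v, H1dot v (G l),
      forall l w D, H1dot w D -> form A (G l) D = - form A (basis_field l) D &
      forall i j, H i j = \int[mu]_y (A y *m (basis_field j + G j) y) i 0].

Lemma homogenizedP A : PD A -> exists Gs, corrector_spec A Gs (homogenized A).
Proof.
move=> pA; have [chi [Dchi cA]] := corrector_exists pA.
have cP : is_corrector A (corrector A).1 (corrector A).2.
  by apply: (@getPex _ [set c | is_corrector A c.1 c.2]); exists (chi, Dchi).
exists (fun l y => (row l ((corrector A).2 y))^T); split.
- by move=> l; have [vG _] := cP l; eexists; exact: vG.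
- by move=> l; have [_ K] := cP l; exact: K.
move=> i j; rewrite mxE; apply: eq_Rintegral => y _.
rewrite [in RHS]mulmxDr [RHS]mxE [LHS]mxE; congr (_ + _).
  by rewrite mulmx_delta_col.
by rewrite !mxE; apply: eq_bigr => k _; rewrite !mxE.
Qed.

Section two_coefficients.
Variables (A B : 'rV[R]_d -> 'M[R]_d) (GA GB : 'I_d -> 'rV[R]_d -> 'cV[R]_d).
Variables (HA HB : 'M[R]_d).
Hypotheses (pA : PD A) (pB : PD B).
Hypotheses (cA : corrector_spec A GA HA) (cB : corrector_spec B GB HB).
Variable j : 'I_d.

Let D := GA j - GB j.
Let g := basis_field j + GB j.
Let E y := (A y - B y) *m g y.

Let GAL : L2v (GA j).
Proof. by have [/(_ j)[v vG] _ _] := cA; exact: H1dot_L2v vG. Qed.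

Let GBL : L2v (GB j).
Proof. by have [/(_ j)[v vG] _ _] := cB; exact: H1dot_L2v vG. Qed.

Let DL : L2v D. Proof. exact: L2vB. Qed.

Let eL := basis_field_L2v j.

Let gL : L2v g.
Proof. by rewrite /g -[GB j]scale1r; exact: L2vD. Qed.

Let EE : E = (fun y => A y *m g y) + (-1) *: (fun y => B y *m g y).
Proof. by apply/funext => y; rewrite /E mulmxBl -scaleN1r. Qed.

Let EL : L2v E.
Proof. by rewrite EE; apply: L2vD; exact: PD_L2v. Qed.

(** By the two cell problems, [form A D D] is minus the integral of the dot product of [E] and [D],
    where [E] contains the corrector of [B] only; coercivity and Cauchy-Schwarz do the rest. *)
Lemma corrector_dist : alpha ^+ 2 * nv D <= nv E.
Proof.
have [/(_ j)[vA HvA] KA _] := cA; have [/(_ j)[vB HvB] KB _] := cB.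
have HD := H1dotB HvA HvB.
have formE : form A D D = - \int[mu]_x dotv (E x) (D x).
  rewrite EE int_dotvDl//; try exact: PD_L2v.
  rewrite -/(form A g D) -/(form B g D).
  have e1 : form A D D = form A (GA j) D - form A (GB j) D.
    by rewrite {1}/D -scaleN1r form_linl// mulN1r.
  have form_g M : PD M -> form M g D = form M (basis_field j) D + form M (GB j) D.
    by move=> pM; rewrite /g -{1}[GB j]scale1r form_linl// mul1r.
  have := form_g A pA; have := form_g B pB; have := KA j _ _ HD; have := KB j _ _ HD.
  rewrite e1; move=> -> -> -> ->; ring.
have /andP[c1 _] := form_coercive pA DL; rewrite formE in c1.
have cs := nv_cauchy_schwarz EL DL.
have [D0|D0] := leP (nv D) 0.
  by rewrite (le_trans _ (nv_ge0 E))// mulr_ge0_le0// sqr_ge0.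
rewrite -(ler_pM2r D0); apply: le_trans cs.
rewrite -mulrA -expr2 -exprMn -[leRHS]sqrrN ler_sqr ?nnegrE//.
  by rewrite mulr_ge0 ?nv_ge0// ltW.
by rewrite (le_trans _ c1)// mulr_ge0 ?nv_ge0// ltW.
Qed.

(** The difference of the integrands splits as [A y *m D y + E y]: the first part is controlled by
    [corrector_dist] and the bound on the entries of [A], the second is the data error itself. *)
Lemma homogenized_dist i :
  (HA i j - HB i j) ^+ 2 <= (2 * (d%:R * beta) ^+ 2 / alpha ^+ 2 + 2) * nv E.
Proof.
have gAL : L2v (basis_field j + GA j).
  by rewrite -[GA j]scale1r; exact: L2vD.
have ADL := PD_L2v pA DL.
have iA := L2_rint (PD_L2v pA gAL i); have iB := L2_rint (PD_L2v pB gL i).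
have -> : HA i j - HB i j = \int[mu]_y ((A y *m D y) i 0 + E y i 0).
  have [_ _ ->] := cA; have [_ _ ->] := cB.
  rewrite -(intB iA iB); apply: eq_Rintegral => y _; rewrite EE.
  have -> : (basis_field j + GA j) y = D y + g y.
    transitivity (GA j y - GB j y + (basis_field j y + GB j y)) => //.
    by rewrite addrCA addrNK.
  by rewrite mulmxDr !mxE mulN1r addrA.
apply: (le_trans (int_sqr_le (L2D (ADL i) (EL i)))).
apply: (le_trans (n2D_le (ADL i) (EL i))).
have b1 := n2_le_nv (fun y => A y *m D y) i; have b2 := n2_le_nv E i.
have b3 := nv_mulmx_bound beta0 (PD_bounded pA) DL.
have a2 : 0 < alpha ^+ 2 by rewrite exprn_gt0.
have b4 : nv D <= nv E / alpha ^+ 2.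
  by rewrite ler_pdivlMr// mulrC corrector_dist.
have b5 := le_trans b1 (le_trans b3 (ler_wpM2l (sqr_ge0 (d%:R * beta)) b4)).
move: (nv E) b1 b2 b5 => p b1 b2 b5.
have -> : (2 * (d%:R * beta) ^+ 2 / alpha ^+ 2 + 2) * p =
    2 * ((d%:R * beta) ^+ 2 * (p / alpha ^+ 2)) + 2 * p.
  by field; rewrite lt0r_neq0.
move: ((d%:R * beta) ^+ 2 * (p / alpha ^+ 2)) b5 => q b5; lra.
Qed.

End two_coefficients.

(** The radius depends on [B] through its corrector gradients, to whose components [n2_mul_small] is
    applied; of [A] only the ellipticity bounds enter. *)
Lemma homogenized_continuous B e : PD B -> 0 < e ->
  exists2 del, 0 < del & forall A, PD A ->
    (forall i k, n2 mu (fun y => A y i k - B y i k) <= del) ->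
    forall i j, `|homogenized A i j - homogenized B i j| <= e.
Proof.
move=> pB e0.
pose C := (2 * (d%:R * beta) ^+ 2 / alpha ^+ 2 + 2).
have C0 : 0 < C.
  by rewrite /C ltr_wpDl// divr_ge0 ?sqr_ge0// mulr_ge0// sqr_ge0.
(* Chosen so that C (d^3 + 1) r = e^2: the power d^3 collects the factor d of [nv_mulmx_le] and the
   d^2 products of entries. *)
pose r := e ^+ 2 / (C * (d%:R ^+ 3 + 1)).
have d3 : 0 < d%:R ^+ 3 + 1 :> R by rewrite ltr_wpDl// exprn_ge0.
have r0 : 0 < r by rewrite /r divr_gt0 ?exprn_gt0// mulr_gt0.
have [GB cB] := homogenizedP pB.
pose g j := basis_field j + GB j.
have gL j : L2v (g j).
  have [/(_ j)[v vG] _ _] := cB.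
  rewrite /g -[GB j]scale1r; apply: L2vD; first exact: basis_field_L2v.
  exact: H1dot_L2v vG.
have /choice[del delP] (p : 'I_d * 'I_d) : exists del, 0 < del /\
    forall a : 'rV[R]_d -> R, measurable_fun setT a ->
    {ae mu, forall x, `|a x| <= 2 * beta} -> n2 mu a <= del ->
    n2 mu (fun x => a x * g p.2 x p.1 0) <= r.
  by have [t t0 tP] := n2_mul_small (2 * beta) (gL p.2 p.1) r0; exists t.
exists (\big[Num.min/1]_p del p).
  by elim/big_ind: _ => // [x y x0 y0|p _]; [rewrite lt_min x0|have [] := delP p].
move=> A pA AB i j.
have bAB : entrywise_bounded (2 * beta) (fun y => A y - B y).
  have [mA bA] := PD_bounded pA; have [mB bB] := PD_bounded pB; split.
    move=> k l; rewrite (_ : (fun x => _) = (fun x => A x k l - B x k l)).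
      exact: measurable_funB.
    by apply/funext => x; rewrite !mxE.
  apply: filterS2 bA bB => x bA bB k l; rewrite !mxE.
  by rewrite (le_trans (ler_normB _ _))// mulr2n mulrDl mul1r lerD.
rewrite -ler_sqr ?nnegrE//; last exact: ltW.
have [GA cA] := homogenizedP pA.
rewrite real_normK ?num_real//; apply: (le_trans (homogenized_dist pA pB cA cB j i)).
rewrite -/C -/(g j).
have Er : nv (fun y => (A y - B y) *m g j y) <= (d%:R ^+ 3 + 1) * r.
  apply: (le_trans (nv_mulmx_le bAB (gL j))).
  apply: (@le_trans _ _ (d%:R * \sum_(k < d) \sum_(l < d) r)).
    rewrite ler_wpM2l//; apply: ler_sum => k _; apply: ler_sum => l _.
    have [_ H] := delP (l, j); apply: H.
    - exact: bAB.1.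
    - by apply: filterS bAB.2 => x; exact.
    - apply: le_trans (bigmin_le_cond _ _ _); last 1 first.
        exact: (erefl : xpredT (l, j)).
      apply: le_trans (AB k l); rewrite le_eqVlt; apply/orP; left; apply/eqP.
      by apply: eq_Rintegral => y _; rewrite !mxE.
  have -> : d%:R * \sum_(k < d) \sum_(l < d) r = d%:R ^+ 3 * r.
    rewrite !sumr_const card_ord -[r *+ d]mulr_natl -[(_ * r) *+ d]mulr_natl; ring.
  by rewrite ler_wpM2r ?lerDl// ltW.
apply: (le_trans (ler_wpM2l (ltW C0) Er)).
by rewrite mulrA /r mulrC divfK// lt0r_neq0// mulr_gt0.
Qed.

End correctors.

(** * Approximation by multilayer perceptrons *)

Section activation_function.
Variables (R : realType) (sigma : R -> R).

Lemma lipschitz_bound : lipschitz sigma ->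
  exists2 k, 0 < k & forall x y, `|sigma x - sigma y| <= k * `|x - y|.
Proof.
move=> [M [_ MP]]; exists (`|M| + 1); first by rewrite ltr_wpDl.
move=> x y; have Mlt : M < `|M| + 1 by rewrite ltr_pwDr// ler_norm.
exact: (MP _ Mlt (x, y)).
Qed.

(** A second derivative vanishing everywhere would make [sigma] affine. *)
Lemma exists_derive2_neq0 : smooth sigma -> ~ polynomial_fun sigma ->
  exists s, derive1 (derive1 sigma) s != 0.
Proof.
move=> sm np; apply: contrapT => H; apply: np.
have d2 s : derive1 (derive1 sigma) s = 0.
  by apply/eqP; apply: contrapT => /negP h; apply: H; exists s.
have der1 (x : R) : is_derive x 1 (derive1 sigma) 0.
  rewrite -(d2 x) derive1E; apply: DeriveDef => //; exact: (sm 1%N x).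
pose a := derive1 sigma 0.
have d1 x : derive1 sigma x = a := is_derive_0_is_cst x 0 der1.
have der0 (x : R) : is_derive x 1 (fun t => sigma t - a * t) 0.
  have d0 : is_derive x 1 sigma a.
    by rewrite -(d1 x) derive1E; apply: DeriveDef => //; exact: (sm 0%N x).
  by apply: is_derive_eq; rewrite /GRing.scale/= mulr1 subrr.
exists ((sigma 0)%:P + a *: 'X); apply/funext => x.
rewrite !hornerE; have := is_derive_0_is_cst x 0 der0.
by rewrite mulr0 subr0 => <-; rewrite subrK.
Qed.

(** The error [k] is even and vanishes at 0, and differentiability of the first derivative of
    [sigma] at [s] makes the derivative of [k] o(u); the mean value theorem then gives o(u^2). *)
Lemma second_difference (s : R) : smooth sigma ->
  forall M e, 0 < e -> exists2 h, 0 < h & forall t, `|t| <= M ->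
  `|(sigma (s + h * t) + sigma (s - h * t) - 2 * sigma s) / h ^+ 2 -
    derive1 (derive1 sigma) s * t ^+ 2| <= e.
Proof.
move=> sm M e e0; set c := derive1 (derive1 sigma) s.
have ds (x : R) : is_derive x 1 sigma (derive1 sigma x).
  by rewrite derive1E; apply: DeriveDef => //; exact: (sm 0%N x).
have dds : is_derive s 1 (derive1 sigma) c.
  by rewrite /c derive1E; apply: DeriveDef => //; exact: (sm 1%N s).
pose k (u : R) := sigma (s + u) + sigma (s - u) - 2 * sigma s - c * u ^+ 2.
pose k' (u : R) := derive1 sigma (s + u) - derive1 sigma (s - u) - 2 * c * u.
have dk (u : R) : is_derive u 1 k (k' u).
  have d1 : is_derive u 1 (fun u => sigma (s + u)) (derive1 sigma (s + u)).
    have da : is_derive u 1 (fun u => s + u) 1.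
      by apply: is_derive_eq; rewrite add0r mulr1.
    by have := @is_derive1_comp _ sigma (fun u => s + u) u _ 1 (ds (s + u)) da; rewrite mulr1.
  have d2 : is_derive u 1 (fun u => sigma (s - u)) (- derive1 sigma (s - u)).
    have da : is_derive u 1 (fun u => s - u) (-1).
      by apply: is_derive_eq; rewrite /GRing.scale/=; ring.
    by have := @is_derive1_comp _ sigma (fun u => s - u) u _ (-1) (ds (s - u)) da; rewrite mulrN1.
  apply: is_derive_eq; rewrite /k' /GRing.scale/=; ring.
have M1 : 0 < `|M| + 1 by rewrite ltr_wpDl.
(* Chosen so that 2 eta (|M| + 1)^2 = e, which bounds the error at u = h t after division by h^2. *)
pose eta := e / (2 * (`|M| + 1) ^+ 2).
have eta0 : 0 < eta by rewrite divr_gt0// mulr_gt0// exprn_gt0.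
have [del del0 k'P] : exists2 del, 0 < del & forall u, 0 < u < del ->
    `|k' u| <= 2 * eta * u.
  have [dd dv] := dds.
  have := dd; rewrite /derivable => /cvg_ex[l lP].
  have lc : l = c by rewrite -dv; apply/esym/(cvg_lim _ lP).
  rewrite lc in lP.
  have /cvgrPdist_le /(_ _ eta0) := lP.
  move=> /nbhs_ballP[del /= del0 dP]; exists del => // u /andP[u0 ud].
  have q v : `|v| = u -> `|derive1 sigma (s + v) - derive1 sigma s - c * v| <= eta * u.
    move=> vu; have v0 : v != 0 by rewrite -normr_gt0 vu.
    have := dP v; rewrite /ball/= sub0r normrN vu => /(_ ud v0).
    rewrite /GRing.scale/= mulr1 [v + s]addrC distrC => H.
    rewrite (_ : _ - c * v = (v^-1 * (derive1 sigma (s + v) - derive1 sigma s) - c) * v).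
      by rewrite normrM vu ler_wpM2r// ltW.
    by field.
  have q1 := q u (gtr0_norm u0).
  have q2 := q (- u); rewrite normrN gtr0_norm// in q2; have {}q2 := q2 erefl.
  rewrite (_ : k' u = (derive1 sigma (s + u) - derive1 sigma s - c * u) -
    (derive1 sigma (s - u) - derive1 sigma s - c * - u)); last by rewrite /k'; ring.
  apply: (le_trans (ler_normB _ _)).
  by rewrite -mulrA mulr2n mulrDl mul1r lerD.
have k0 : k 0 = 0 by rewrite /k addr0 subr0 expr0n/= mulr0; ring.
have kpos u : 0 < u < del -> `|k u| <= 2 * eta * u ^+ 2.
  move=> /andP[u0 ud].
  have ck : {within `[0, u], continuous k}.
    apply: continuous_subspaceT => x; apply: differentiable_continuous.
    by apply/derivable1_diffP; apply: ex_derive.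
  have [x] := MVT u0 (fun x _ => dk x) ck.
  rewrite in_itv/= => /andP[x0 xu]; rewrite k0 !subr0 => ->.
  rewrite normrM (gtr0_norm u0) expr2 mulrA ler_pM2r//.
  apply: (le_trans (k'P x _)); first by rewrite x0 (lt_trans xu).
  by rewrite ler_pM2l ?mulr_gt0// ltW.
have keven u : k (- u) = k u by rewrite /k opprK sqrrN; ring.
have kall u : `|u| < del -> `|k u| <= 2 * eta * u ^+ 2.
  move=> ud; have [u0|u0|->] := ltgtP u 0.
  - rewrite -keven -sqrrN; apply: kpos; rewrite oppr_gt0 u0/=.
    by rewrite -(ltr0_norm u0).
  - by apply: kpos; rewrite u0 -(gtr0_norm u0).
  - by rewrite k0 normr0 expr0n/= mulr0.
(* This gives [|h * t| <= del / 2]; the factor 2 makes the inequality with [del] strict. *)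
pose h := del / (2 * (`|M| + 1)).
have h0 : 0 < h by rewrite divr_gt0// mulr_gt0.
exists h => // t tM.
have tM' : `|t| <= `|M| by rewrite (le_trans tM)// ler_norm.
have ht : `|h * t| < del.
  rewrite normrM (gtr0_norm h0).
  apply: (@le_lt_trans _ _ (h * (`|M| + 1))).
    by rewrite ler_pM2l// (le_trans tM')// lerDl.
  rewrite (_ : h * _ = del / 2); last by rewrite /h; field; rewrite lt0r_neq0.
  by rewrite ltr_pdivrMr// mulr2n mulrDr mulr1 ltrDl.
have := kall _ ht.
rewrite (_ : (_ / h ^+ 2 - _) = k (h * t) / h ^+ 2); last first.
  by rewrite /k; field; rewrite lt0r_neq0.
rewrite normrM normfV (ger0_norm (sqr_ge0 h)) ler_pdivrMr ?exprn_gt0// => kh.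
apply: (le_trans kh); rewrite exprMn mulrCA mulrC ler_wpM2r ?sqr_ge0//.
have t2 : t ^+ 2 <= (`|M| + 1) ^+ 2.
  rewrite -[t ^+ 2]real_normK ?num_real//; apply: lerXn2r.
  - by rewrite nnegrE.
  - by rewrite nnegrE ltW.
  - by rewrite (le_trans tM')// lerDl.
apply: (@le_trans _ _ (2 * eta * (`|M| + 1) ^+ 2)).
  by rewrite ler_wpM2l// mulr_ge0// ltW.
by rewrite /eta le_eqVlt; apply/orP; left; apply/eqP; field; rewrite lt0r_neq0.
Qed.

End activation_function.

(** * Operations on multilayer perceptrons *)

Section mlp_operations.
Variables (R : realType) (sigma : R -> R).

(** The number of activations: an affine map alone has depth 0. *)
Fixpoint mlp_depth m n (N : mlp R m n) : nat :=
  match N with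
  | MlpLast _ _ _ _ => 0
  | MlpLayer _ _ _ _ _ rest => (mlp_depth rest).+1
  end.

Lemma mlp_pre m n (N : mlp R m n) p (W : 'M[R]_(m, p)) :
  exists2 N' : mlp R p n, mlp_depth N' = mlp_depth N &
    forall x, mlp_eval sigma N' x = mlp_eval sigma N (W *m x).
Proof.
case: N W => {m n} [m n V b|m q n V b N] W.
  by exists (MlpLast (V *m W) b) => // x /=; rewrite mulmxA.
by exists (MlpLayer (V *m W) b N) => // x /=; rewrite mulmxA.
Qed.

Lemma mlp_post m n (N : mlp R m n) p (W : 'M[R]_(p, n)) (c : 'cV[R]_p) :
  exists2 N' : mlp R m p, mlp_depth N' = mlp_depth N &
    forall x, mlp_eval sigma N' x = W *m mlp_eval sigma N x + c.
Proof.
elim: N p W c => {m n} [m n V b|m q n V b N ih] p W c.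
  by exists (MlpLast (W *m V) (W *m b + c)) => // x /=;
    rewrite mulmxDr mulmxA addrA.
by have [N' dN' eN'] := ih p W c; exists (MlpLayer V b N') => [|x] /=; rewrite ?dN'.
Qed.

Lemma mlp_snoc m n (N : mlp R m n) :
  exists2 N' : mlp R m n, mlp_depth N' = (mlp_depth N).+1 &
    forall x, mlp_eval sigma N' x = map_mx sigma (mlp_eval sigma N x).
Proof.
elim: N => {m n} [m n V b|m q n V b N [N' dN' eN']].
  by exists (MlpLayer V b (MlpLast 1%:M 0)) => // x /=; rewrite mul1mx addr0.
by exists (MlpLayer V b N') => [|x] /=; rewrite ?dN'.
Qed.

(** Block-diagonal weights. The depths must agree because an activation applies to all coordinates
    at once. *)
Lemma mlp_par m1 n1 (N1 : mlp R m1 n1) m2 n2 (N2 : mlp R m2 n2) :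
  mlp_depth N1 = mlp_depth N2 ->
  exists2 N : mlp R (m1 + m2) (n1 + n2), mlp_depth N = mlp_depth N1 &
    forall x1 x2, mlp_eval sigma N (col_mx x1 x2) =
      col_mx (mlp_eval sigma N1 x1) (mlp_eval sigma N2 x2).
Proof.
elim: N1 m2 n2 N2 => {m1 n1} [m1 n1 V1 b1|m1 q1 n1 V1 b1 N1 ih] m2 n2 [] //=.
  move=> {m2 n2} m2 n2 V2 b2 _.
  exists (MlpLast (block_mx V1 0 0 V2) (col_mx b1 b2)) => // x1 x2 /=.
  by rewrite mul_block_col !mul0mx addr0 add0r add_col_mx.
move=> {m2 n2} m2 q2 n2 V2 b2 N2 [] /ih[N dN eN].
exists (MlpLayer (block_mx V1 0 0 V2) (col_mx b1 b2) N) => [|x1 x2] /=; first by rewrite dN.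
by rewrite mul_block_col !mul0mx addr0 add0r add_col_mx map_col_mx eN.
Qed.

Lemma mlp_const m L (c : R) : exists2 N : mlp R m 1, mlp_depth N = L &
  forall x, mlp_eval sigma N x = c%:M.
Proof.
have [N dN] : exists N : mlp R m 1, mlp_depth N = L.
  elim: L => [|L [N dN]]; first by exists (MlpLast 0 0).
  by have [N' dN' _] := mlp_snoc N; exists N'; rewrite dN' dN.
have [N' dN' eN'] := mlp_post N 0 c%:M.
by exists N' => [|x]; rewrite ?dN'// eN' mul0mx add0r.
Qed.

End mlp_operations.

(** * Approximation by perceptrons acting on an abstract family of features *)

Section network_approximation.
Variables (R : realType) (sigma : R -> R) (X : Type) (K : set X).
Variable base : forall m : nat, (X -> 'cV[R]_m) -> Prop.
Hypothesis base0 : exists psi : X -> 'cV[R]_0, base psi.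
Hypothesis base_col : forall m1 m2 (psi1 : X -> 'cV[R]_m1) (psi2 : X -> 'cV[R]_m2),
  base psi1 -> base psi2 -> base (fun x => col_mx (psi1 x) (psi2 x)).
Hypotheses (sm : smooth sigma) (np : ~ polynomial_fun sigma) (lip : lipschitz sigma).
Implicit Types (f g : X -> R) (L : nat).

(** The depth is prescribed exactly, since [mlp_par] combines only networks of equal depth. The
    family [base], closed under stacking, stands for the features that the Fourier layers can
    supply. *)
Definition net_approx L f (e : R) := exists m (psi : X -> 'cV[R]_m) (N : mlp R m 1),
  [/\ base psi, mlp_depth N = L &
      forall x, K x -> `|mlp_eval sigma N (psi x) 0 0 - f x| <= e].

Lemma net_approx_const L c e : 0 <= e -> net_approx L (fun=> c) e.
Proof.
move=> e0; have [psi bpsi] := base0; have [N dN eN] := mlp_const sigma 0 L c.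
by exists 0%N, psi, N; split=> // x _; rewrite eN mxE eqxx mulr1n subrr normr0.
Qed.

Lemma net_approx_add L f g t e1 e2 : net_approx L f e1 -> net_approx L g e2 ->
  net_approx L (fun x => f x + t * g x) (e1 + `|t| * e2).
Proof.
move=> [m1 [psi1 [N1 [b1 d1 a1]]]] [m2 [psi2 [N2 [b2 d2 a2]]]].
have [|N dN eN] := @mlp_par R sigma m1 1 N1 m2 1 N2; first by rewrite d1 d2.
have [N' dN' eN'] := mlp_post sigma N (row_mx (1%:M : 'M[R]_1) (t%:M : 'M[R]_1)) 0.
exists (m1 + m2)%N, (fun x => col_mx (psi1 x) (psi2 x)), N'; split.
- exact: base_col.
- by rewrite dN' dN.
move=> x Kx; rewrite eN' eN addr0 mul_row_col mul1mx mul_scalar_mx !mxE.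
have := a1 x Kx; have := a2 x Kx.
move: (mlp_eval _ N1 _ _ _) (mlp_eval _ N2 _ _ _) => u1 u2 h2 h1.
rewrite (_ : _ - _ = (u1 - f x) + t * (u2 - g x)); last by ring.
by rewrite (le_trans (ler_normD _ _))// lerD// normrM ler_wpM2l.
Qed.

Lemma net_approx_affine L f a b e : net_approx L f e ->
  net_approx L (fun x => a * f x + b) (`|a| * e).
Proof.
move=> fe; have := @net_approx_add L (fun=> b) f a 0 e (net_approx_const L b (lexx 0)) fe.
by rewrite add0r; under eq_fun do rewrite addrC.
Qed.

Lemma net_approx_close L f g e1 e2 : net_approx L g e1 ->
  (forall x, K x -> `|f x - g x| <= e2) -> net_approx L f (e1 + e2).
Proof.
move=> [m [psi [N [b dN a]]]] fg; exists m, psi, N; split=> // x Kx.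
rewrite -(subrKA (g x)) (le_trans (ler_normD _ _))// lerD ?a//.
by rewrite distrC fg.
Qed.

Lemma net_approx_le L f e1 e2 : e1 <= e2 -> net_approx L f e1 -> net_approx L f e2.
Proof.
move=> e12 [m [psi [N [b dN a]]]]; exists m, psi, N; split=> // x Kx.
exact: le_trans (a x Kx) e12.
Qed.

(** The Lipschitz constant propagates the error through one more activation; it is fixed before the
    depth and the function. *)
Lemma net_approx_sigma : exists2 k, 0 < k & forall L f a b e, net_approx L f e ->
  net_approx L.+1 (fun x => sigma (a * f x + b)) (k * (`|a| * e)).
Proof.
have [k k0 kP] := lipschitz_bound lip; exists k => // L f a b e.
move=> /(net_approx_affine a b)[m [psi [N [bpsi dN aN]]]].
have [N' dN' eN'] := mlp_snoc sigma N.
exists m, psi, N'; split=> //; first by rewrite dN' dN.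
move=> x Kx; rewrite eN' mxE; apply: (le_trans (kP _ _)).
by rewrite ler_pM2l// aN.
Qed.

(** A second difference of [sigma], divided by [c * h ^+ 2], is close to a square. The tolerance
    [e'] depends on the bound [M] and on [e], but neither on the depth nor on the function, so it
    can be used in inductions. *)
Lemma net_approx_sqr M e : 0 < e -> exists2 e', 0 < e' &
  forall L f, (forall x, K x -> `|f x| <= M) -> net_approx L f e' ->
    net_approx L.+1 (fun x => f x ^+ 2) e.
Proof.
move=> e0; have [s c0] := exists_derive2_neq0 sm np.
set c := derive1 (derive1 sigma) s in c0.
have c1 : 0 < `|c| by rewrite normr_gt0.
have ec : 0 < e / 2 * `|c| by rewrite mulr_gt0// divr_gt0.
have [h h0 hP] := second_difference s sm M ec.
have [k k0 kP] := net_approx_sigma.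
pose w := (c * h ^+ 2)^-1.
have w0 : w != 0 by rewrite invr_neq0// mulf_neq0// expf_neq0// lt0r_neq0.
have w1 : 0 < `|w| by rewrite normr_gt0.
(* Two activated copies, each with error k h e' and scaled by [w], consume e / 2; the second
   difference consumes the other half. *)
exists (e / 2 / (`|w| * (2 * (k * h)))) => [|L f fM fe].
  by rewrite !divr_gt0// !mulr_gt0.
have n1 := kP L f h s _ fe; have n2 := kP L f (- h) s _ fe.
have n3 := net_approx_add 1 n1 n2.
have n4 := net_approx_affine w (- (2 * sigma s * w)) n3.
have E : e = `|w| * (k * (`|h| * (e / 2 / (`|w| * (2 * (k * h))))) +
    `|1| * (k * (`|- h| * (e / 2 / (`|w| * (2 * (k * h))))))) + e / 2.
  rewrite normrN normr1 (gtr0_norm h0); field.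
  by rewrite !lt0r_neq0.
rewrite [e]E; apply: net_approx_close n4 _ => x Kx.
have := hP _ (fM x Kx); rewrite -/c.
rewrite -(ler_pM2r (_ : 0 < `|c^-1|)) ?normr_gt0 ?invr_neq0//.
rewrite -normrM normfV mulfK ?gt_eqF//.
rewrite (_ : (_ - _) * c^-1 = - (f x ^+ 2 - (w * (sigma (h * f x + s) +
  1 * sigma (- h * f x + s)) + - (2 * sigma s * w)))); first by rewrite normrN.
rewrite /w ![_ + s]addrC mulNr; field.
by rewrite c0 lt0r_neq0.
Qed.

(** The identity costs one layer by polarization: f = ((f + 1)^2 - (f - 1)^2) / 4. *)
Lemma net_approx_succ M e : 0 < e -> exists2 e', 0 < e' &
  forall L f, (forall x, K x -> `|f x| <= M) -> net_approx L f e' ->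
    net_approx L.+1 f e.
Proof.
move=> e0.
have [e' e'0 sq] := net_approx_sqr (M + 1) (divr_gt0 e0 (ltr0Sn R 1) : 0 < e / 2).
exists e' => // L f fM fe.
have sh b : `|b| <= 1 -> net_approx L.+1 (fun x => (1 * f x + b) ^+ 2) (e / 2).
  move=> b1; apply: sq => [x Kx|].
    by rewrite mul1r (le_trans (ler_normD _ _))// lerD// fM.
  by have := net_approx_affine 1 b fe; rewrite normr1 mul1r.
have p := sh 1; have m := sh (-1); rewrite normrN normr1 lexx in p m.
have := net_approx_affine 4^-1 0 (net_approx_add (-1) (p isT) (m isT)).
rewrite (_ : (fun x => _) = f); last by apply/funext => x; field.
apply: net_approx_le; rewrite normrN normr1 mul1r -splitr.
by rewrite ger0_norm// ler_piMl ?ltW// invf_lt1// ltr1n.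
Qed.

(* Asking for all large depths makes functions approximated at different
   depths addable, since only networks of equal depth run in parallel. *)
Definition net_class f := (exists M, forall x, K x -> `|f x| <= M) /\
  forall e, 0 < e -> exists L0, forall L, (L0 <= L)%N -> net_approx L f e.

Lemma net_class_depth0 f : (exists M, forall x, K x -> `|f x| <= M) ->
  (forall e, 0 < e -> net_approx 0 f e) -> net_class f.
Proof.
move=> fM f0; split=> //; suff H L : forall e, 0 < e -> net_approx L f e.
  by move=> e e0; exists 0%N => L _; exact: H.
elim: L => // L ih e e0; have [M MP] := fM.
by have [e' e'0 P] := net_approx_succ M e0; apply: P => //; exact: ih.
Qed.

Lemma net_class_const c : net_class (fun=> c).
Proof.
split; first by exists `|c|.
by move=> e e0; exists 0%N => L _; apply: net_approx_const; exact: ltW.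
Qed.

Lemma net_class_lin f g t : net_class f -> net_class g ->
  net_class (fun x => f x + t * g x).
Proof.
move=> [[M1 f1] fe] [[M2 g1] ge]; split.
  exists (M1 + `|t| * M2) => x Kx.
  by rewrite (le_trans (ler_normD _ _))// lerD ?f1// normrM ler_wpM2l// g1.
move=> e e0; have t1 : 0 < `|t| + 1 by rewrite ltr_wpDl.
have [L1 P1] := fe (e / 2) (divr_gt0 e0 (ltr0Sn R 1)).
have [L2 P2] := ge (e / 2 / (`|t| + 1)) (divr_gt0 (divr_gt0 e0 (ltr0Sn R 1)) t1).
exists (maxn L1 L2) => L; rewrite geq_max => /andP[/P1 n1 /P2 n2].
apply: net_approx_le (net_approx_add t n1 n2).
rewrite [leRHS](splitr e) lerD2l mulrCA ler_piMr ?divr_ge0 ?ltW//.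
by rewrite ltr_pdivrMr// mul1r ltrDl.
Qed.

Lemma net_class_sqr f : net_class f -> net_class (fun x => f x ^+ 2).
Proof.
move=> [[M fM] fe]; split.
  exists (M ^+ 2) => x Kx.
  by rewrite normrX lerXn2r ?nnegrE ?fM// (le_trans _ (fM x Kx)).
move=> e e0; have [e' e'0 P] := net_approx_sqr M e0.
have [L0 L0P] := fe e' e'0; exists L0.+1 => -[//|L] L0L.
by apply: P => //; exact: L0P.
Qed.

Lemma net_class_limit f : (forall e, 0 < e -> exists2 g, net_class g &
  forall x, K x -> `|f x - g x| <= e) -> net_class f.
Proof.
move=> H; split.
  have [g [[M gM] _] fg] := H 1 ltr01; exists (1 + M) => x Kx.
  by rewrite -[f x](subrK (g x)) (le_trans (ler_normD _ _))// lerD ?fg// gM.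
move=> e e0; have e2 : 0 < e / 2 by rewrite divr_gt0.
have [g [_ gC] fg] := H _ e2; have [L0 L0P] := gC _ e2.
exists L0 => L /L0P ga; rewrite [e]splitr; exact: net_approx_close ga fg.
Qed.

End network_approximation.

(** * Polynomial approximation of the absolute value *)

Section absolute_value_polynomials.
Variable R : realType.

(** The classical iteration for the square root of [u ^+ 2], known from proofs of the
    Stone-Weierstrass theorem. It uses only linear combinations and squares, the operations under
    which [net_class] is closed. *)
Fixpoint abs_iter n (u : R) : R :=
  if n is m.+1 then abs_iter m u + 2^-1 * (u ^+ 2 - abs_iter m u ^+ 2) else 0.

(** With t = |u| and p the current iterate, the error r = t - p becomes r (1 - (t + p) / 2), at most
    r (1 - r / 2); the map b -> b (1 - b / 2) increases on [0, 1] and sends 2 / (n + 2) below 2 / (n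
    + 3). *)
Lemma abs_iter_bound n u : `|u| <= 1 ->
  0 <= abs_iter n u <= `|u| /\ `|u| - abs_iter n u <= 2 / n.+2%:R.
Proof.
move=> u1; elim: n => [|n [/andP[p0 p1] p2]] /=.
  by rewrite lexx normr_ge0 subr0 divff// pnatr_eq0.
rewrite -[u ^+ 2]real_normK ?num_real//.
move: `|u| (abs_iter n u) (normr_ge0 u) u1 p0 p1 p2 => t p t0 t1 p0 p1 p2.
have tp := mulr_ge0 (_ : 0 <= t - p) (_ : 0 <= t + p).
have {}tp : 0 <= (t - p) * (t + p) by apply: tp; lra.
have tp2 : 0 <= (t - p) * (1 - (t + p) / 2) by apply: mulr_ge0; lra.
split; first by apply/andP; split; lra.
have n2 : (0 : R) < n.+2%:R by [].
have n3 : (0 : R) < n.+3%:R by [].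
have b1 : 2 / n.+2%:R <= 1 :> R by rewrite ler_pdivrMr// mul1r ler_nat.
apply: (@le_trans _ _ (2 / n.+2%:R * (1 - 2 / n.+2%:R / 2))).
  move: (2 / n.+2%:R) p2 b1 => b p2 b1.
  have h1 : 0 <= (b - (t - p)) * (1 - (b + (t - p)) / 2) by apply: mulr_ge0; lra.
  have h2 : 0 <= p * (t - p) by apply: mulr_ge0; lra.
  by lra.
rewrite ler_pdivlMr// (_ : _ * n.+3%:R = 2 * ((n.+2%:R ^+ 2 - 1) / n.+2%:R ^+ 2)).
  by rewrite ler_piMr// ler_pdivrMr ?exprn_gt0// mul1r gerBl.
have -> : n.+3%:R = n.+2%:R + 1 :> R by rewrite natr1.
by field; rewrite lt0r_neq0.
Qed.

End absolute_value_polynomials.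

(** * Lattice operations and uniform approximation of continuous functions *)

Section network_density.
Variables (R : realType) (sigma : R -> R) (X : choiceType) (K : set X).
Variable base : forall m : nat, (X -> 'cV[R]_m) -> Prop.
Hypothesis base0 : exists psi : X -> 'cV[R]_0, base psi.
Hypothesis base_col : forall m1 m2 (psi1 : X -> 'cV[R]_m1) (psi2 : X -> 'cV[R]_m2),
  base psi1 -> base psi2 -> base (fun x => col_mx (psi1 x) (psi2 x)).
Hypotheses (sm : smooth sigma) (np : ~ polynomial_fun sigma) (lip : lipschitz sigma).
Implicit Types (f g : X -> R) (L : nat).
Local Notation net_class := (net_class sigma K base).

Lemma net_class_scale f c : net_class f -> net_class (fun x => c * f x).
Proof.
move=> fC; have := net_class_lin base_col c (net_class_const sigma K base0 0) fC.
by under eq_fun do rewrite add0r.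
Qed.

Lemma net_class_add f g : net_class f -> net_class g -> net_class (fun x => f x + g x).
Proof.
by move=> fC gC; have := net_class_lin base_col 1 fC gC; under eq_fun do rewrite mul1r.
Qed.

Lemma net_class_sub f g : net_class f -> net_class g -> net_class (fun x => f x - g x).
Proof.
by move=> fC gC; have := net_class_lin base_col (-1) fC gC; under eq_fun do rewrite mulN1r.
Qed.

Lemma net_class_sum (I : Type) (s : seq I) (f : I -> X -> R) :
  (forall i, net_class (f i)) -> net_class (fun x => \sum_(i <- s) f i x).
Proof.
move=> fC; elim: s => [|i s ih].
  by under eq_fun do rewrite big_nil; exact: net_class_const.
by under eq_fun do rewrite big_cons; exact: net_class_add.
Qed.

Lemma net_class_abs f : net_class f -> net_class (fun x => `|f x|).
Proof.
move=> fC; have [[M fM] _] := fC.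
have M0 : 0 < `|M| + 1 by rewrite ltr_wpDl.
pose u x := (`|M| + 1)^-1 * f x.
have uC : net_class u by exact: net_class_scale.
have u1 x : K x -> `|u x| <= 1.
  move=> Kx; rewrite /u normrM (gtr0_norm (_ : 0 < (`|M| + 1)^-1)) ?invr_gt0//.
  rewrite mulrC ler_pdivrMr// mul1r (le_trans (fM x Kx))//.
  by rewrite (le_trans (ler_norm M))// lerDl.
have pC n : net_class (fun x => abs_iter n (u x)).
  elim: n => [|n ih] /=; first exact: net_class_const.
  apply: net_class_add => //; apply: net_class_scale.
  by apply: net_class_sub; exact: net_class_sqr.
suff absu : net_class (fun x => `|u x|).
  have := net_class_scale (`|M| + 1) absu; congr net_class; apply/funext => x.
  rewrite /u normrM (gtr0_norm (_ : 0 < (`|M| + 1)^-1)) ?invr_gt0//.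
  by rewrite mulrA divff ?mul1r// lt0r_neq0.
apply: (net_class_limit) => e e0.
pose n := Num.truncn (2 / e).
exists (fun x => abs_iter n (u x)) => // x Kx.
have [/andP[_ h1] h2] := abs_iter_bound n (u1 x Kx).
rewrite ger0_norm ?subr_ge0//; apply: (le_trans h2).
rewrite ler_pdivrMr// mulrC -ler_pdivrMr//.
rewrite (le_trans (ltW (truncnS_gt _)))// ler_nat.
by rewrite leqnSn.
Qed.

Lemma net_class_max f g : net_class f -> net_class g ->
  net_class (fun x => Num.max (f x) (g x)).
Proof.
move=> fC gC; rewrite (_ : (fun x => _) = (fun x => 2^-1 * (f x + g x + `|f x - g x|))).
  apply: net_class_scale; apply: net_class_add; first exact: net_class_add.
  by apply: net_class_abs; exact: net_class_sub.
by apply/funext => x; rewrite maxr_absE mulrC.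
Qed.

(** For a given [A], a centre is either near, where [F] varies little and the penalty only lowers
    the value, or far, where the penalty outweighs [F]; this bounds the maximum from above. The
    bound from below needs a single centre, one that covers [A]. The last hypothesis is compactness,
    with a radius depending on the centre. *)
Lemma net_class_dense (D : X -> X -> R) (F : X -> R) :
  (forall B, K B -> net_class (D B)) ->
  (forall A B, 0 <= D B A) ->
  (forall B e, K B -> 0 < e -> exists2 del, 0 < del &
    forall A, K A -> D B A <= del -> `|F A - F B| <= e) ->
  (forall rho : X -> R, (forall B, 0 < rho B) -> exists s : seq X,
    (forall B, B \in s -> K B) /\
    forall A, K A -> exists2 B, B \in s & D B A <= rho B) ->
  net_class F.
Proof.
move=> DC D0 FC cover.
have mod e : 0 < e -> exists del : X -> R, forall B, 0 < del B /\
    (K B -> forall A, K A -> D B A <= del B -> `|F A - F B| <= e).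
  move=> e0; suff /choice[del H] B : exists del : R, 0 < del /\
      (K B -> forall A, K A -> D B A <= del -> `|F A - F B| <= e).
    by exists del.
  (* Outside [K] the radius is set to 1, because [cover] asks for positive radii on all of [X]. *)
  have [KB|nKB] := pselect (K B); last by exists 1.
  by have [del del0 H] := FC B e KB e0; exists del.
have [M M0 FM] : exists2 M, 0 < M & forall A, K A -> `|F A| <= M.
  have [del delP] := mod 1 ltr01.
  have [s [sK sP]] := cover del (fun B => (delP B).1).
  exists (\sum_(B <- s) `|F B| + 1); first by rewrite ltr_wpDl// sumr_ge0.
  move=> A KA; have [B sB DB] := sP A KA.
  have FAB := (delP B).2 (sK B sB) A KA DB.
  have : `|F B| <= \sum_(B <- s) `|F B| by rewrite (big_rem B)//= lerDl sumr_ge0.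
  have := ler_normD (F A - F B) (F B); rewrite subrK; lra.
apply: (net_class_limit) => e e0.
have e2 : 0 < e / 2 by rewrite divr_gt0.
have [del delP] := mod _ e2.
(* Where [D B A] reaches [del B] the penalty is 2 M, which brings [F B], at most [M], down to [- M]
   or below. *)
pose c B := 2 * M / del B.
have c0 B : 0 < c B by rewrite divr_gt0 ?mulr_gt0//; have [] := delP B.
(* Within this radius the variation of [F] and the penalty each cost at most e / 2. *)
pose rho B := Num.min (del B) (e / 2 / c B).
have rho0 B : 0 < rho B by rewrite lt_min (delP B).1 divr_gt0.
have [s [sK sP]] := cover rho rho0.
(* The start value [- M] is a lower bound of [F] on [K], so it does not spoil the upper bound on the
   maximum. *)
pose g r A := foldr (fun B acc => Num.max (F B - c B * D B A) acc) (- M) r.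
have gC r : (forall B, B \in r -> K B) -> net_class (g r).
  elim: r => [|B r ih] rK; first exact: net_class_const.
  apply: net_class_max; last by apply: ih => C Cr; apply: rK; rewrite inE Cr orbT.
  apply: net_class_sub; first exact: net_class_const.
  by apply/net_class_scale/DC/rK; rewrite mem_head.
exists (g s); first exact: gC.
move=> A KA.
have FAM := FM A KA.
have up r : (forall B, B \in r -> K B) -> g r A <= F A + e / 2.
  elim: r => [|B r ih] rK /=.
    by have := FAM; rewrite ler_norml => /andP[]; lra.
  rewrite ge_max ih ?andbT; last by move=> C Cr; apply: rK; rewrite inE Cr orbT.
  have KB : K B by apply: rK; rewrite mem_head.
  have [DB|DB] := leP (D B A) (del B).
    have := (delP B).2 KB A KA DB; rewrite ler_norml => /andP[+ _].
    have := mulr_ge0 (ltW (c0 B)) (D0 A B); lra.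
  have : 2 * M <= c B * D B A.
    by rewrite /c mulrAC ler_pdivlMr ?(delP B).1// ler_pM2l ?mulr_gt0// ltW.
  have := FM B KB; have := FAM; rewrite !ler_norml => /andP[+ _] /andP[_ +]; lra.
have low r B : B \in r -> F B - c B * D B A <= g r A.
  elim: r => //= C r ih; rewrite inE => /orP[/eqP ->|/ih h]; rewrite le_max ?lexx//.
  by rewrite h orbT.
have [B sB DB] := sP A KA.
have := up s sK; have := low s B sB.
have DB1 : D B A <= del B by rewrite (le_trans DB)// ge_min lexx.
have := (delP B).2 (sK B sB) A KA DB1; rewrite ler_norml => /andP[_ +].
have : c B * D B A <= e / 2.
  by rewrite mulrC -ler_pdivlMr// (le_trans DB)// ge_min lexx orbT.
move=> h1 h2 h3 h4; rewrite ler_norml; apply/andP; split; lra.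
Qed.

End network_density.

(** * Features computed by the first layer *)

Section bounded_fields.
Variables (R : realType) (d : nat).
Local Notation mu := (torus R d).

Lemma Lp_ooP m n (F : 'rV[R]_d -> 'M[R]_(m, n)) : Lp +oo F <->
  [/\ periodic F, measurable_fun setT F &
      exists M, {ae mu, forall x, frob (F x) <= M}].
Proof.
have mu1 : (0 < mu [set: 'rV[R]_d])%E by rewrite probability_setT lte01.
split=> [[pF mF]|[pF mF [M FM]]].
  rewrite unlock mu1 => ey; split=> //.
  have [y ly _] : exists2 y : R,
      (ess_sup mu (abse \o [eta EFin \o (fun x => frob (F x))]) <= y%:E)%E & True.
    case: (ess_sup _ _) ey => [r _|//|_]; first by exists r.
    by exists 0; rewrite ?leNye.
  exists y; move/ess_supP : ly; apply: filterS => x /=.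
  by rewrite lee_fin ger0_norm// frob_ge0.
split=> //; rewrite unlock mu1; apply: (@le_lt_trans _ _ M%:E); last exact: ltry.
by apply/ess_supP; apply: filterS FM => x /=; rewrite lee_fin ger0_norm// frob_ge0.
Qed.

Lemma Lp_oo_entries m n (F : 'rV[R]_d -> 'M[R]_(m, n)) M : periodic F ->
  (forall i j, measurable_fun setT (fun x => F x i j)) ->
  {ae mu, forall x, forall i j, `|F x i j| <= M} -> Lp +oo F.
Proof.
move=> pF mF FM; apply/Lp_ooP; split=> //; first exact/measurable_fun_mxP.
exists (Num.sqrt (\sum_(i < m) \sum_(j < n) M ^+ 2)); apply: filterS FM => x FM.
rewrite /frob ler_wsqrtr//; apply: ler_sum => i _; apply: ler_sum => j _.
by rewrite -[leLHS]real_normK ?num_real// lerXn2r ?nnegrE// (le_trans _ (FM i j)).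
Qed.

Lemma Lp_oo_cst m n (C : 'M[R]_(m, n)) : Lp +oo (fun _ : 'rV[R]_d => C).
Proof.
by apply/Lp_ooP; split=> //; exists (frob C); apply: aeW.
Qed.

Lemma Lp_oo_col_mx m1 m2 (b1 : 'rV[R]_d -> 'cV[R]_m1) (b2 : 'rV[R]_d -> 'cV[R]_m2) :
  Lp +oo b1 -> Lp +oo b2 -> Lp +oo (fun x => col_mx (b1 x) (b2 x)).
Proof.
move=> /Lp_ooP[p1 m1' [M1 B1]] /Lp_ooP[p2 m2' [M2 B2]].
apply: (@Lp_oo_entries _ _ _ (Num.max M1 M2)) => [x i|i j|].
- by rewrite p1 p2.
- case: (split_ordP i) => k ->.
    under eq_fun do rewrite col_mxEu.
    by move/measurable_fun_mxP : m1'; exact.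
  under eq_fun do rewrite col_mxEd.
  by move/measurable_fun_mxP : m2'; exact.
- apply: filterS2 B1 B2 => x B1 B2 i j; rewrite le_max.
  case: (split_ordP i) => k ->; rewrite ?col_mxEu ?col_mxEd; apply/orP; [left|right].
    exact: le_trans (norm_entry_le_frob _ _ _) B1.
  exact: le_trans (norm_entry_le_frob _ _ _) B2.
Qed.

End bounded_fields.

(** * Finite covers of a compact set of fields *)

Section compact_cover_L2.
Variables (R : realType) (d : nat).

Lemma Lp2_zero : Lp 2%:E (fun _ : 'rV[R]_d => (0 : 'M[R]_d)).
Proof.
apply/Lp2P; split=> // i j; under eq_fun do rewrite mxE; exact: L2_cst.
Qed.

(* [compact_cover] is only available on pointed topological types. *)
#[local] HB.instance Definition _ := isPointed.Build (L2_field R d) (L2Field Lp2_zero).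

Lemma compact_ball_cover (K : set (L2_field R d)) (r : L2_field R d -> R) :
  compact K -> (forall B, 0 < r B) -> exists s : seq (L2_field R d),
    (forall B, B \in s -> K B) /\
    forall A, K A -> exists2 B, B \in s & (L2_dist B A < (r B)%:E)%E.
Proof.
move=> cK r0.
(* Interiors of balls supply the open sets of the cover, since a ball is only known to be a
   neighbourhood of its centre. *)
move: cK; rewrite compact_cover => /(_ _ K (fun B => (ball B (r B))°)).
move=> [||D DK KD].
- by move=> B _; exact: open_interior.
- by move=> B KB; exists B => //; rewrite /interior; exact: nbhsx_ballx.
exists (finmap.enum_fset D); split=> [B BD|A KA].
  exact: set_mem (DK B BD).
by have [B BD AB] := KD A KA; exists B => //; exact: (interior_subset AB).
Qed.

End compact_cover_L2.

Section features.
Variables (R : realType) (d : nat) (sigma : R -> R).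
Local Notation mu := (torus R d).
Hypotheses (sm : smooth sigma) (np : ~ polynomial_fun sigma) (lip : lipschitz sigma).

(** What the zero Fourier mode of the second layer reads off the output of the first: [W] comes from
    the lifting and [b] is the bias function. *)
Definition feature m (W : 'M[R]_(m, d * d)) (b : 'rV[R]_d -> 'cV[R]_m)
    (A : 'rV[R]_d -> 'M[R]_d) : 'cV[R]_m :=
  \col_i \int[mu]_x sigma ((W *m (mxvec (A x))^T + b x) i 0).

Definition feature_map m (psi : L2_field R d -> 'cV[R]_m) :=
  exists (W : 'M[R]_(m, d * d)) (b : 'rV[R]_d -> 'cV[R]_m),
    Lp +oo b /\ psi = (fun A : L2_field R d => feature W b A).

Lemma feature_map0 : exists psi : L2_field R d -> 'cV[R]_0, feature_map psi.
Proof.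
by eexists; exists 0, (fun=> 0); split; [exact: Lp_oo_cst|].
Qed.

Lemma feature_map_col m1 m2 (psi1 : L2_field R d -> 'cV[R]_m1)
    (psi2 : L2_field R d -> 'cV[R]_m2) : feature_map psi1 -> feature_map psi2 ->
  feature_map (fun A => col_mx (psi1 A) (psi2 A)).
Proof.
move=> [W1 [b1 [B1 ->]]] [W2 [b2 [B2 ->]]].
exists (col_mx W1 W2), (fun x => col_mx (b1 x) (b2 x)); split.
  exact: Lp_oo_col_mx.
apply/funext => A; apply/colP => i.
case: (split_ordP i) => k ->; rewrite ?col_mxEu ?col_mxEd !mxE;
  apply: eq_Rintegral => x _; congr sigma.
  by rewrite mul_col_mx add_col_mx col_mxEu.
by rewrite mul_col_mx add_col_mx col_mxEd.
Qed.

Lemma L2_field_entry (A : L2_field R d) i j : (fun x => A x i j) \in Lfun mu 2%:E.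
Proof. by have /Lp2P[_ AL] := field_L2 A; exact: AL. Qed.

Lemma continuous_sigma : continuous sigma.
Proof.
by move=> x; have /derivable1_diffP/differentiable_continuous := @sm 0%N x.
Qed.

Lemma rint_sigma (f : 'rV[R]_d -> R) : f \in Lfun mu 2%:E ->
  rint mu (fun x => sigma (f x)).
Proof.
move=> fL; have [k k0 kP] := lipschitz_bound lip.
apply: (@rint_le _ _ _ _ _ (fun x => `|sigma 0| + k * `|f x|)).
- apply: (measurableT_comp (continuous_measurable_fun continuous_sigma)).
  exact: L2_meas fL.
- apply: rintD; first exact: rint_cst.
  by apply/rintZ/rint_norm/L2_rint.
- move=> x; rewrite -[sigma (f x)](subrK (sigma 0)) (le_trans (ler_normD _ _))//.
  by rewrite addrC lerD2l (le_trans (kP _ _))// subr0.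
Qed.

Variables (alpha beta : R).
Hypotheses (alpha0 : 0 < alpha) (alpha_beta : alpha <= beta).
Variable K : set (L2_field R d).
Hypothesis KPD : forall A, K A -> PD alpha beta A.
Local Notation net_class := (net_class sigma K feature_map).

(** The row [W] selects one entry and scales it by [t], while s - t B_ik(x) goes into the bias,
    admissible because a member of [PD] has bounded entries. The network on top is the identity, so
    the error is 0. *)
Lemma net_approx_entry_shift (B : L2_field R d) i k s t : K B ->
  net_approx sigma K feature_map 0
    (fun A : L2_field R d => \int[mu]_x sigma (s + t * (A x i k - B x i k))) 0.
Proof.
move=> KB; have [[pB mB _] _ _] := KPD KB.
have [_ bB] := PD_bounded alpha0 (KPD KB).
pose W : 'M[R]_(1, d * d) := \row_q (t * (q == mxvec_index i k)%:R).
pose b x : 'cV[R]_1 := (s - t * B x i k)%:M.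
exists 1%N, (fun A : L2_field R d => feature W b A), (MlpLast 1%:M 0).
have mBik : measurable_fun setT (fun x => B x i k).
  by move/measurable_fun_mxP : mB; exact.
split=> //.
- exists W, b; split=> //.
  apply: (@Lp_oo_entries _ _ _ _ _ (`|s| + `|t| * beta)) => [x j|j l|].
  + by rewrite /b pB.
  + rewrite (ord1 j) (ord1 l); under eq_fun do rewrite mxE eqxx mulr1n.
    by apply: measurable_funB => //; exact: measurable_funM.
  + apply: filterS bB => x bB j l; rewrite (ord1 j) (ord1 l) mxE eqxx mulr1n.
    by rewrite (le_trans (ler_normB _ _))// lerD2l normrM ler_wpM2l.
- move=> A KA /=; rewrite mul1mx addr0 mxE.
  rewrite -[leLHS]/(`|_ - _|) (_ : \int[mu]_x _ =
    \int[mu]_x sigma (s + t * (A x i k - B x i k))) ?subrr ?normr0//.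
  apply: eq_Rintegral => x _; congr sigma; rewrite !mxE eqxx mulr1n.
  rewrite (bigD1 (mxvec_index i k))//= big1 ?addr0; last first.
    by move=> q qn; rewrite !mxE (negbTE qn) mulr0 mul0r.
  by rewrite !mxE eqxx mulr1 -[_ 0 (mxvec_index i k)]/(mxvec (A x) 0 _) mxvecE; ring.
Qed.

Lemma entry_diff_bound (A B : L2_field R d) i k : K A -> K B ->
  {ae mu, forall x, `|A x i k - B x i k| <= 2 * beta}.
Proof.
move=> KA KB; have [_ bA] := PD_bounded alpha0 (KPD KA).
have [_ bB] := PD_bounded alpha0 (KPD KB).
apply: filterS2 bA bB => x bA bB.
by rewrite (le_trans (ler_normB _ _))// mulr2n mulrDl mul1r lerD.
Qed.

(** The second difference of [sigma] is applied under the integral to the entry difference, which is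
    almost everywhere at most 2 beta in absolute value; the mean is then within [e] of the squared
    norm. Depth 0 suffices, the activation being already in the features. *)
Lemma net_class_entry_dist (B : L2_field R d) i k : K B ->
  net_class (fun A : L2_field R d => n2 mu (fun x => A x i k - B x i k)).
Proof.
move=> KB.
have diffL (A : L2_field R d) : (fun x => A x i k - B x i k) \in Lfun mu 2%:E.
  by apply: L2B; exact: L2_field_entry.
apply: net_class_depth0 => //.
- exact: feature_map0.
- exact: feature_map_col.
- exists (n2 mu (fun=> 2 * beta)) => A KA; rewrite ger0_norm ?n2_ge0//.
  apply: n2_le_ae => //; first exact: L2_cst.
  by apply: filterS (entry_diff_bound i k KA KB) => x h; rewrite (le_trans h)// ler_norm.
move=> e e0; have [s c0] := exists_derive2_neq0 sm np.
set c := derive1 (derive1 sigma) s in c0.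
have c1 : 0 < `|c| by rewrite normr_gt0.
have ec : 0 < e * `|c| by rewrite mulr_gt0.
have [h h0 hP] := second_difference s sm (2 * beta) ec.
pose w := (c * h ^+ 2)^-1.
have n1 := net_approx_entry_shift i k s h KB.
have n2' := net_approx_entry_shift i k s (- h) KB.
have n3 := net_approx_add feature_map_col 1 n1 n2'.
have n4 := net_approx_affine feature_map0 feature_map_col w (- (2 * sigma s * w)) n3.
rewrite mulr0 addr0 mulr0 in n4.
rewrite -[e]add0r; apply: (net_approx_close n4) => A KA.
have i1 : rint mu (fun x => sigma (s + h * (A x i k - B x i k))).
  by apply: rint_sigma; apply: L2D; [exact: L2_cst|exact: L2Z].
have i2 : rint mu (fun x => sigma (s + - h * (A x i k - B x i k))).
  by apply: rint_sigma; apply: L2D; [exact: L2_cst|exact: L2Z].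
have i3 := L2_sqr (diffL A).
have i4 := rint_cst mu (2 * sigma s * w).
rewrite /n2 mul1r -intD// -intZ; last exact: rintD.
have -> : - (2 * sigma s * w) = \int[mu]_x (- (2 * sigma s * w)) by rewrite int_cst.
have i5 := rintZ w (rintD i1 i2).
have i6 := rint_cst mu (- (2 * sigma s * w)).
rewrite -intD// -intB//; last exact: rintD.
have i7 := rintB i3 (rintD i5 i6).
apply: (le_trans (int_norm i7)).
rewrite -[leRHS](int_cst mu); apply: int_le_ae; [exact: rint_norm|exact: rint_cst|].
apply: filterS (entry_diff_bound i k KA KB) => x /hP; rewrite -/c.
set a := A x i k - B x i k.
rewrite -(ler_pM2r (_ : 0 < `|c^-1|)) ?normr_gt0 ?invr_neq0//.
rewrite -normrM normfV mulfK ?gt_eqF//.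
rewrite (_ : (_ - _) * c^-1 = - (a ^+ 2 - (w * (sigma (s + h * a) +
  sigma (s + - h * a)) + - (2 * sigma s * w)))); first by rewrite normrN.
rewrite /w mulNr; field.
by rewrite c0 lt0r_neq0.
Qed.

Definition L2_sqdist (B A : L2_field R d) : R :=
  \sum_i \sum_k n2 mu (fun x => A x i k - B x i k).

Lemma L2_sqdist_ge0 A B : 0 <= L2_sqdist B A.
Proof. by do 2 (apply: sumr_ge0 => ? _); exact: n2_ge0. Qed.

Lemma L2_sqdist_class B : K B -> net_class (L2_sqdist B).
Proof.
move=> KB; have b0 := feature_map0; have bc := feature_map_col.
apply: net_class_sum => // i; apply: net_class_sum => // k.
exact: net_class_entry_dist.
Qed.

(** Passage from the extended-real norm of the pseudometric to the sum of squared norms of the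
    entries, which is what networks approximate; hence the square root on the radius. *)
Lemma L2_sqdist_lt A B e : 0 < e -> (L2_dist B A < (Num.sqrt e)%:E)%E ->
  L2_sqdist B A <= e.
Proof.
move=> e0 dAB.
have sE : (\int[mu]_x (`|frob (B x - A x)| `^ 2)%:E)%E = (L2_sqdist B A)%:E.
  have diffL i k : (fun x => A x i k - B x i k) \in Lfun mu 2%:E.
    by apply: L2B; exact: L2_field_entry.
  have ri i : rint mu (fun x => \sum_k (A x i k - B x i k) ^+ 2).
    by apply: rint_sum => k; exact: L2_sqr.
  transitivity (\int[mu]_x (\sum_i \sum_k (A x i k - B x i k) ^+ 2)%:E)%E.
    apply: eq_integral => x _; congr EFin.
    rewrite powR_mulrn// real_normK ?num_real// sqr_frob pair_bigA/=.
    by apply: eq_bigr => p _; rewrite !mxE; ring.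
  rewrite -(fineK (integrable_fin_num measurableT (rint_sum _ ri))); congr EFin.
  rewrite -/(Rintegral _ _ _) int_sum//; apply: eq_bigr => i _.
  by rewrite int_sum// => k; exact: L2_sqr.
have := powR_Lnorm mu (EFin \o (fun x => frob (B x - A x))) (_ : (2 : R) != 0).
rewrite pnatr_eq0 => /(_ isT).
rewrite -/(L2_dist B A) sE; move: dAB (Lnorm_ge0 mu 2%:E (EFin \o (fun x => frob (B x - A x)))).
rewrite -/(L2_dist B A); case: (L2_dist B A) => [r| |]//=.
rewrite lte_fin lee_fin => re r0 [<-].
rewrite powR_mulrn// -[leRHS]sqr_sqrtr; last exact: ltW.
apply: lerXn2r; rewrite ?nnegrE ?sqrtr_ge0//.
exact: ltW.
Qed.

Lemma compact_L2_cover (rho : L2_field R d -> R) : compact K ->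
  (forall B, 0 < rho B) -> exists s : seq (L2_field R d),
    (forall B, B \in s -> K B) /\
    forall A, K A -> exists2 B, B \in s & L2_sqdist B A <= rho B.
Proof.
move=> cK rho0.
have r0 B : 0 < Num.sqrt (rho B) by rewrite sqrtr_gt0.
have [s [sK sP]] := compact_ball_cover cK r0.
exists s; split=> // A KA; have [B sB BA] := sP A KA; exists B => //.
exact: L2_sqdist_lt.
Qed.

End features.

(** * Realization by Fourier neural operators *)

Section fourier_mean.
Local Open Scope complex_scope.
Variables (R : realType) (d : nat).
Local Notation mu := (torus R d).

Lemma low_freqs0 : @low_freqs d 0 = [set 0].
Proof.
apply/seteqP; split => [k /= k0|_ ->].
  apply/rowP => i; rewrite mxE; apply/eqP; rewrite -sqrf_eq0 eq_le sqr_ge0 andbT.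
  apply: le_trans k0; rewrite (bigD1 i)//= lerDl.
  by apply: sumr_ge0 => j _; exact: sqr_ge0.
by rewrite /low_freqs /= big1// => i _; rewrite mxE expr0n.
Qed.

Definition mean_field n (v : 'rV[R]_d -> 'cV[R]_n) : 'cV[R]_n :=
  \col_i \int[mu]_x v x i 0.

(** The zero frequency has basis function 1, and its coefficient is the mean, without imaginary
    part. A real matrix then keeps the output real, as [multiplier_real] demands. *)
Lemma fourier_op_mean n (P : 'M[R]_n) (v : 'rV[R]_d -> 'cV[R]_n) x :
  fourier_op 0 (fun=> map_mx (real_complex R) P) v x =
  map_mx (real_complex R) (P *m mean_field v).
Proof.
rewrite /fourier_op low_freqs0 fsbig_set1 map_mxM.
have -> : fourier_basis 0 x = 1.
  by rewrite /fourier_basis phase0 cos0 sin0.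
rewrite scale1r; congr (_ *m _); apply/colP => j; rewrite !mxE.
congr (_ +i* _).
  by apply: eq_Rintegral => y _; rewrite phase0 cos0 mulr1.
rewrite (@eq_Rintegral _ _ _ _ _ (fun=> 0)) ?int_cst ?oppr0//.
by move=> y _; rewrite phase0 sin0 mulr0.
Qed.

Lemma fourier_mean_real n (P : 'M[R]_n) (v : 'rV[R]_d -> 'cV[R]_n) : Lp 2%:E v ->
  forall x l, complex.Im
    (fourier_op 0 (fun=> map_mx (real_complex R) P) v x l 0) = 0.
Proof. by move=> _ x l; rewrite fourier_op_mean mxE. Qed.

Definition mean_layer n (W P : 'M[R]_n) (b : 'rV[R]_d -> 'cV[R]_n)
    (bB : Lp +oo b) : fno_layer R d n 0 :=
  FnoLayer W bB (fourier_mean_real P).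

Lemma mean_layerE sigma n (W P : 'M[R]_n) b (bB : Lp +oo b) v x :
  layer_eval sigma (mean_layer W P bB) v x =
  map_mx sigma (W *m v x + P *m mean_field v + b x).
Proof.
rewrite /layer_eval /=; congr (map_mx sigma (_ + _ + _)).
by rewrite fourier_op_mean; apply/matrixP => i j; rewrite !mxE.
Qed.

End fourier_mean.

Section fno_realization.
Variables (R : realType) (d : nat) (sigma : R -> R).

(* The first layer applies sigma pointwise, the second one only sees the mean
   of its input, so the output is a constant field. *)
Lemma fno_of_mlp m n (W : 'M[R]_(m, d * d)) (b : 'rV[R]_d -> 'cV[R]_m)
    (N : mlp R m n) : (0 < m)%N -> (0 < mlp_depth N)%N -> Lp +oo b ->
  exists Phi : fno R d (d * d) n, forall (A : 'rV[R]_d -> 'M[R]_d) x,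
    fno_eval sigma Phi (fun y => (mxvec (A y))^T) x =
    mlp_eval sigma N (feature sigma W b A).
Proof.
(* The first affine map and activation of [N] become the second Fourier layer, and [rest] becomes
   the projection. *)
case: N W b => {m n} [//|m p n S t rest] W b m0 _ bB.
(* All Fourier layers share one width: the first [m] channels carry the features, the last [p] the
   first hidden layer of [N]. *)
have w0 : (0 < m + p)%N by rewrite addn_gt0 m0.
have [Q _ QE] := mlp_pre sigma rest (row_mx 0 1%:M : 'M[R]_(p, m + p)).
have bB0 : Lp +oo (fun x => col_mx (b x) (0 : 'cV[R]_p)).
  by apply: Lp_oo_col_mx => //; exact: Lp_oo_cst.
have bB1 : Lp +oo (fun x : 'rV[R]_d => col_mx (0 : 'cV[R]_m) t) by exact: Lp_oo_cst.
pose l0 := mean_layer 1%:M 0 bB0.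
pose l1 := mean_layer 0 (block_mx 0 0 S 0) bB1.
exists (@Fno R d (d * d) n (m + p) w0 0 (MlpLast (col_mx W 0) 0) [:: l0; l1] isT Q).
move=> A x; rewrite /fno_eval /= mean_layerE QE.
congr (mlp_eval sigma rest _).
rewrite mul0mx add0r -[mean_field _]vsubmxK mul_block_col !mul0mx !addr0.
rewrite add_col_mx map_col_mx mul_row_col mul0mx mul1mx add0r.
congr (map_mx sigma (S *m _ + t)); apply/colP => i; rewrite !mxE.
apply: eq_Rintegral => y _; rewrite mean_layerE mxE; congr sigma.
by rewrite mul1mx mul0mx !addr0 mul_col_mx add_col_mx col_mxEu.
Qed.

Variables (X : Type) (K : set X) (base : forall m : nat, (X -> 'cV[R]_m) -> Prop).
Hypothesis base0 : exists psi : X -> 'cV[R]_0, base psi.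
Hypothesis base_col : forall m1 m2 (psi1 : X -> 'cV[R]_m1) (psi2 : X -> 'cV[R]_m2),
  base psi1 -> base psi2 -> base (fun x => col_mx (psi1 x) (psi2 x)).

Lemma net_approx_vector L n (f : 'I_n -> X -> R) e :
  (forall i, net_approx sigma K base L (f i) e) ->
  exists m (psi : X -> 'cV[R]_m) (N : mlp R m n), [/\ base psi, mlp_depth N = L &
    forall x, K x -> forall i, `|mlp_eval sigma N (psi x) i 0 - f i x| <= e].
Proof.
elim: n f => [|n ih] f fe.
  have [psi bpsi] := base0; have [N dN _] := mlp_const sigma 0 L 0.
  have [N' dN' _] := mlp_post sigma N (0 : 'M[R]_(0, 1)) 0.
  by exists 0%N, psi, N'; split=> //; [rewrite dN'|move=> x _ []].
have [m1 [psi1 [N1 [b1 d1 a1]]]] := fe ord0.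
have [m2 [psi2 [N2 [b2 d2 a2]]]] := ih (fun i => f (lift ord0 i)) (fun i => fe _).
have [|N dN eN] := @mlp_par R sigma m1 1 N1 m2 n N2; first by rewrite d1 d2.
exists (m1 + m2)%N, (fun x => col_mx (psi1 x) (psi2 x)), N; split.
- exact: base_col.
- by rewrite dN d1.
move=> x Kx i; rewrite eN; case: (unliftP ord0 i) => [j ->|->].
  rewrite (_ : lift ord0 j = rshift 1 j); last exact: val_inj.
  rewrite [X in `|X - _|]col_mxEd (_ : rshift 1 j = lift ord0 j); last exact: val_inj.
  exact: a2.
rewrite (_ : ord0 = lshift n (0 : 'I_1)); last exact: val_inj.
rewrite [X in `|X - _|]col_mxEu (_ : lshift n 0 = ord0); last exact: val_inj.
exact: a1.
Qed.

End fno_realization.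

Theorem theorem3p4 (R : realType) (d : nat) (alpha beta : R) (sigma : R -> R)
    (K : set (L2_field R d)) (eps : R) :
  (0 < d)%N ->
  0 < alpha -> alpha <= beta ->
  lipschitz sigma -> ~ polynomial_fun sigma -> smooth sigma ->
  (forall A, K A -> PD alpha beta A) ->
  compact K ->
  0 < eps ->
  exists Phi : fno R d (d * d) (d * d),
    (forall A, K A -> Lp +oo%E (fno_eval_mx sigma Phi A)) /\
    (ereal_sup [set ereal_sup
        [set (frob (homogenized A - fno_eval_mx sigma Phi A x))%:E
          | x in [set: 'rV[R]_d]]
      | A in K] < eps%:E)%E.
Proof.
move=> d0 alpha0 alpha_beta lip np sm KPD cK eps0.
pose F (q : 'I_(d * d)) (A : L2_field R d) : R := mxvec (homogenized A) 0 q.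
have b0 := feature_map0 d sigma; have bc := @feature_map_col R d sigma.
have FC q : net_class sigma K (@feature_map R d sigma) (F q).
  apply: (net_class_dense b0 bc sm np lip (D := @L2_sqdist R d)).
  - by move=> B KB; exact: (L2_sqdist_class sm np lip alpha0 KPD KB).
  - exact: L2_sqdist_ge0.
  - move=> B e KB e0.
    have [del del0 H] := homogenized_continuous alpha0 alpha_beta (KPD B KB) e0.
    exists del => // A KA AB; have := H A (KPD A KA); rewrite /F.
    move: (homogenized A) (homogenized B) => MA MB {}H.
    case/mxvec_indexP: q => i j; rewrite !mxvecE; apply: H => k l.
    apply: le_trans AB; rewrite /L2_sqdist.
    rewrite (bigD1 k)//= (bigD1 l)//= -addrA lerDl addr_ge0//.
      by apply: sumr_ge0 => m _; exact: n2_ge0.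
    by apply: sumr_ge0 => m _; apply: sumr_ge0 => p _; exact: n2_ge0.
  - by move=> rho rho0; exact: compact_L2_cover.
have dR : (0 : R) < d%:R by rewrite ltr0n.
(* With d^2 entries each within [e], the Frobenius distance is at most d e = eps / 2. *)
pose e := eps / 2 / d%:R.
have e0 : 0 < e by rewrite !divr_gt0.
have /choice[L0 L0P] q : exists L0, forall L, (L0 <= L)%N ->
    net_approx sigma K (@feature_map R d sigma) L (F q) e by exact: (FC q).2.
(* One depth for all entries; the successor makes it positive, so that [N] has a hidden layer to
   move into the Fourier part. *)
pose L := (\max_q L0 q).+1.
have [m [psi [N [[W [b [bB psiE]]] dN aN]]]] : exists m (psi : L2_field R d -> 'cV[R]_m)
    (N : mlp R m (d * d)), [/\ feature_map sigma psi, mlp_depth N = L &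
    forall A, K A -> forall q, `|mlp_eval sigma N (psi A) q 0 - F q A| <= e].
  apply: net_approx_vector => // q; apply: L0P.
  by rewrite ltnW// ltnS; exact: leq_bigmax.
(* A dummy channel with zero weight and bias makes the number of features positive, since [m] may be
   0. *)
have bB1 : Lp +oo (fun x => col_mx (0 : 'cV[R]_1) (b x)).
  by apply: Lp_oo_col_mx => //; exact: Lp_oo_cst.
have [N' dN' eN'] := mlp_pre sigma N (row_mx 0 1%:M : 'M[R]_(m, 1 + m)).
have [|||Phi PhiE] := @fno_of_mlp R d sigma (1 + m) (d * d) (col_mx 0 W)
  (fun x => col_mx (0 : 'cV[R]_1) (b x)) N'.
- by [].
- by rewrite dN' dN.
- exact: bB1.
have out (A : L2_field R d) x : fno_eval_mx sigma Phi A x =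
    vec_mx (mlp_eval sigma N (psi A))^T.
  rewrite /fno_eval_mx PhiE eN'; congr (vec_mx (mlp_eval sigma N _)^T).
  rewrite psiE -[feature _ _ _ _]vsubmxK mul_row_col mul0mx mul1mx add0r.
  apply/colP => i; rewrite !mxE; apply: eq_Rintegral => y _; congr sigma.
  by rewrite mul_col_mx add_col_mx col_mxEd.
exists Phi; split=> [A KA|].
  rewrite (_ : fno_eval_mx sigma Phi A = (fun=> vec_mx (mlp_eval sigma N (psi A))^T)).
    exact: Lp_oo_cst.
  by apply/funext => x; exact: out.
(* The suprema inherit only a non-strict bound, so half of [eps] is kept in reserve. *)
apply: (@le_lt_trans _ _ (eps / 2)%:E); last first.
  by rewrite lte_fin ltr_pdivrMr// mulr2n mulrDr mulr1 ltrDl.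
apply: ge_ereal_sup => _ [A KA <-]; apply: ge_ereal_sup => _ [x _ <-].
rewrite lee_fin out -ler_sqr ?nnegrE ?frob_ge0//; last by rewrite divr_ge0// ltW.
have := aN A KA; rewrite /F; move: (homogenized A) (mlp_eval _ _ _) => H v Hv.
rewrite sqr_frob; apply: (@le_trans _ _ (\sum_(p : 'I_d * 'I_d) e ^+ 2)).
  apply: ler_sum => -[i j] _ /=; rewrite !mxE.
  rewrite -[leLHS]real_normK ?num_real//; apply: lerXn2r; rewrite ?nnegrE//.
    exact: ltW.
  by have := Hv (mxvec_index i j); rewrite mxvecE distrC.
rewrite sumr_const card_prod card_ord -[leLHS]mulr_natl natrM.
rewrite (_ : eps / 2 = d%:R * e); last by rewrite /e [RHS]mulrC divfK// lt0r_neq0.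
by have -> : (d%:R * e) ^+ 2 = d%:R * d%:R * e ^+ 2 by ring.
Qed.
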